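(* Let $L\subset L_2(E,\mu)$ be a closed subspace whose orthogonal projection operator $Q$ lies in $\mathscr I_{1,\mathrm{loc}}(E,\mu)$, let $V\subset L_{2,\mathrm{loc}}(E,\mu)$ be a finite-dimensional subspace, and let $E_0\subset E$ be a Borel set, such that $L$, $V$, $E_0$ satisfy Assumption A (see context) and, additionally, $V\cap L_2(E,\mu)=0$. Set $H=L+V$. Let $B_n$ be an increasing sequence of bounded Borel sets exhausting $E\setminus E_0$. Let $\Pi^{E_0\cup B_n}$ be the operator of orthogonal projection onto the closed subspace $\chi_{E_0\cup B_n}H$ of $L_2(E,\mu)$. If there exists $\alpha_0>0$ such that for all $n$ we have $$\operatorname{angle}(\chi_{E_0\cup B_n}L,\chi_{E_0\cup B_n}V)\ge\alpha_0,$$ then $$\Pi^{E_0\cup B_n}\to Q\quad\text{in }\mathscr I_{1,\mathrm{loc}}(E,\mu)\text{ as }n\to\infty.$$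
   Context: $E$ is a locally compact complete separable metric space in which bounded sets have compact closure, and $\mu$ is a sigma-finite Borel measure on $E$. $\mathscr I_1(E,\mu)$ is the space of trace-class operators on $L_2(E,\mu)$ with the trace norm. $\mathscr I_{1,\mathrm{loc}}(E,\mu)$ is the space of bounded operators $K$ on $L_2(E,\mu)$ such that $\chi_BK\chi_B\in\mathscr I_1(E,\mu)$ for every bounded Borel set $B\subset E$; convergence $K_n\to K$ in $\mathscr I_{1,\mathrm{loc}}(E,\mu)$ means $\|\chi_B(K_n-K)\chi_B\|_{\mathscr I_1}\to0$ for every bounded Borel $B$. $L_{2,\mathrm{loc}}(E,\mu)$ is the space of measurable functions (mod $\mu$) square integrable on every bounded Borel set. Functions are identified with multiplication operators. For subspaces $H_1,H_2\subset L_2(E,\mu)$, $\operatorname{angle}(H_1,H_2)$ is the infimum of the angles between nonzero vectors of $H_1$ and nonzero vectors of $H_2$. Assumption A for $(L,V,E_0)$: (A1) $\chi_{E\setminus E_0}Q\chi_{E\setminus E_0}\in\mathscr I_1(E,\mu)$; (A2) $\chi_{E_0}V\subset L_2(E,\mu)$; (A3) if $\varphi\in V$ satisfies $\chi_{E_0}\varphi\in\chi_{E_0}L$, then $\varphi=0$; (A4) if $\varphi\in L$ satisfies $\chi_{E_0}\varphi=0$, then $\varphi=0$. *)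

(* Defs.v *)
From HB Require Import structures.
From mathcomp Require Import all_boot all_order all_algebra.
From mathcomp Require Import all_classical all_reals all_analysis.
From mathcomp Require Import measurable_realfun complex ring.

Set Implicit Arguments.
Unset Strict Implicit.
Unset Printing Implicit Defensive.
Import Order.TTheory GRing.Theory Num.Theory.
Import numFieldNormedType.Exports.

Local Open Scope classical_set_scope.
Local Open Scope ring_scope.
Local Open Scope complex_scope.

Local Notation Re := (@complex.Re _).
Local Notation Im := (@complex.Im _).
Local Notation normc := ComplexField.Normc.normc.

Section MeasurableComplexFunctions.
Context {d} {T : measurableType d} {R : realType}.

Definition cmeasurable : {pred T -> R[i]} :=
  mem [set f : T -> R[i] | measurable_fun setT (Re \o f) /\ measurable_fun setT (Im \o f)].

Lemma cmeasurableP (f : T -> R[i]) : f \in cmeasurable <->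
  measurable_fun setT (Re \o f) /\ measurable_fun setT (Im \o f).
Proof. by split => [/set_mem|?]; [|exact/mem_set]. Qed.

Lemma cmeasurable_submod : submod_closed cmeasurable.
Proof.
split=> [|a f g /cmeasurableP[mf1 mf2] /cmeasurableP[mg1 mg2]].
  by apply/cmeasurableP; split; exact: measurable_cst.
apply/cmeasurableP; split.
- rewrite (_ : _ \o _ =
    (fun x => Re a * (Re \o f) x - Im a * (Im \o f) x + (Re \o g) x)).
    apply: measurable_funD => //.
    by apply: measurable_funB; apply: measurable_funM => //.
  by apply/funext => x /=; rewrite !fctE; case: a (f x) (g x) => [? ?] [? ?] [? ?].
- rewrite (_ : _ \o _ =
    (fun x => Re a * (Im \o f) x + Im a * (Re \o f) x + (Im \o g) x)).
    apply: measurable_funD => //.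
    by apply: measurable_funD; apply: measurable_funM => //.
  by apply/funext => x /=; rewrite !fctE; case: a (f x) (g x) => [? ?] [? ?] [? ?].
Qed.

HB.instance Definition _ :=
  GRing.isSubmodClosed.Build R[i] (T -> R[i]) cmeasurable cmeasurable_submod.

Record cmfun := CMfun { cmfun_val :> T -> R[i] ; _ : cmfun_val \in cmeasurable }.

HB.instance Definition _ := [isSub for cmfun_val].
HB.instance Definition _ := [Choice of cmfun by <:].
HB.instance Definition _ := [SubChoice_isSubLmodule of cmfun by <:].

End MeasurableComplexFunctions.

Section L0.
Context {d} {T : measurableType d} {R : realType}.
Variable mu : {measure set T -> \bar R}.

Definition ae_eqc (f g : @cmfun d T R) := `[< {ae mu, forall x, f x = g x} >].

Fact ae_eqc_refl : reflexive ae_eqc.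
Proof. by move=> f; apply/asboolP; exact: aeW. Qed.

Fact ae_eqc_sym : symmetric ae_eqc.
Proof.
by move=> f g; apply/idP/idP => /asboolP h; apply/asboolP;
  apply: filterS h => x ->.
Qed.

Fact ae_eqc_trans : transitive ae_eqc.
Proof.
move=> f g h /asboolP gf /asboolP fh; apply/asboolP.
by apply: filterS2 gf fh => x -> ->.
Qed.

Canonical ae_eqc_equiv := EquivRel ae_eqc ae_eqc_refl ae_eqc_sym ae_eqc_trans.

Local Open Scope quotient_scope.

Definition L0 : Type := {eq_quot ae_eqc}.
HB.instance Definition _ := Choice.on L0.
HB.instance Definition _ := EqQuotient.on L0.

Definition L0_fun (f : L0) : T -> R[i] := repr f.
Definition L0_class (f : cmfun) : L0 := \pi_L0 f.

Lemma L0_classP (f g : cmfun) :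
  L0_class f = L0_class g <-> {ae mu, forall x, f x = g x}.
Proof.
split=> [/eqP|fg]; first by rewrite eqmodE => /asboolP.
by apply/eqP; rewrite eqmodE; exact/asboolP.
Qed.

Lemma L0_classK (f : L0) : L0_class (repr f) = f.
Proof. exact: reprK. Qed.

Lemma repr_classE (f : cmfun) : {ae mu, forall x, L0_fun (L0_class f) x = f x}.
Proof. by apply/L0_classP; rewrite L0_classK. Qed.

Definition L0_zero : L0 := L0_class 0.
Definition L0_opp (f : L0) : L0 := L0_class (- repr f).
Definition L0_add (f g : L0) : L0 := L0_class (repr f + repr g).
Definition L0_scale (a : R[i]) (f : L0) : L0 := L0_class (a *: repr f).

Lemma L0_class_add f g : L0_add (L0_class f) (L0_class g) = L0_class (f + g).
Proof.
apply/L0_classP; apply: filterS2 (repr_classE f) (repr_classE g) => x fE gE.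
by rewrite /= !fctE -[X in _ = X + _]fE -[X in _ = _ + X]gE.
Qed.

Lemma L0_class_opp f : L0_opp (L0_class f) = L0_class (- f).
Proof.
apply/L0_classP; apply: filterS (repr_classE f) => x fE.
by rewrite /= !fctE -[in RHS]fE.
Qed.

Lemma L0_class_scale a f : L0_scale a (L0_class f) = L0_class (a *: f).
Proof.
apply/L0_classP; apply: filterS (repr_classE f) => x fE.
by rewrite /= !fctE -[in RHS]fE.
Qed.

Fact L0_addA : associative L0_add.
Proof.
move=> f g h; rewrite -[f]L0_classK -[g]L0_classK -[h]L0_classK.
by rewrite !L0_class_add addrA.
Qed.

Fact L0_addC : commutative L0_add.
Proof. by move=> f g; rewrite /L0_add addrC. Qed.

Fact L0_add0 : left_id L0_zero L0_add.
Proof. by move=> f; rewrite -[f]L0_classK L0_class_add add0r. Qed.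

Fact L0_addN : left_inverse L0_zero L0_opp L0_add.
Proof.
by move=> f; rewrite -[f]L0_classK L0_class_opp L0_class_add addNr.
Qed.

HB.instance Definition _ :=
  GRing.isZmodule.Build L0 L0_addA L0_addC L0_add0 L0_addN.

Fact L0_scaleA a b (f : L0) : L0_scale a (L0_scale b f) = L0_scale (a * b) f.
Proof. by rewrite -[f]L0_classK !L0_class_scale scalerA. Qed.

Fact L0_scale1 : left_id 1 L0_scale.
Proof. by move=> f; rewrite -[f]L0_classK L0_class_scale scale1r. Qed.

Fact L0_scaleDr : right_distributive L0_scale +%R.
Proof.
have addE f g : L0_class f + L0_class g = L0_class (f + g).
  exact: L0_class_add.
move=> a f g; rewrite -[f]L0_classK -[g]L0_classK addE !L0_class_scale addE.
by rewrite scalerDr.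
Qed.

Fact L0_scaleDl (f : L0) : {morph L0_scale^~ f : a b / a + b}.
Proof.
move=> a b; rewrite -[f]L0_classK !L0_class_scale scalerDl.
exact/esym/L0_class_add.
Qed.

HB.instance Definition _ :=
  GRing.Zmodule_isLmodule.Build R[i] L0
    L0_scaleA L0_scale1 L0_scaleDr L0_scaleDl.

(* Multiplication by the indicator function of [B]. [insubd] returns the given
   function if it is measurable, and the irrelevant default 0 otherwise; only
   measurable sets [B] are ever used, for which see [chiE]. *)
Definition chi_fun (B : set T) (f : L0) : cmfun :=
  insubd (0 : cmfun) (fun x => (\1_B x)%:C * L0_fun f x).
Definition chi (B : set T) (f : L0) : L0 := L0_class (chi_fun B f).

Lemma chi_funE (B : set T) (f : L0) : measurable B ->
  chi_fun B f = (fun x => (\1_B x)%:C * L0_fun f x) :> (T -> R[i]).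
Proof.
move=> mB; rewrite /chi_fun insubdK //; apply/cmeasurableP.
have /cmeasurableP[m1 m2] := valP (repr f).
have m1B : measurable_fun setT (\1_B : T -> R) by exact: measurable_indic.
split.
- rewrite (_ : _ \o _ = (fun x => \1_B x * (Re \o L0_fun f) x)).
    by apply: measurable_funM.
  by apply/funext => y /=; case: (L0_fun f y) => ? ? /=; rewrite mul0r subr0.
- rewrite (_ : _ \o _ = (fun x => \1_B x * (Im \o L0_fun f) x)).
    by apply: measurable_funM.
  by apply/funext => y /=; case: (L0_fun f y) => ? ? /=; rewrite mul0r addr0.
Qed.

Lemma chiE (B : set T) (f : L0) : measurable B ->
  {ae mu, forall x, L0_fun (chi B f) x = (\1_B x)%:C * L0_fun f x}.
Proof.
move=> mB; apply: filterS (repr_classE (chi_fun B f)) => x.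
by rewrite chi_funE.
Qed.

Definition square_integrable_on (B : set T) (f : L0) :=
  (\int[mu]_(x in B) (normc (L0_fun f x) ^+ 2)%:E < +oo)%E.

Definition finL2 : {pred L0} := mem [set f | square_integrable_on setT f].

Lemma finL2P (f : L0) : f \in finL2 <-> square_integrable_on setT f.
Proof. by split => [/set_mem|?]; [|exact/mem_set]. Qed.

Lemma measurable_normc2 (f : L0) :
  measurable_fun setT (fun x => (normc (L0_fun f x) ^+ 2)%:E).
Proof.
have /cmeasurableP[m1 m2] := valP (repr f).
apply/measurable_EFinP; rewrite (_ : (fun _ => _) =
  (fun x => (Re \o L0_fun f) x ^+ 2 + (Im \o L0_fun f) x ^+ 2)).
  by apply: measurable_funD; exact: measurable_funX.
apply/funext => x /=; case: (L0_fun f x) => a b /=.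
by rewrite sqr_sqrtr// addr_ge0// sqr_ge0.
Qed.

Lemma finL2_submod : submod_closed finL2.
Proof.
split=> [|a f g /finL2P f2 /finL2P g2]; apply/finL2P.
  rewrite /square_integrable_on (ae_eq_integral (cst 0%E))//=.
  - by rewrite integral0.
  - exact: measurable_normc2.
  apply: filterS (repr_classE (0 : cmfun)) => x h _.
  by rewrite h /= /normc /= expr0n /= addr0 sqrtr0 expr0n.
pose h x := ((2 * normc a ^+ 2)%:E * (normc (L0_fun f x) ^+ 2)%:E +
  2%:E * (normc (L0_fun g x) ^+ 2)%:E)%E.
have n2_ge0 (u : L0) x : (0 <= (normc (L0_fun u x) ^+ 2)%:E)%E.
  by rewrite lee_fin sqr_ge0.
have c0 : (0 <= (2 * normc a ^+ 2)%:E)%E by rewrite lee_fin mulr_ge0// sqr_ge0.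
have mh : measurable_fun setT h.
  by apply: emeasurable_funD; apply: measurable_funeM; exact: measurable_normc2.
have agE : {ae mu, forall x,
    L0_fun (a *: f + g) x = a * L0_fun f x + L0_fun g x}.
  apply: filterS2 (repr_classE (repr (a *: f) + repr g))
    (repr_classE (a *: repr f)) => x h1 h2.
  rewrite [LHS]h1 /= !fctE; congr (_ + _).
  exact: h2.
apply: (@le_lt_trans _ _ (\int[mu]_x h x)%E).
  apply: ae_ge0_le_integral => //.
  - exact: measurable_normc2.
  - by move=> x _; rewrite adde_ge0// mule_ge0// lee_fin.
  apply: filterS agE => x E _; rewrite {}E /h -!EFinM -EFinD lee_fin.
  case: a (L0_fun f x) (L0_fun g x) {c0 h mh} => [a1 a2] [f1 f2'] [g1 g2'] /=.
  rewrite !sqr_sqrtr ?addr_ge0 ?sqr_ge0//.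
  rewrite -subr_ge0.
  have -> : 2 * (a1 ^+ 2 + a2 ^+ 2) * (f1 ^+ 2 + f2' ^+ 2) +
      2 * (g1 ^+ 2 + g2' ^+ 2) -
    ((a1 * f1 - a2 * f2' + g1) ^+ 2 + (a1 * f2' + a2 * f1 + g2') ^+ 2) =
    (a1 * f1 - a2 * f2' - g1) ^+ 2 + (a1 * f2' + a2 * f1 - g2') ^+ 2 by ring.
  by rewrite addr_ge0// sqr_ge0.
rewrite ge0_integralD//=.
- rewrite !ge0_integralZl//; [|exact: measurable_normc2..].
  by rewrite lte_add_pinfty// lte_mul_pinfty.
- by move=> x _; rewrite mule_ge0.
- by apply: measurable_funeM; exact: measurable_normc2.
- by move=> x _; rewrite mule_ge0// lee_fin.
- by apply: measurable_funeM; exact: measurable_normc2.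
Qed.

HB.instance Definition _ :=
  GRing.isSubmodClosed.Build R[i] L0 finL2 finL2_submod.

Record L2 := MkL2 { L2_val :> L0 ; _ : L2_val \in finL2 }.

HB.instance Definition _ := [isSub for L2_val].
HB.instance Definition _ := [Choice of L2 by <:].
HB.instance Definition _ := [SubChoice_isSubLmodule of L2 by <:].

Lemma chi_finL2 (B : set T) (f : L2) : chi B f \in finL2.
Proof.
apply/finL2P; apply: (@le_lt_trans _ _
    (\int[mu]_x (normc (L0_fun f x) ^+ 2)%:E)%E); last first.
  by apply/finL2P; exact: valP.
apply: ae_ge0_le_integral => //.
- by move=> x _; rewrite lee_fin sqr_ge0.
- exact: measurable_normc2.
- by move=> x _; rewrite lee_fin sqr_ge0.
- exact: measurable_normc2.
apply: filterS (repr_classE (chi_fun B f)) => x h _; rewrite lee_fin {}h.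
rewrite /chi_fun /insubd; case: insubP => [g _ ->|_] /=.
  rewrite indicE; case: (x \in B); case: (L0_fun _ x) => a b /=.
    by rewrite !mul1r !mul0r subr0 addr0.
  by rewrite !mul0r subr0 addr0 expr0n /= addr0 sqrtr0 expr0n sqr_ge0.
by rewrite expr0n /= addr0 sqrtr0 expr0n sqr_ge0.
Qed.

Definition chi2 (B : set T) (f : L2) : L2 := MkL2 (chi_finL2 B f).

(* [A] intersected with L2; it is only applied to sets [A] contained in L2,
   such as [chi (E0 `|` B) @` V] for bounded [B] under [assumptionA]. *)
Definition in_L2 (A : set L0) : set L2 := [set f | A f].

Definition dot (f g : L2) : R[i] :=
  (\int[mu]_x Re (L0_fun f x * conjc (L0_fun g x))) +i*
  (\int[mu]_x Im (L0_fun f x * conjc (L0_fun g x))).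

Definition L2norm (f : L2) : R := Num.sqrt (Re (dot f f)).

Definition linear_subspace (M : set L2) :=
  M 0 /\ forall a f g, M f -> M g -> M (a *: f + g).

Definition norm_closed (M : set L2) := forall f,
  (forall e : R, 0 < e -> exists2 g, M g & L2norm (f - g) < e) -> M f.

Definition finite_dim_subspace (V : set L0) :=
  exists n (b : 'I_n -> L0),
    V = [set v | exists c : 'I_n -> R[i], v = \sum_i c i *: b i].

(* For complex subspaces, the infimum of these angles is the same with the
   modulus of [dot f g] in place of its real part. *)
Definition vect_angle (f g : L2) : R :=
  acos (Re (dot f g) / (L2norm f * L2norm g)).

(* The infimum over the empty set is +oo. *)
Definition angle (H1 H2 : set L2) : \bar R :=
  ereal_inf [set a | exists f g,
    [/\ H1 f, H2 g, f != 0, g != 0 & a = (vect_angle f g)%:E]].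

(* Whenever [M] is a closed subspace there is exactly one such [g]. *)
Definition orth_proj (M : set L2) (f : L2) : L2 :=
  xget 0 [set g | M g /\ forall h, M h -> dot (f - g) h = 0].

Definition bounded_op (K : L2 -> L2) :=
  linear K /\ exists c : R, forall f, L2norm (K f) <= c * L2norm f.

Definition positive_op (K : L2 -> L2) := forall f, 0 <= dot (K f) f.

Definition is_adjoint (K K' : L2 -> L2) :=
  forall f g, dot (K f) g = dot f (K' g).

(* |K|, the positive square root of K^* K: it exists and is unique for every
   bounded operator [K]. *)
Definition abs_op (K : L2 -> L2) : L2 -> L2 :=
  xget (fun=> 0) [set S | [/\ bounded_op S, positive_op S &
    exists2 K', bounded_op K' /\ is_adjoint K K' & S \o S = K' \o K]].

Definition orthonormal (B : set L2) :=
  forall e f, B e -> B f -> dot e f = (e == f)%:R.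

Definition orthonormal_basis (B : set L2) :=
  orthonormal B /\ forall f, (forall e, B e -> dot f e = 0) -> f = 0.

(* A fixed orthonormal basis; the trace of a positive operator does not depend
   on this choice. *)
Definition onb : set L2 := xget set0 orthonormal_basis.

Definition trace (S : L2 -> L2) : \bar R :=
  \esum_(e in onb) (Re (dot (S e) e))%:E.

Definition trace_norm (K : L2 -> L2) : \bar R := trace (abs_op K).

Definition trace_class (K : L2 -> L2) :=
  bounded_op K /\ (trace_norm K < +oo)%E.

Definition compress (B : set T) (K : L2 -> L2) : L2 -> L2 :=
  chi2 B \o K \o chi2 B.

Definition assumptionA (L : set L2) (V : set L0) (E0 : set T) :=
  [/\ trace_class (compress (~` E0) (orth_proj L)),
      forall v, V v -> chi E0 v \in finL2,
      forall v, V v -> (exists2 l, L l & chi E0 v = chi2 E0 l) -> v = 0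
    & forall l, L l -> chi2 E0 l = 0 -> l = 0].

Definition add_subspaces (L : set L2) (V : set L0) : set L0 :=
  [set h | exists l v, [/\ L l, V v & h = (l : L0) + v]].

End L0.

Arguments chi {d T R mu} B f.
Arguments chi2 {d T R mu} B f.
Arguments finL2 {d T R mu}.

#[short(type="completeMetricType")]
HB.structure Definition CompleteMetric (K : numDomainType) :=
  { M of Complete M & Metric K M }.

Notation borel E := (g_sigma_algebraType (@open E)).

Definition separable (E : topologicalType) :=
  exists2 D : set E, countable D & dense D.

Section LocalSpaces.
Context {R : realType} {E : completeMetricType R}.
Variable mu : {measure set (borel E) -> \bar R}.

Definition metric_bounded (A : set E) :=
  exists r : R, forall x y, A x -> A y -> mdist x y <= r.

Definition bounded_borel (B : set (borel E)) := measurable B /\ metric_bounded B.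

Definition L2loc : set (L0 mu) :=
  [set f | forall B, bounded_borel B -> square_integrable_on B f].

Definition I1loc : set (L2 mu -> L2 mu) :=
  [set K | bounded_op K /\
    forall B, bounded_borel B -> trace_class (compress B K)].

Definition I1loc_cvg (Kn : nat -> L2 mu -> L2 mu) (K : L2 mu -> L2 mu) :=
  [/\ forall n, I1loc (Kn n), I1loc K & forall B, bounded_borel B ->
    trace_norm (compress B (fun f => Kn n f - K f)) @[n --> \oo] --> 0%E].

End LocalSpaces.

(* Main.v *)
(* Write [chi_n] for the indicator of [E0 `|` B n], [Q] for the projection onto
   [L] and [P_n] for the projection onto [chi_n L].

   By A1 the operator [chi (~` E0) Q] is Hilbert-Schmidt, and with A4 this makes
   [chi E0] bounded below on [L]; hence [chi_n L] is closed and [P_n] differs from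
   [chi_n Q chi_n] by a positive operator whose quadratic form is at most a
   constant times [|chi_n^c Q chi_n f|^2], so its trace tends to 0.

   The projection onto [chi_n (L + V)] is [P_n] plus at most [dim V] rank one
   projections along vectors [u = g - P_n g], [g = chi_n v], [v] in [V]. The
   angle condition bounds [|g|]. As [V] meets [L2] only in 0, compactness of the
   unit ball of [V] forces [chi E0 v], and then [chi D v] for every bounded [D],
   to tend to 0, so these rank one terms vanish locally.

   Trace norms are estimated through quadratic forms: if [-b <= K <= a] with [K]
   self-adjoint, then [|K|] is [K] on one spectral half and [-K] on the other, so
   the trace norm of [K] is at most the sum of the traces of [a] and [b]. *)

Require Import Defs.
From HB Require Import structures.
From mathcomp Require Import all_boot all_order all_algebra.
From mathcomp Require Import all_classical all_reals all_analysis.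
From mathcomp Require Import measurable_realfun complex finmap ring lra.

Set Implicit Arguments.
Unset Strict Implicit.
Unset Printing Implicit Defensive.
Import Order.TTheory GRing.Theory Num.Theory.
Import numFieldNormedType.Exports.

Local Open Scope classical_set_scope.
Local Open Scope ring_scope.
Local Open Scope complex_scope.

Local Notation Re := (@complex.Re _).
Local Notation Im := (@complex.Im _).
Local Notation normc := ComplexField.Normc.normc.

(** * The inner product of [L2] *)

(** The residual [u = g - P_n g] contains the nonlocal term [P_n g], so local smallness of [g] does
    not suffice. Write [P_n g] as [chi_n Q g] plus the defect applied to [g]. The operator norm of
    the defect is controlled by the Hilbert-Schmidt norm of [chi_n^c Q], so this part is small
    although [g] is merely bounded. For [chi D (Q g)] an index [m] is frozen first, so large that
    [chi_m^c Q chi D] has small Hilbert-Schmidt norm, which uses that [Q] is locally of trace class;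
    only then does [n] grow, which makes [chi_m g] small.

    With [h = chi D f], the form of the compressed difference contains [|Q chi_n h|^2 - |Q h|^2],
    which is of first order in [Q chi_n^c h]. Young's inequality with a weight [eta] bounds it by
    [eta |Q h|^2], of trace proportional to [eta], plus a multiple of [|Q chi_n^c h|^2], whose trace
    tends to 0 for fixed [eta].

    A3 is applied with [l = 0]: [chi E0] is injective on [V], so by finite dimension [|chi E0 v|]
    controls [|chi D v|] for every [D] containing [E0] with [chi D V] inside [L2]. *)

Section L2Dot.
Context {d} {T : measurableType d} {R : realType}.
Variable mu : {measure set T -> \bar R}.
Implicit Types (f g h : L2 mu) (u v : L0 mu).

Lemma L0_funD u v : {ae mu, forall x, L0_fun (u + v) x = L0_fun u x + L0_fun v x}.
Proof. by apply: filterS (repr_classE mu (repr u + repr v)) => x ->. Qed.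

Lemma L0_funZ (a : R[i]) u : {ae mu, forall x, L0_fun (a *: u) x = a * L0_fun u x}.
Proof. by apply: filterS (repr_classE mu (a *: repr u)) => x ->. Qed.

Lemma L0_fun0 : {ae mu, forall x, L0_fun (0 : L0 mu) x = 0}.
Proof. by apply: filterS (repr_classE mu 0) => x ->. Qed.

Lemma L0_funN u : {ae mu, forall x, L0_fun (- u) x = - L0_fun u x}.
Proof. by apply: filterS (repr_classE mu (- repr u)) => x ->. Qed.

Lemma L0_funB u v : {ae mu, forall x, L0_fun (u - v) x = L0_fun u x - L0_fun v x}.
Proof. by apply: filterS2 (L0_funD u (- v)) (L0_funN v) => x -> ->. Qed.

Lemma L0_eqP u v : {ae mu, forall x, L0_fun u x = L0_fun v x} -> u = v.
Proof. by move=> uv; rewrite -(L0_classK u) -(L0_classK v); apply/L0_classP. Qed.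

Lemma L2_eqP f g : {ae mu, forall x, L0_fun f x = L0_fun g x} -> f = g.
Proof. by move=> fg; apply/val_inj/L0_eqP. Qed.

Lemma L2_valD f g : L2_val (f + g) = L2_val f + L2_val g. Proof. by []. Qed.
Lemma L2_valZ (a : R[i]) f : L2_val (a *: f) = a *: L2_val f. Proof. by []. Qed.
Lemma L2_valB f g : L2_val (f - g) = L2_val f - L2_val g. Proof. by []. Qed.
Lemma measurable_Re u : measurable_fun setT (fun x => Re (L0_fun u x)).
Proof. by have /cmeasurableP[] := valP (repr u). Qed.

Lemma measurable_Im u : measurable_fun setT (fun x => Im (L0_fun u x)).
Proof. by have /cmeasurableP[] := valP (repr u). Qed.

Lemma normc2E (z : R[i]) : normc z ^+ 2 = Re z ^+ 2 + Im z ^+ 2.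
Proof. by case: z => a b /=; rewrite sqr_sqrtr// addr_ge0// sqr_ge0. Qed.

Lemma integrable_normc2 f :
  mu.-integrable setT (fun x => (normc (L0_fun f x) ^+ 2)%:E).
Proof.
apply/integrableP; split; first exact: measurable_normc2.
have /finL2P := valP f; congr (_ < _)%E; apply: eq_integral => x _.
by rewrite gee0_abs // lee_fin sqr_ge0.
Qed.

Lemma measurable_Re_mul u v :
  measurable_fun setT (fun x => Re (L0_fun u x * conjc (L0_fun v x))).
Proof.
rewrite (_ : (fun _ => _) = (fun x => Re (L0_fun u x) * Re (L0_fun v x) +
    Im (L0_fun u x) * Im (L0_fun v x))).
  by apply: measurable_funD; apply: measurable_funM;
     (exact: measurable_Re || exact: measurable_Im).
by apply/funext => x; case: (L0_fun u x) (L0_fun v x) => a b [a' b'] /=; ring.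
Qed.

Lemma measurable_Im_mul u v :
  measurable_fun setT (fun x => Im (L0_fun u x * conjc (L0_fun v x))).
Proof.
rewrite (_ : (fun _ => _) = (fun x => Im (L0_fun u x) * Re (L0_fun v x) -
    Re (L0_fun u x) * Im (L0_fun v x))).
  by apply: measurable_funB; apply: measurable_funM;
     (exact: measurable_Re || exact: measurable_Im).
by apply/funext => x; case: (L0_fun u x) (L0_fun v x) => a b [a' b'] /=; ring.
Qed.

Lemma integrable_mul_bound f g (k : T -> R) : measurable_fun setT k ->
  (forall x, `|k x| <= normc (L0_fun f x) ^+ 2 + normc (L0_fun g x) ^+ 2) ->
  mu.-integrable setT (EFin \o k).
Proof.
move=> mk kle.
have i2 := integrableD measurableT (integrable_normc2 f) (integrable_normc2 g).
apply: (le_integrable measurableT _ _ i2); first exact/measurable_EFinP.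
by move=> x _; rewrite /= lee_fin (le_trans (kle x))// ler_norm.
Qed.

Lemma integrable_Re_mul f g :
  mu.-integrable setT (EFin \o (fun x => Re (L0_fun f x * conjc (L0_fun g x)))).
Proof.
apply: (@integrable_mul_bound f g); first exact: measurable_Re_mul.
move=> x; rewrite !normc2E; case: (L0_fun f x) (L0_fun g x) => a b [a' b'] /=.
have := sqr_ge0 (a - a'); have := sqr_ge0 (b - b').
have := sqr_ge0 (a + a'); have := sqr_ge0 (b + b').
have := sqr_ge0 a; have := sqr_ge0 b; have := sqr_ge0 a'; have := sqr_ge0 b'.
by rewrite ler_norml; move=> *; apply/andP; split; nra.
Qed.

Lemma integrable_Im_mul f g :
  mu.-integrable setT (EFin \o (fun x => Im (L0_fun f x * conjc (L0_fun g x)))).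
Proof.
apply: (@integrable_mul_bound f g); first exact: measurable_Im_mul.
move=> x; rewrite !normc2E; case: (L0_fun f x) (L0_fun g x) => a b [a' b'] /=.
have := sqr_ge0 (a - b'); have := sqr_ge0 (b - a').
have := sqr_ge0 (a + b'); have := sqr_ge0 (b + a').
have := sqr_ge0 a; have := sqr_ge0 b; have := sqr_ge0 a'; have := sqr_ge0 b'.
by rewrite ler_norml; move=> *; apply/andP; split; nra.
Qed.

Lemma ae_eq_Rintegral (k l : T -> R) : mu.-integrable setT (EFin \o k) ->
  mu.-integrable setT (EFin \o l) -> {ae mu, forall x, k x = l x} ->
  \int[mu]_x k x = \int[mu]_x l x.
Proof.
move=> ik il kl; rewrite /Rintegral; congr fine; apply: ae_eq_integral => //.
- exact: measurable_int ik.
- exact: measurable_int il.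
- by apply: filterS kl => x /= -> _.
Qed.

(** The right-hand side has the shape of [Rintegral_lin3], because [dot] integrates real and
    imaginary parts separately. *)
Lemma Re_mulD (a z w t : R[i]) : Re ((a * z + w) * t) =
  Re a * Re (z * t) + ((- Im a) * Im (z * t) + Re (w * t)).
Proof. by case: a z w t => [? ?] [? ?] [? ?] [? ?] /=; ring. Qed.

Lemma Im_mulD (a z w t : R[i]) : Im ((a * z + w) * t) =
  Re a * Im (z * t) + (Im a * Re (z * t) + Im (w * t)).
Proof. by case: a z w t => [? ?] [? ?] [? ?] [? ?] /=; ring. Qed.

Lemma integrableZlR (a : R) (k : T -> R) : mu.-integrable setT (EFin \o k) ->
  mu.-integrable setT (EFin \o (fun x => a * k x)).
Proof. exact: integrableZl. Qed.

Lemma integrableDR (k l : T -> R) : mu.-integrable setT (EFin \o k) ->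
  mu.-integrable setT (EFin \o l) ->
  mu.-integrable setT (EFin \o (fun x => k x + l x)).
Proof. exact: integrableD. Qed.

Lemma Rintegral_lin3 (a b : R) (k l m : T -> R) :
  mu.-integrable setT (EFin \o k) -> mu.-integrable setT (EFin \o l) ->
  mu.-integrable setT (EFin \o m) ->
  \int[mu]_x (a * k x + (b * l x + m x)) =
  a * (\int[mu]_x k x) + (b * (\int[mu]_x l x) + \int[mu]_x m x).
Proof.
move=> ik il im; rewrite RintegralD//; [|exact: integrableZlR|].
  rewrite RintegralD//; last exact: integrableZlR.
  by rewrite !RintegralZl.
by apply: integrableDR => //; exact: integrableZlR.
Qed.

Lemma Re_dot_int f g : Re (dot f g) = \int[mu]_x Re (L0_fun f x * conjc (L0_fun g x)).
Proof. by []. Qed.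

Lemma Im_dot_int f g : Im (dot f g) = \int[mu]_x Im (L0_fun f x * conjc (L0_fun g x)).
Proof. by []. Qed.

Lemma dotDZl a f g h : dot (a *: f + g) h = a * dot f h + dot g h.
Proof.
have E : {ae mu, forall x, L0_fun (a *: f + g : L2 mu) x =
    a * L0_fun f x + L0_fun g x}.
  apply: filterS2 (L0_funD (a *: (f : L0 mu)) g) (L0_funZ a f) => x h1 h2.
  by rewrite -h2; exact: h1.
have -> : dot (a *: f + g) h =
  (Re a * Re (dot f h) + ((- Im a) * Im (dot f h) + Re (dot g h))) +i*
  (Re a * Im (dot f h) + (Im a * Re (dot f h) + Im (dot g h))).
  rewrite [LHS]/dot !Re_dot_int !Im_dot_int; congr (_ +i* _).
  - rewrite -Rintegral_lin3; try exact: integrable_Re_mul;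
      try exact: integrable_Im_mul.
    apply: ae_eq_Rintegral; first exact: integrable_Re_mul.
      apply: integrableDR; first by apply: integrableZlR; exact: integrable_Re_mul.
      apply: integrableDR; first by apply: integrableZlR; exact: integrable_Im_mul.
      exact: integrable_Re_mul.
    by apply: filterS E => x ->; rewrite Re_mulD.
  - rewrite -Rintegral_lin3; try exact: integrable_Re_mul;
      try exact: integrable_Im_mul.
    apply: ae_eq_Rintegral; first exact: integrable_Im_mul.
      apply: integrableDR; first by apply: integrableZlR; exact: integrable_Im_mul.
      apply: integrableDR; first by apply: integrableZlR; exact: integrable_Re_mul.
      exact: integrable_Im_mul.
    by apply: filterS E => x ->; rewrite Im_mulD.
by case: a (dot f h) (dot g h) {E} => [? ?] [? ?] [? ?] /=; congr (_ +i* _); ring.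
Qed.

Lemma dotC f g : dot f g = conjc (dot g f).
Proof.
rewrite /dot /=; congr (_ +i* _).
  apply: eq_Rintegral => x _.
  by case: (L0_fun f x) (L0_fun g x) => a b [a' b'] /=; ring.
rewrite (_ : (fun x => _) = (fun x => (-1) * Im (L0_fun g x * conjc (L0_fun f x)))).
  by rewrite RintegralZl ?mulN1r//; exact: integrable_Im_mul.
apply/funext => x.
by case: (L0_fun f x) (L0_fun g x) => a b [a' b'] /=; ring.
Qed.

Lemma Re_dotE f : Re (dot f f) = \int[mu]_x (normc (L0_fun f x) ^+ 2).
Proof.
apply: eq_Rintegral => x _; rewrite normc2E.
by case: (L0_fun f x) => a b /=; ring.
Qed.

Lemma Re_dot_EFin f :
  (Re (dot f f))%:E = (\int[mu]_x (normc (L0_fun f x) ^+ 2)%:E)%E.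
Proof.
rewrite Re_dotE /Rintegral fineK//.
exact/integrable_fin_num/integrable_normc2.
Qed.

Lemma Re_dot_ge0 f : 0 <= Re (dot f f).
Proof. by rewrite Re_dotE Rintegral_ge0// => x _; exact: sqr_ge0. Qed.

Lemma Im_dot f : Im (dot f f) = 0.
Proof.
have := congr1 Im (dotC f f); case: (dot f f) => a b /= E.
by apply/eqP; rewrite -[_ == _](mulrn_eq0 b 2)/= mulr2n {1}E addNr.
Qed.

Lemma dot_eq0 f : Re (dot f f) = 0 -> f = 0.
Proof.
move=> f0; have := Re_dot_EFin f; rewrite f0 => /esym/eqP.
have m := measurable_normc2 f.
rewrite (_ : integral _ _ _ =
    \int[mu]_x `|(normc (L0_fun f x) ^+ 2)%:E|)%E; last first.
  by apply: eq_integral => x _; rewrite gee0_abs// lee_fin sqr_ge0.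
move=> /eqP /(ae_eq_integral_abs mu measurableT m) h.
apply: L2_eqP; apply: filterS2 h L0_fun0 => x h hx.
rewrite [RHS]hx; apply: ComplexField.Normc.eq0_normc.
by have [/eqP] := h I; rewrite expf_eq0 /= => /eqP.
Qed.

Definition rdot f g : R := Re (dot f g).
Definition nsq f : R := rdot f f.

Lemma L2norm_sqrt f : L2norm f = Num.sqrt (nsq f). Proof. by []. Qed.

Lemma nsq_ge0 f : 0 <= nsq f. Proof. exact: Re_dot_ge0. Qed.

Lemma nsq_eq0 f : nsq f = 0 -> f = 0. Proof. exact: dot_eq0. Qed.

Lemma dotDl f g h : dot (f + g) h = dot f h + dot g h.
Proof. by rewrite -[f in LHS]scale1r dotDZl mul1r. Qed.

Lemma dot0l h : dot 0 h = 0.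
Proof. by have /eqP := dotDl 0 0 h; rewrite addr0 -subr_eq subrr => /eqP <-. Qed.

Lemma dotZl a f h : dot (a *: f) h = a * dot f h.
Proof. by rewrite -[a *: f]addr0 dotDZl dot0l addr0. Qed.

Lemma dotNl f h : dot (- f) h = - dot f h.
Proof. by rewrite -scaleN1r dotZl mulN1r. Qed.

Lemma dotBl f g h : dot (f - g) h = dot f h - dot g h.
Proof. by rewrite dotDl dotNl. Qed.

Lemma conjcD (z w : R[i]) : conjc (z + w) = conjc z + conjc w.
Proof. by case: z w => a b [a' b'] /=; congr (_ +i* _); rewrite opprD. Qed.

Lemma conjcM (z w : R[i]) : conjc (z * w) = conjc z * conjc w.
Proof. by case: z w => a b [a' b'] /=; congr (_ +i* _); ring. Qed.

Lemma conjcN (z : R[i]) : conjc (- z) = - conjc z.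
Proof. by case: z. Qed.

Lemma dotDr f g h : dot h (f + g) = dot h f + dot h g.
Proof. by rewrite dotC dotDl conjcD -!dotC. Qed.

Lemma dot0r h : dot h 0 = 0.
Proof. by rewrite dotC dot0l conjc0. Qed.

Lemma dotZr a f h : dot h (a *: f) = conjc a * dot h f.
Proof. by rewrite dotC dotZl conjcM -dotC. Qed.

Lemma dotNr f h : dot h (- f) = - dot h f.
Proof. by rewrite dotC dotNl conjcN -dotC. Qed.

Lemma dotBr f g h : dot h (f - g) = dot h f - dot h g.
Proof. by rewrite dotDr dotNr. Qed.

Lemma dotff f : dot f f = (nsq f)%:C.
Proof. by rewrite /nsq /rdot; have := Im_dot f; case: (dot f f) => a b /= ->. Qed.

Lemma rdotC f g : rdot f g = rdot g f.
Proof. by rewrite /rdot dotC; case: (dot g f). Qed.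

Lemma rdotDl f g h : rdot (f + g) h = rdot f h + rdot g h.
Proof. by rewrite /rdot dotDl; case: (dot f h) (dot g h) => ? ? []. Qed.

Lemma rdotNl f h : rdot (- f) h = - rdot f h.
Proof. by rewrite /rdot dotNl; case: (dot f h). Qed.

Lemma rdotBl f g h : rdot (f - g) h = rdot f h - rdot g h.
Proof. by rewrite rdotDl rdotNl. Qed.

Lemma rdotDr f g h : rdot h (f + g) = rdot h f + rdot h g.
Proof. by rewrite rdotC rdotDl !(rdotC h). Qed.

Lemma rdotNr f h : rdot h (- f) = - rdot h f.
Proof. by rewrite rdotC rdotNl rdotC. Qed.

Lemma rdotBr f g h : rdot h (f - g) = rdot h f - rdot h g.
Proof. by rewrite rdotDr rdotNr. Qed.

Lemma rdotZl (a : R) f h : rdot (a%:C *: f) h = a * rdot f h.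
Proof. by rewrite /rdot dotZl; case: (dot f h) => x y /=; rewrite mul0r subr0. Qed.

Lemma rdotZr (a : R) f h : rdot h (a%:C *: f) = a * rdot h f.
Proof. by rewrite rdotC rdotZl rdotC. Qed.

Lemma rdot0l h : rdot 0 h = 0. Proof. by rewrite /rdot dot0l. Qed.
Lemma rdot0r h : rdot h 0 = 0. Proof. by rewrite /rdot dot0r. Qed.

Lemma nsqD f g : nsq (f + g) = nsq f + 2 * rdot f g + nsq g.
Proof. by rewrite /nsq !(rdotDl, rdotDr) (rdotC g f); ring. Qed.

Lemma nsqB f g : nsq (f - g) = nsq f - 2 * rdot f g + nsq g.
Proof. by rewrite /nsq !(rdotDl, rdotDr, rdotNl, rdotNr) (rdotC g f); ring. Qed.

Lemma nsqN f : nsq (- f) = nsq f.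
Proof. by rewrite /nsq !(rdotNl, rdotNr) opprK. Qed.

Lemma nsq0 : nsq 0 = 0. Proof. by rewrite /nsq rdot0l. Qed.

Lemma nsqZ a f : nsq (a *: f) = normc a ^+ 2 * nsq f.
Proof.
rewrite /nsq /rdot dotZl dotZr dotff normc2E.
by case: a => x y /=; ring.
Qed.

Lemma parallelogram f g : nsq (f + g) + nsq (f - g) = 2 * nsq f + 2 * nsq g.
Proof. by rewrite nsqD nsqB; ring. Qed.

Lemma nsqD_le f g : nsq (f + g) <= 2 * nsq f + 2 * nsq g.
Proof. by rewrite -parallelogram lerDl nsq_ge0. Qed.

Lemma nsqB_le f g : nsq (f - g) <= 2 * nsq f + 2 * nsq g.
Proof. by rewrite -parallelogram lerDr nsq_ge0. Qed.

Lemma dot_CS f g : normc (dot f g) ^+ 2 <= nsq f * nsq g.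
Proof.
have [g0|g0] := eqVneq (nsq g) 0.
  by rewrite (nsq_eq0 g0) dot0r nsq0 mulr0 ComplexField.Normc.normc0 expr0n.
have gp : 0 < nsq g by rewrite lt_neqAle eq_sym g0 nsq_ge0.
(* The residual of [f] along [g], scaled by [nsq g] to avoid a division. *)
have := nsq_ge0 ((nsq g)%:C *: f - dot f g *: g).
rewrite nsqB !nsqZ /rdot dotZl dotZr !normc2E.
case: (dot f g) => x y /=; rewrite expr0n /= addr0.
have -> : nsq g ^+ 2 * nsq f - 2 * (nsq g * (x * x - - y * y) - 0 * (x * y + - y * x)) +
  (x ^+ 2 + y ^+ 2) * nsq g = nsq g * (nsq f * nsq g - (x ^+ 2 + y ^+ 2)) by ring.
by rewrite pmulr_rge0// subr_ge0.
Qed.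

Lemma rdot_CS f g : rdot f g ^+ 2 <= nsq f * nsq g.
Proof.
by apply: le_trans (dot_CS f g); rewrite normc2E /rdot lerDl sqr_ge0.
Qed.

Lemma L2norm_ge0 f : 0 <= L2norm f. Proof. exact: sqrtr_ge0. Qed.

Lemma L2norm2 f : L2norm f ^+ 2 = nsq f.
Proof. by rewrite L2norm_sqrt sqr_sqrtr// nsq_ge0. Qed.

Lemma L2norm_eq0 f : L2norm f = 0 -> f = 0.
Proof.
by move=> f0; apply: nsq_eq0; rewrite -L2norm2 f0 expr0n.
Qed.

Lemma L2norm_le f g : (L2norm f <= L2norm g) = (nsq f <= nsq g).
Proof. by rewrite -!L2norm2 ler_pXn2r// nnegrE L2norm_ge0. Qed.

Lemma L2norm_ltr f (c : R) : 0 <= c -> (L2norm f < c) = (nsq f < c ^+ 2).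
Proof. by move=> c0; rewrite -!L2norm2 ltr_pXn2r// nnegrE L2norm_ge0. Qed.

End L2Dot.

(** * Multiplication by indicator functions *)

Section Chi.
Context {d} {T : measurableType d} {R : realType}.
Variable mu : {measure set T -> \bar R}.
Implicit Types (f g h : L2 mu) (u v : L0 mu) (A B : set T).

Lemma chi_lin A a u v : measurable A ->
  chi A (a *: u + v) = a *: chi A u + chi A v.
Proof.
move=> mA; apply: L0_eqP; near=> x.
have -> : L0_fun (chi A (a *: u + v)) x = (\1_A x)%:C * L0_fun (a *: u + v) x.
  by near: x; exact: chiE.
have -> : L0_fun (a *: u + v) x = L0_fun (a *: u) x + L0_fun v x.
  by near: x; exact: L0_funD.
have -> : L0_fun (a *: u) x = a * L0_fun u x by near: x; exact: L0_funZ.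
have -> : L0_fun (a *: chi A u + chi A v) x = L0_fun (a *: chi A u) x + L0_fun (chi A v) x.
  by near: x; exact: L0_funD.
have -> : L0_fun (a *: chi A u) x = a * L0_fun (chi A u) x by near: x; exact: L0_funZ.
have -> : L0_fun (chi A u) x = (\1_A x)%:C * L0_fun u x by near: x; exact: chiE.
have -> : L0_fun (chi A v) x = (\1_A x)%:C * L0_fun v x by near: x; exact: chiE.
by rewrite mulrDr mulrCA.
Unshelve. all: by end_near. Qed.

Lemma chi_chi A B u : measurable A -> measurable B ->
  chi A (chi B u) = chi (A `&` B) u.
Proof.
move=> mA mB; apply: L0_eqP.
apply: filterS3 (chiE (chi B u) mA) (chiE u mB) (chiE u (measurableI _ _ mA mB)).
by move=> x -> -> ->; rewrite indicI /= mulrA -rmorphM.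
Qed.

Lemma chi2_lin A a f g : measurable A ->
  chi2 A (a *: f + g) = a *: chi2 A f + chi2 A g.
Proof. by move=> mA; apply: val_inj; exact: chi_lin. Qed.

Lemma chi2_chi2 A B f : measurable A -> measurable B ->
  chi2 A (chi2 B f) = chi2 (A `&` B) f.
Proof. by move=> mA mB; apply: val_inj; exact: chi_chi. Qed.

Lemma L2_val_chi2 A f : L2_val (chi2 A f) = chi A f. Proof. by []. Qed.

Lemma chi2_linear A : measurable A -> linear (chi2 (mu := mu) A).
Proof. by move=> mA a f g; exact: chi2_lin. Qed.

Lemma chi2_setC A f : measurable A -> chi2 A f + chi2 (~` A) f = f.
Proof.
move=> mA; apply: L2_eqP; near=> x.
have -> : L0_fun (chi2 A f + chi2 (~` A) f) x = L0_fun (chi2 A f) x + L0_fun (chi2 (~` A) f) x.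
  by near: x; exact: L0_funD.
have -> : L0_fun (chi2 A f) x = (\1_A x)%:C * L0_fun f x by near: x; exact: chiE.
have -> : L0_fun (chi2 (~` A) f) x = (\1_(~` A) x)%:C * L0_fun f x.
  by near: x; apply: chiE; exact: measurableC.
by rewrite -mulrDl -rmorphD /= !indicE in_setC; case: (_ \in _); rewrite ?addr0 ?add0r mul1r.
Unshelve. all: by end_near. Qed.

Lemma dot_chi2 A f g : measurable A -> dot (chi2 A f) g = dot f (chi2 A g).
Proof.
move=> mA; rewrite /dot; congr (_ +i* _).
- apply: ae_eq_Rintegral; [exact: integrable_Re_mul..|].
  apply: filterS2 (chiE f mA) (chiE g mA) => x -> ->.
  case: (L0_fun f x) (L0_fun g x) => a b [a' b'] /=; ring.
- apply: ae_eq_Rintegral; [exact: integrable_Im_mul..|].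
  apply: filterS2 (chiE f mA) (chiE g mA) => x -> ->.
  case: (L0_fun f x) (L0_fun g x) => a b [a' b'] /=; ring.
Qed.

Lemma rdot_chi2 A f g : measurable A -> rdot (chi2 A f) g = rdot f (chi2 A g).
Proof. by move=> mA; rewrite /rdot dot_chi2. Qed.

Lemma nsq_chi2_le A f : measurable A -> nsq (chi2 A f) <= nsq f.
Proof.
move=> mA; have -> : nsq f = nsq (chi2 A f) + nsq (f - chi2 A f).
  by rewrite /nsq !(rdotBl, rdotBr) (rdotC f) !rdot_chi2// chi2_chi2// setIid; ring.
by rewrite lerDl nsq_ge0.
Qed.

Lemma nsq_chi2_sub A B f : measurable A -> measurable B -> A `<=` B ->
  nsq (chi2 A f) <= nsq (chi2 B f).
Proof.
move=> mA mB AB; have -> : chi2 A f = chi2 A (chi2 B f).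
  by rewrite (chi2_chi2 f mA mB) (setIidl AB).
exact: nsq_chi2_le.
Qed.

Lemma nsq_chi2_setC A f : measurable A ->
  nsq f = nsq (chi2 A f) + nsq (chi2 (~` A) f).
Proof.
move=> mA; rewrite -[in LHS](chi2_setC f mA) nsqD.
have -> : rdot (chi2 A f) (chi2 (~` A) f) = 0.
  rewrite rdot_chi2// chi2_chi2//; last exact: measurableC.
  rewrite setICr (_ : chi2 set0 f = 0) ?rdot0r//.
  apply: L2_eqP; apply: filterS2 (chiE f measurable0) (L0_fun0 mu) => x -> ->.
  by rewrite indic0 mul0r.
by rewrite mulr0 addr0.
Qed.

Lemma nsq_EFin f : (nsq f)%:E = (\int[mu]_x (normc (L0_fun f x) ^+ 2)%:E)%E.
Proof. exact: Re_dot_EFin. Qed.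

Lemma normc_indic A (z : R[i]) x :
  normc ((\1_A x)%:C * z) ^+ 2 = \1_A x * normc z ^+ 2.
Proof.
rewrite !normc2E indicE; case: (x \in A); case: z => a b /=;
 by rewrite !(mul1r, mul0r, subr0, addr0, expr0n).
Qed.

Lemma square_integrable_onP A u : measurable A ->
  square_integrable_on A u <-> chi A u \in finL2.
Proof.
move=> mA; rewrite finL2P /square_integrable_on.
suff -> : (\int[mu]_(x in A) (normc (L0_fun u x) ^+ 2)%:E =
  \int[mu]_x (normc (L0_fun (chi A u) x) ^+ 2)%:E)%E by [].
rewrite integral_mkcond; apply: ae_eq_integral => //.
- exact/(measurable_restrictT _ mA).1/measurable_funS/measurable_normc2.
- exact: measurable_normc2.
apply: filterS (chiE u mA) => x -> _.
rewrite normc_indic patchE indicE; case: (x \in A); by rewrite ?mul1r ?mul0r.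
Qed.

Lemma subset_nondecreasing (A : nat -> set T) : (forall n, A n `<=` A n.+1) ->
  forall m n, (m <= n)%N -> A m `<=` A n.
Proof.
move=> iA; apply: (@homo_leq _ _ (fun X Y : set T => X `<=` Y)) => // [X x|Y X Z XY YZ x /XY /YZ] //.
Qed.

Lemma subset_nonincreasing (A : nat -> set T) : (forall n, A n.+1 `<=` A n) ->
  forall m n, (m <= n)%N -> A n `<=` A m.
Proof.
move=> iA; apply: (@homo_leq _ _ (fun X Y : set T => Y `<=` X)) => // [X x|Y X Z YX ZY x /ZY /YX] //.
Qed.

(** Dominated convergence with majorant [|f|^2]: every point has left [A n] from some index on. *)
Lemma chi2_cvg0 (A : nat -> set T) f : (forall n, measurable (A n)) ->
  (forall n, A n.+1 `<=` A n) -> \bigcap_n A n = set0 ->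
  nsq (chi2 (A n) f) @[n --> \oo] --> (0 : R).
Proof.
move=> mA dA A0.
pose F n x := (\1_(A n) x * normc (L0_fun f x) ^+ 2)%:E : \bar R.
have mF n : measurable_fun setT (F n).
  rewrite /F; under eq_fun do rewrite EFinM.
  apply: emeasurable_funM; last exact: measurable_normc2.
  by apply/measurable_EFinP; exact: measurable_indic.
have FE n : (\int[mu]_x F n x = (nsq (chi2 (A n) f))%:E)%E.
  rewrite nsq_EFin; apply: ae_eq_integral => //.
    exact: measurable_normc2.
  by apply: filterS (chiE f (mA n)) => x /= -> _; rewrite normc_indic.
have [] := @dominated_convergence _ _ _ mu setT measurableT F (cst 0%E)
  (fun x => (normc (L0_fun f x) ^+ 2)%:E) mF (measurable_cst _) _ (integrable_normc2 f) _.
- apply: aeW => x _; have : ~ (\bigcap_n A n) x by rewrite A0.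
  move=> /existsNP[n /not_implyP[_ nAx]].
  apply: cvg_near_cst; exists n => // m /= nm; rewrite /F indicE.
  rewrite memNset ?mul0r// => Amx; apply: nAx.
  by apply: subset_nonincreasing nm _ Amx.
- apply: aeW => x n _; rewrite /F /= lee_fin ger0_norm.
    by rewrite indicE; case: (_ \in _); rewrite ?mul1r ?mul0r ?sqr_ge0.
  by rewrite mulr_ge0 ?sqr_ge0.
move=> _ _; rewrite integral0; under eq_fun do rewrite FE.
by move/fine_cvgP => [_].
Qed.

(** Monotone convergence. This is how an element of [V] is recognised as lying in [L2], hence as
    zero. *)
Lemma nondecreasing_finL2 (A : nat -> set T) u (c : R) :
  (forall n, measurable (A n)) ->
  (forall n, A n `<=` A n.+1) -> \bigcup_n A n = setT ->
  (forall n, exists2 g : L2 mu, g = chi (A n) u :> L0 mu & nsq g <= c) ->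
  u \in finL2.
Proof.
move=> mA iA AT bA.
pose F n x := (\1_(A n) x * normc (L0_fun u x) ^+ 2)%:E : \bar R.
have mF n : measurable_fun setT (F n).
  rewrite /F; under eq_fun do rewrite EFinM.
  apply: emeasurable_funM; last exact: measurable_normc2.
  by apply/measurable_EFinP; exact: measurable_indic.
have F0 n x : setT x -> (0 <= F n x)%E.
  by move=> _; rewrite lee_fin mulr_ge0 ?sqr_ge0.
have FE n : (\int[mu]_x F n x <= c%:E)%E.
  have [g gE gc] := bA n.
  rewrite (_ : integral _ _ _ = (nsq g)%:E) ?lee_fin//.
  rewrite nsq_EFin; apply: ae_eq_integral => //.
    exact: measurable_normc2.
  by rewrite gE; apply: filterS (chiE u (mA n)) => x /= -> _; rewrite normc_indic.
have nA := subset_nondecreasing iA.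
have ndF x : setT x -> nondecreasing_seq (F^~ x).
  move=> _ m n mn; rewrite lee_fin ler_wpM2r ?sqr_ge0//.
  rewrite !indicE ler_nat; case: (boolP (x \in A m)) => // /set_mem/(nA _ _ mn) Anx.
  by rewrite mem_set.
apply/finL2P; rewrite /square_integrable_on.
have := @cvg_monotone_convergence _ _ _ mu setT measurableT F mF F0 ndF.
rewrite (_ : (\int[mu]_x limn (F^~ x))%E =
    \int[mu]_x (normc (L0_fun u x) ^+ 2)%:E)%E; last first.
  apply: eq_integral => x _; have : (\bigcup_n A n) x by rewrite AT.
  move=> [n _ Anx]; apply: cvg_lim => //; apply: cvg_near_cst.
  exists n => // m /= nm; rewrite /F indicE mem_set ?mul1r//.
  exact: nA nm _ Anx.
move=> /cvg_lim <- //; apply: (@le_lt_trans _ _ c%:E); last exact: ltry.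
apply: lime_le; last exact: nearW.
apply: ereal_nondecreasing_is_cvgn => m n mn; apply: ge0_le_integral => //.
- by move=> x; exact: F0.
- by move=> x _; exact: (ndF x I m n mn).
Qed.
End Chi.

(** * Completeness of [L2] *)

Section Completeness.
Context {d} {T : measurableType d} {R : realType}.
Variable mu : {measure set T -> \bar R}.
Implicit Types (f g h : L2 mu).

Lemma cvg_of_geometric_increments (a : nat -> R) (c : R) :
  (forall k, `|a k.+1 - a k| <= c * 2^-1 ^+ k) -> cvgn a.
Proof.
move=> ac; have -> : a = (fun n => a 0%N + series (telescope a) n).
  by apply/funext => n; exact: eq_sum_telescope.
apply: is_cvgD; first exact: is_cvg_cst.
apply: normed_cvg; apply: (@series_le_cvg _ _ (geometric c 2^-1)) => //.
- by move=> n; exact: normr_ge0.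
- move=> n; rewrite /= mulr_ge0 ?exprn_ge0 ?invr_ge0//.
  by have := le_trans (normr_ge0 _) (ac 0%N); rewrite expr0 mulr1.
- by apply: is_cvg_geometric_series; rewrite ger0_norm ?invr_ge0// invf_lt1// ltr1n.
Qed.

Lemma sum_pow_half n : \sum_(k < n) (2^-1 : R) ^+ k <= 2.
Proof.
suff -> : \sum_(k < n) (2^-1 : R) ^+ k = 2 - 2 * 2^-1 ^+ n.
  by rewrite gerBl mulr_ge0// exprn_ge0// invr_ge0.
elim: n => [|n IH]; first by rewrite big_ord0 expr0 mulr1 subrr.
by rewrite big_ord_recr/= IH exprS; field.
Qed.

Definition sqdist u v x : R := normc (L0_fun (u : L0 mu) x - L0_fun (v : L0 mu) x) ^+ 2.

Lemma sqdist_ge0 u v x : 0 <= sqdist u v x. Proof. exact: sqr_ge0. Qed.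

Lemma measurable_sqdist u v : measurable_fun setT (sqdist u v).
Proof.
rewrite (_ : sqdist u v = (fun x =>
   (Re (L0_fun u x) - Re (L0_fun v x)) ^+ 2 + (Im (L0_fun u x) - Im (L0_fun v x)) ^+ 2)).
  by apply: measurable_funD; apply: measurable_funX; apply: measurable_funB;
     (exact: measurable_Re || exact: measurable_Im).
apply/funext => x; rewrite /sqdist normc2E.
by case: (L0_fun u x) (L0_fun v x) => ? ? [].
Qed.

Lemma integral_sqdist f g : (\int[mu]_x (sqdist f g x)%:E = (nsq (f - g))%:E)%E.
Proof.
rewrite nsq_EFin; apply: ae_eq_integral => //.
- by apply/measurable_EFinP; exact: measurable_sqdist.
- exact: measurable_normc2.
by apply: filterS (L0_funB f g) => x h _; rewrite /sqdist -h.
Qed.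

(* Weighting the increments by [4 ^ k] makes them square summable almost
   everywhere by monotone convergence alone, without Minkowski's inequality. *)
Lemma ae_geometric_increments (w : nat -> L2 mu) :
  (forall k, nsq (w k.+1 - w k) <= 8^-1 ^+ k) ->
  {ae mu, forall x, exists c : R, forall k, sqdist (w k.+1) (w k) x <= (c * 2^-1 ^+ k) ^+ 2}.
Proof.
move=> hw; pose b k x := 4 ^+ k * sqdist (w k.+1) (w k) x.
have b0 k x : 0 <= b k x.
  by apply: mulr_ge0; [exact: exprn_ge0|exact: sqdist_ge0].
have mb k : measurable_fun setT (b k).
  by apply: measurable_funM => //; exact: measurable_sqdist.
pose G n x := (\sum_(k < n) b k x)%:E.
have mG n : measurable_fun setT (G n).
  by apply/measurable_EFinP; exact: measurable_sum.
have G0 n x : setT x -> (0 <= G n x)%E by move=> _; rewrite lee_fin sumr_ge0.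
have ndG x : setT x -> nondecreasing_seq (G^~ x).
  move=> _; apply/nondecreasing_seqP => n; rewrite lee_fin big_ord_recr/=.
  by rewrite lerDl.
have intG n : (\int[mu]_x G n x <= 2%:E)%E.
  rewrite /G; under eq_integral do rewrite -sumEFin.
  rewrite ge0_integral_sum//; last 2 first.
  - by move=> k; apply: measurableT_comp => //; exact: mb.
  - by move=> k x _; rewrite lee_fin.
  apply: (@le_trans _ _ (\sum_(k < n) (2^-1 ^+ k)%:E)%E); last first.
    by rewrite sumEFin lee_fin sum_pow_half.
  apply: lee_sum => k _; rewrite /b; under eq_integral do rewrite EFinM.
  rewrite ge0_integralZl//; last 2 first.
  - by apply/measurable_EFinP; exact: measurable_sqdist.
  - by move=> x _; rewrite lee_fin sqdist_ge0.
  rewrite integral_sqdist -EFinM lee_fin.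
  apply: (le_trans (ler_wpM2l _ (hw k))); first exact: exprn_ge0.
  by rewrite -exprMn (_ : 4 * 8^-1 = 2^-1 :> R)//; field.
have iG : mu.-integrable setT (fun x => limn (G^~ x)).
  apply/integrableP; split.
    apply: (emeasurable_fun_cvg G) => // x _.
    exact: ereal_nondecreasing_is_cvgn (ndG x I).
  apply: (@le_lt_trans _ _ 2%:E); last exact: ltry.
  rewrite (_ : integral _ _ _ = (\int[mu]_x limn (G^~ x))%E); last first.
    apply: eq_integral => x _; rewrite gee0_abs//.
    apply: lime_ge; first exact: ereal_nondecreasing_is_cvgn (ndG x I).
    by apply: nearW => n; exact: G0.
  have /cvg_lim <- // := @cvg_monotone_convergence _ _ _ mu setT measurableT G mG G0 ndG.
  apply: lime_le; last exact: nearW.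
  apply: ereal_nondecreasing_is_cvgn => m n mn; apply: ge0_le_integral => //.
  - by move=> x; exact: G0.
  - by move=> x _; exact: (ndG x I m n mn).
apply: filterS (integrable_ae measurableT iG) => x /(_ I) fG.
(* The limit of the partial sums bounds each weighted term, and the weight [4 ^+ k] is the square of
   [2 ^+ k]. *)
exists (Num.sqrt (fine (limn (G^~ x)))) => k.
have bk : b k x <= fine (limn (G^~ x)).
  rewrite -lee_fin fineK//; apply: lime_ge.
    exact: ereal_nondecreasing_is_cvgn (ndG x I).
  exists k.+1 => // n /= kn; apply: le_trans (ndG x I _ _ kn).
  by rewrite lee_fin big_ord_recr/= lerDr sumr_ge0.
rewrite exprMn sqr_sqrtr; last exact: le_trans bk.
rewrite -exprM mulnC exprM expr2 -invfM -natrM exprVn ler_pdivlMr ?exprn_gt0//.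
by rewrite mulrC.
Qed.

Lemma sqdist_Re u v x (c : R) : 0 <= c -> sqdist u v x <= c ^+ 2 ->
  `|Re (L0_fun (u : L0 mu) x) - Re (L0_fun (v : L0 mu) x)| <= c.
Proof.
move=> c0; rewrite /sqdist normc2E => h.
rewrite -(@ler_pXn2r _ 2)// real_normK ?num_real// (le_trans _ h)//.
by case: (L0_fun u x) (L0_fun v x) => ? ? [] ? ? /=; rewrite lerDl sqr_ge0.
Qed.

Lemma sqdist_Im u v x (c : R) : 0 <= c -> sqdist u v x <= c ^+ 2 ->
  `|Im (L0_fun (u : L0 mu) x) - Im (L0_fun (v : L0 mu) x)| <= c.
Proof.
move=> c0; rewrite /sqdist normc2E => h.
rewrite -(@ler_pXn2r _ 2)// real_normK ?num_real// (le_trans _ h)//.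
by case: (L0_fun u x) (L0_fun v x) => ? ? [] ? ? /=; rewrite lerDr sqr_ge0.
Qed.

Lemma ae_limit_exists (w : nat -> L2 mu) :
  (forall k, nsq (w k.+1 - w k) <= 8^-1 ^+ k) ->
  exists v : L0 mu, {ae mu, forall x,
    (Re (L0_fun (w k) x) @[k --> \oo] --> Re (L0_fun v x)) /\
    (Im (L0_fun (w k) x) @[k --> \oo] --> Im (L0_fun v x))}.
Proof.
move=> hw.
(* The upper limit is measurable without any convergence and equals the limit wherever that exists;
   its values on the remaining null set are irrelevant. *)
pose lim_ (p : nat -> T -> R) x := fine (limn_esup (fun k => (p k x)%:E)).
have mlim p : (forall k, measurable_fun setT (p k)) -> measurable_fun setT (lim_ p).
  move=> mp; apply: (measurableT_comp (fine_measurable measurableT)).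
  by apply: measurable_fun_limn_esup => k; exact/measurable_EFinP.
have limE p x : cvgn (p^~ x) -> p k x @[k --> \oo] --> lim_ p x.
  move=> cp; have cE : (p k x)%:E @[k --> \oo] --> (limn (p^~ x))%:E.
    by apply: cvg_EFin; [exact: nearW|exact: cp].
  by rewrite /lim_ (cvg_limn_einf_sup cE).2.
pose gR := lim_ (fun k x => Re (L0_fun (w k) x)).
pose gI := lim_ (fun k x => Im (L0_fun (w k) x)).
have mg : (fun x => gR x +i* gI x) \in cmeasurable.
  apply/cmeasurableP; split.
  - by apply: mlim => k; exact: measurable_Re.
  - by apply: mlim => k; exact: measurable_Im.
exists (L0_class mu (CMfun mg)).
apply: filterS2 (repr_classE mu (CMfun mg)) (ae_geometric_increments hw) => x -> [c hc].
have hc' k : sqdist (w k.+1) (w k) x <= (`|c| * 2^-1 ^+ k) ^+ 2.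
  by rewrite (le_trans (hc k))// !exprMn real_normK ?num_real.
have ck k : 0 <= `|c| * 2^-1 ^+ k by rewrite mulr_ge0// exprn_ge0// invr_ge0.
split; apply: limE; apply: (@cvg_of_geometric_increments _ `|c|) => k.
- exact: sqdist_Re.
- exact: sqdist_Im.
Qed.

(** Here [v] is still only a class of measurable functions, so the conclusion is an integral bound;
    it is also what puts [v] into [L2] later. *)
Lemma fatou_L2 (w : nat -> L2 mu) (v : L0 mu) (u : L2 mu) (e : R) :
  {ae mu, forall x,
    (Re (L0_fun (w k) x) @[k --> \oo] --> Re (L0_fun v x)) /\
    (Im (L0_fun (w k) x) @[k --> \oo] --> Im (L0_fun v x))} ->
  (\forall k \near \oo, nsq (u - w k) <= e) ->
  (\int[mu]_x (normc (L0_fun (L2_val u - v) x) ^+ 2)%:E <= e%:E)%E.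
Proof.
move=> wv we.
pose F k x := (sqdist u (w k) x)%:E : \bar R.
have mF k : measurable_fun setT (F k) by apply/measurable_EFinP; exact: measurable_sqdist.
have F0 k x : setT x -> (0 <= F k x)%E by rewrite lee_fin sqdist_ge0.
have := fatou mu measurableT mF F0.
rewrite (_ : integral _ _ _ = \int[mu]_x (normc (L0_fun (L2_val u - v) x) ^+ 2)%:E)%E.
  move=> /le_trans; apply.
  have [N _ hN] := we.
  rewrite limn_einf_lim; apply: lime_le; first exact: is_cvg_einfs.
  (* The tail infimum starts at [n] and the estimate [hN] at [N]; the index must pass both. *)
  apply: nearW => n; apply: ereal_inf_le; exists (\int[mu]_x F (maxn n N) x)%E.
    by exists (maxn n N) => //=; rewrite leq_maxl.
  by rewrite integral_sqdist lee_fin hN//= leq_maxr.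
apply: ae_eq_integral => //; first by apply: measurableT_comp => //;
    apply: measurable_fun_limn_esup => k; exact: measurableT_comp.
  exact: measurable_normc2.
apply: filterS2 wv (L0_funB u v) => x [cR cI] E _.
have -> : normc (L0_fun (L2_val u - v) x) ^+ 2 = sqdist u v x by rewrite E.
apply: (cvg_limn_einf_sup _).1; apply: cvg_EFin; first exact: nearW.
have sqE a b : sqdist a b x =
    (Re (L0_fun a x) - Re (L0_fun b x)) * (Re (L0_fun a x) - Re (L0_fun b x)) +
    (Im (L0_fun a x) - Im (L0_fun b x)) * (Im (L0_fun a x) - Im (L0_fun b x)).
  by rewrite /sqdist normc2E !expr2; case: (L0_fun a x) (L0_fun b x) => ? ? [].
rewrite /F sqE (_ : _ \o _ = fun k => sqdist u (w k) x)//.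
under eq_fun do rewrite sqE.
by apply: cvgD; apply: cvgM; apply: cvgB => //; exact: cvg_cst.
Qed.

Lemma L2_complete (u : nat -> L2 mu) :
  (forall e, 0 < e -> exists N, forall m n, (N <= m)%N -> (N <= n)%N ->
    nsq (u m - u n) <= e) ->
  exists g, forall e, 0 < e -> exists N, forall n, (N <= n)%N -> nsq (u n - g) <= e.
Proof.
move=> cu.
have e8 k : 0 < (8^-1 : R) ^+ k by rewrite exprn_gt0// invr_gt0.
pose N k := projT1 (cid (cu _ (e8 k))).
have NP k m n : (N k <= m)%N -> (N k <= n)%N -> nsq (u m - u n) <= 8^-1 ^+ k.
  exact: projT2 (cid (cu _ (e8 k))) m n.
(* [M k] dominates [N 0], ..., [N k], so [M k] and [M k.+1] both lie beyond [N k]; the summand [k]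
   makes the subsequence tend to infinity. *)
pose M k := (k + \max_(j < k.+1) N j)%N.
have NM j k : (j <= k)%N -> (N j <= M k)%N.
  move=> jk; apply: leq_trans (leq_addl k _).
  exact: (@leq_bigmax _ _ (Ordinal (jk : (j < k.+1)%N))).
have [v hv] := @ae_limit_exists (fun k => u (M k))
  (fun k => NP k _ _ (NM k k.+1 (leqnSn k)) (NM k k (leqnn k))).
have main e : 0 < e -> exists N, forall n, (N <= n)%N ->
    (\int[mu]_x (normc (L0_fun (L2_val (u n) - v) x) ^+ 2)%:E <= e%:E)%E.
  move=> e0; have [K hK] := cu _ e0; exists K => n Kn.
  apply: fatou_L2 hv _; exists K => // k /= Kk; apply: hK => //.
  by rewrite (leq_trans Kk)// leq_addr.
have [K hK] := main 1 ltr01.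
have vL2 : L2_val (u K) - v \in finL2.
  by apply/finL2P; apply: le_lt_trans (hK K (leqnn K)) (ltry _).
pose g := u K - MkL2 vL2.
have gE : L2_val g = v by rewrite L2_valB /= opprB addrC subrK.
exists g => e /main[N' hN']; exists N' => n Nn.
by have := hN' n Nn; rewrite -lee_fin nsq_EFin L2_valB gE.
Qed.

End Completeness.

(** * Orthogonal projections *)

Section Projection.
Context {d} {T : measurableType d} {R : realType}.
Variable mu : {measure set T -> \bar R}.
Implicit Types (f g h : L2 mu) (M : set (L2 mu)).

Definition closed_subspace M := linear_subspace M /\ norm_closed M.

Lemma subspaceZD M a f g : linear_subspace M -> M f -> M g -> M (a *: f + g).
Proof. by move=> [_ hM]; exact: hM. Qed.

Lemma subspaceD M f g : linear_subspace M -> M f -> M g -> M (f + g).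
Proof. by move=> hM Mf Mg; rewrite -[f]scale1r; exact: subspaceZD. Qed.

Lemma subspaceZ M a f : linear_subspace M -> M f -> M (a *: f).
Proof. by move=> hM Mf; rewrite -[_ *: _]addr0; apply: subspaceZD => //; case: hM. Qed.

Lemma subspaceN M f : linear_subspace M -> M f -> M (- f).
Proof. by move=> hM Mf; rewrite -scaleN1r; exact: subspaceZ. Qed.

Lemma subspaceB M f g : linear_subspace M -> M f -> M g -> M (f - g).
Proof. by move=> hM Mf Mg; apply: subspaceD => //; exact: subspaceN. Qed.

Lemma norm_closed_nsq M : norm_closed M <->
  forall f, (forall e : R, 0 < e -> exists2 g, M g & nsq (f - g) <= e) -> M f.
Proof.
split=> hM f hf; apply: hM => e e0.
- have e20 : 0 < (e / 2) ^+ 2 by rewrite exprn_gt0// divr_gt0.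
  have [g Mg gE] := hf _ e20; exists g => //.
  rewrite L2norm_ltr ?ltW// (le_lt_trans gE)// ltr_pXn2r// ?nnegrE ?divr_ge0 ?ltW//.
  by rewrite gtr_pMr// invf_lt1// ltr1n.
- have [|g Mg gE] := hf (Num.sqrt e); first by rewrite sqrtr_gt0.
  exists g => //; move: gE; rewrite L2norm_ltr ?sqrtr_ge0// sqr_sqrtr; first exact: ltW.
  exact: ltW.
Qed.

Lemma norm_closed_seq M (u : nat -> L2 mu) g : norm_closed M -> (forall n, M (u n)) ->
  (forall e, 0 < e -> exists N, forall n, (N <= n)%N -> nsq (u n - g) <= e) -> M g.
Proof.
move=> /norm_closed_nsq hM Mu ug; apply: hM => e /ug[N hN]; exists (u N) => //.
by rewrite -nsqN opprB hN.
Qed.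

Lemma inv_nat_small (e : R) : 0 < e ->
  exists N, forall n, (N <= n)%N -> n.+1%:R^-1 <= e.
Proof.
move=> e0; exists (Num.truncn e^-1) => n Nn.
rewrite invf_ple ?posrE//; apply: le_trans (ltW (truncnS_gt _)) _.
by rewrite ler_nat ltnS.
Qed.

(** The imaginary part of [dot x h] is the real part of [dot x (i h)]. *)
Lemma dot_eq0_of_rdot M x : linear_subspace M -> (forall h, M h -> rdot x h = 0) ->
  forall h, M h -> dot x h = 0.
Proof.
move=> hM x0 h Mh; have := x0 _ Mh; have := x0 _ (subspaceZ 'i%C hM Mh).
rewrite /rdot dotZr; case: (dot x h) => a b /=.
by rewrite mul0r sub0r mulN1r opprK => -> ->.
Qed.

Lemma proj_exists M f : closed_subspace M ->
  exists g, M g /\ forall h, M h -> dot (f - g) h = 0.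
Proof.
move=> [lM cM]; pose S := [set nsq (f - m) | m in M].
have S0 : lbound S 0 by move=> _ [m _ <-]; exact: nsq_ge0.
have hS : has_inf S.
  by split; [exists (nsq (f - 0)), 0 => //; case: lM|exists 0].
pose dd := inf S.
have ddle m : M m -> dd <= nsq (f - m) by move=> Mm; apply: ge_inf; [exists 0|exists m].
have inv0 n : 0 < n.+1%:R^-1 :> R by rewrite invr_gt0.
have ex n : exists m, M m /\ nsq (f - m) <= dd + n.+1%:R^-1.
  have [_ [m Mm <-] hm] := inf_adherent (inv0 n) hS; exists m; split => //.
  exact: ltW.
pose u n := projT1 (cid (ex n)).
have Mu n : M (u n) := (projT2 (cid (ex n))).1.
have uP n : nsq (f - u n) <= dd + n.+1%:R^-1 := (projT2 (cid (ex n))).2.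
(* The midpoint of [u i] and [u j] lies in [M], so the parallelogram law makes the minimising
   sequence Cauchy. *)
have uC i j : nsq (u i - u j) <= 2 * i.+1%:R^-1 + 2 * j.+1%:R^-1.
  have := parallelogram (f - u j) (f - u i).
  rewrite opprB addrACA -opprD [f - u j + _]addrC addrA subrK.
  have Mm : M (2^-1%:C *: (u j + u i)).
    by apply: subspaceZ => //; exact: subspaceD.
  have -> : f + f - (u j + u i) = 2%:C *: (f - 2^-1%:C *: (u j + u i)).
    rewrite scalerBr scalerA -rmorphM /= divff// scale1r.
    by rewrite rmorph_nat scaler_nat mulr2n.
  rewrite nsqZ /= expr0n addr0 sqrtr_sqr ger0_norm//.
  have := ddle _ Mm; have := uP i; have := uP j.
  set a := nsq _; set b := nsq _; set c := nsq _; set e := nsq (u i - u j).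
  set p := _^-1; set q := _^-1; move: a b c e p q => a b c e p q; clear; lra.
have [g ug] : exists g, forall e, 0 < e -> exists N, forall n, (N <= n)%N -> nsq (u n - g) <= e.
  apply: L2_complete => e e0.
  have e40 : 0 < e / 4 by rewrite divr_gt0.
  have [N hN] := inv_nat_small e40; exists N => m n /hN + /hN.
  have := uC m n; set a := nsq _; set p := _^-1; set q := n.+1%:R^-1.
  by move: a p q => a p q; lra.
have Mg := norm_closed_seq cM Mu ug.
exists g; split => //; apply: dot_eq0_of_rdot => // h Mh.
(* Moving [u n] by the optimal multiple of [h] lowers the squared distance by
   [rdot (f - u n) h ^+ 2 / nsq h], which cannot exceed the slack [1 / (n + 1)]. *)
have var n : rdot (f - u n) h ^+ 2 <= nsq h / n.+1%:R.
  have [h0|h0] := eqVneq (nsq h) 0.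
    by rewrite (nsq_eq0 h0) rdot0r expr0n nsq0 mul0r.
  have hp : 0 < nsq h by rewrite lt_neqAle eq_sym h0 nsq_ge0.
  have := ddle _ (subspaceD lM (Mu n) (subspaceZ (rdot (f - u n) h / nsq h)%:C lM Mh)).
  rewrite opprD addrA nsqB rdotZr nsqZ /= expr0n addr0 sqrtr_sqr real_normK ?num_real//.
  have := uP n; 
  set c := rdot _ h; set N := nsq h; set x := nsq _ => x1 x2.
  have e1 : (c / N) ^+ 2 * N = c ^+ 2 / N by field.
  have e2 : 2 * (c / N * c) = 2 * (c ^+ 2 / N) by ring.
  rewrite mulrC -ler_pdivrMr//; rewrite e1 e2 in x2.
  by move: x1 x2; set y := _^-1; set z := c ^+ 2 / N; move: x y z => x y z; clear; lra.
have sm e : 0 < e -> rdot (f - g) h ^+ 2 <= e * (4 * nsq h).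
  move=> e0; have [N1 hN1] := ug _ e0; have [N2 hN2] := inv_nat_small e0.
  pose n := maxn N1 N2.
  have -> : rdot (f - g) h = rdot (f - u n) h + rdot (u n - g) h.
    by rewrite -rdotDl addrA subrK.
  have h1 : rdot (f - u n) h ^+ 2 <= e * nsq h.
    apply: le_trans (var n) _; rewrite mulrC ler_wpM2r ?nsq_ge0//.
    by rewrite hN2// leq_maxr.
  have h2 : rdot (u n - g) h ^+ 2 <= e * nsq h.
    apply: le_trans (rdot_CS _ _) _; rewrite ler_wpM2r ?nsq_ge0//.
    by rewrite hN1// leq_maxl.
  have := sqr_ge0 (rdot (f - u n) h - rdot (u n - g) h).
  by rewrite mulrCA; move: h1 h2; set a := rdot _ _; set b := rdot _ _; set c := e * nsq h; nra.
apply/eqP; rewrite -sqrf_eq0 eq_le sqr_ge0 andbT.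
apply/ler_addgt0Pr => e e0; rewrite add0r.
have k0 : 0 < 4 * nsq h + 1 by rewrite ltr_wpDl// mulr_ge0// nsq_ge0.
have := sm _ (divr_gt0 e0 k0) => /le_trans; apply.
rewrite mulrAC ler_pdivrMr// ler_pM2l// lerDl//.
Qed.

Lemma orth_projP M f : closed_subspace M ->
  M (orth_proj M f) /\ forall h, M h -> dot (f - orth_proj M f) h = 0.
Proof.
move=> hM; have [g gP] := proj_exists f hM.
exact: (@xgetPex _ 0 [set g | M g /\ forall h, M h -> dot (f - g) h = 0]
  (ex_intro _ g gP)).
Qed.

Lemma orth_proj_eq M f g : closed_subspace M -> M g ->
  (forall h, M h -> dot (f - g) h = 0) -> orth_proj M f = g.
Proof.
move=> hM Mg gP; have [MP PP] := orth_projP f hM.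
apply/eqP; rewrite -subr_eq0; apply/eqP/nsq_eq0.
set x := orth_proj M f - g.
have Mx : M x by apply: subspaceB => //; case: hM.
have := PP _ Mx; have -> : f - orth_proj M f = (f - g) - x.
  by rewrite /x opprB addrA subrK.
rewrite dotBl gP// sub0r => /eqP; rewrite oppr_eq0 => /eqP.
by rewrite dotff => -[].
Qed.

Section Fixed.
Variable M : set (L2 mu).
Hypothesis hM : closed_subspace M.
Let lM : linear_subspace M. Proof. by case: hM. Qed.

Lemma orth_proj_in f : M (orth_proj M f). Proof. by case: (orth_projP f hM). Qed.

Lemma orth_proj_dot f h : M h -> dot (f - orth_proj M f) h = 0.
Proof. by case: (orth_projP f hM) => _; exact. Qed.

Lemma orth_proj_dotE f h : M h -> dot f h = dot (orth_proj M f) h.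
Proof. by move=> /(orth_proj_dot f)/eqP; rewrite dotBl subr_eq0 => /eqP. Qed.

Lemma orth_proj_id f : M f -> orth_proj M f = f.
Proof. by move=> Mf; apply: orth_proj_eq => // h _; rewrite subrr dot0l. Qed.

Lemma orth_proj_linear : linear (orth_proj M).
Proof.
move=> a f g; apply: orth_proj_eq => //.
  by apply: subspaceZD => //; exact: orth_proj_in.
move=> h Mh.
by rewrite dotBl !dotDZl (orth_proj_dotE f Mh) (orth_proj_dotE g Mh) subrr.
Qed.

Lemma orth_proj_sym f g : dot (orth_proj M f) g = dot f (orth_proj M g).
Proof.
rewrite (orth_proj_dotE f (orth_proj_in g)) dotC.
by rewrite (orth_proj_dotE g (orth_proj_in f)) -dotC.
Qed.

Lemma rdot_orth_proj f : rdot (orth_proj M f) f = nsq (orth_proj M f).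
Proof. by rewrite rdotC /nsq /rdot (orth_proj_dotE f (orth_proj_in f)). Qed.

Lemma nsq_orth_proj f : nsq f = nsq (orth_proj M f) + nsq (f - orth_proj M f).
Proof. by rewrite nsqB rdotC rdot_orth_proj; ring. Qed.

Lemma nsq_orth_proj_le f : nsq (orth_proj M f) <= nsq f.
Proof. by rewrite [leRHS]nsq_orth_proj lerDl nsq_ge0. Qed.

Lemma orth_proj_bounded : bounded_op (orth_proj M).
Proof.
split; first exact: orth_proj_linear.
by exists 1 => f; rewrite mul1r L2norm_le nsq_orth_proj_le.
Qed.

End Fixed.

End Projection.

(* Unification would otherwise unfold these constants down to integrals. *)
Opaque dot.

(** * Sums over arbitrary index sets *)

Section EsumExtra.
Context {R : realType} {I : choiceType}.
Implicit Types (A : set I) (a b : I -> R) (s t : seq I).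

(** Finite subsets are represented by duplicate-free sequences, on which finite sums are easily
    split and reordered. *)
Lemma esum_ub A a (c : \bar R) :
  (forall s, uniq s -> (forall x, x \in s -> A x) -> ((\sum_(x <- s) a x)%:E <= c)%E) ->
  (\esum_(x in A) (a x)%:E <= c)%E.
Proof.
move=> h; apply: ge_ereal_sup => /= _ [X [finX XA] <-].
rewrite fsbig_finite// sumEFin; apply: h; first exact: fset_uniq.
by move=> x; rewrite in_fset_set// => /set_mem/XA.
Qed.

Lemma esum_lb A a s : uniq s -> (forall x, x \in s -> A x) ->
  ((\sum_(x <- s) a x)%:E <= \esum_(x in A) (a x)%:E)%E.
Proof.
move=> us sA; apply: esum_ge; exists [set` s].
  by split; [exact: finite_seq|exact: sA].
by rewrite -fsbig_seq// sumEFin.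
Qed.

Lemma sum_uniq_sub (a : I -> R) s t : (forall x, 0 <= a x) -> uniq s -> uniq t ->
  {subset s <= t} -> \sum_(x <- s) a x <= \sum_(x <- t) a x.
Proof.
move=> a0 us ut st; rewrite [leRHS](bigID (mem s))/= -[X in X + _]big_filter.
have -> : \sum_(x <- [seq x <- t | x \in s]) a x = \sum_(x <- s) a x.
  apply: perm_big; apply: uniq_perm; rewrite ?filter_uniq// => x.
  by rewrite mem_filter; case: (boolP (x \in s)) => //= /st ->.
by rewrite lerDl sumr_ge0.
Qed.

(** [s] enumerates a finite set whose sum is within [e] of the supremum; a disjoint [t] of larger
    sum would overshoot it. *)
Lemma esum_tail A a (e : R) : (forall x, 0 <= a x) ->
  (\esum_(x in A) (a x)%:E < +oo)%E -> 0 < e ->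
  exists s, [/\ uniq s, (forall x, x \in s -> A x) &
    forall t, uniq t -> (forall x, x \in t -> A x /\ x \notin s) ->
      \sum_(x <- t) a x <= e].
Proof.
move=> a0 afin e0.
have aE : (\esum_(x in A) (a x)%:E)%E \is a fin_num.
  by rewrite ge0_fin_numE// esum_ge0// => x _; rewrite lee_fin.
have [_ [X [finX XA] <-] hX] := ub_ereal_sup_adherent e0 aE.
exists (fset_set X); split; first exact: fset_uniq.
  by move=> x; rewrite in_fset_set// => /set_mem/XA.
move=> t ut tA; rewrite leNgt; apply/negP => et.
have tX : uniq (t ++ fset_set X).
  rewrite cat_uniq ut fset_uniq andbT/=; apply/hasPn => x xX.
  by apply/negP => /tA[_]; rewrite xX.
have tXA x : x \in t ++ fset_set X -> A x.
  by rewrite mem_cat in_fset_set// => /orP[/tA[]//|/set_mem/XA].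
have := esum_lb a tX tXA; rewrite big_cat/=.
apply/negP; rewrite -ltNge -(fineK aE) lte_fin.
move: hX; rewrite fsbig_finite// sumEFin -/(esum _ _) -(fineK aE) lte_fin /=.
by move: et; set p := \sum_(_ <- t) _; set q := \sum_(_ <- _) _; set r := fine _; lra.
Qed.

Lemma cvg0_le (u : nat -> R) (e : R) : u n @[n --> \oo] --> (0 : R) -> 0 < e ->
  exists N, forall n, (N <= n)%N -> u n <= e.
Proof.
move=> u0 e0; have /cvgrPdist_le/(_ _ e0)[N _ hN] := u0.
exists N => n /hN; rewrite sub0r normrN; exact/le_trans/ler_norm.
Qed.

Lemma sum_cvg0_le (b : nat -> I -> R) s :
  (forall x, x \in s -> b n x @[n --> \oo] --> (0 : R)) ->
  forall e, 0 < e -> exists N, forall n, (N <= n)%N -> \sum_(x <- s) b n x <= e.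
Proof.
elim: s => [|x s IH] b0 e e0.
  by exists 0%N => n _; rewrite big_nil ltW.
have e20 : 0 < e / 2 by rewrite divr_gt0.
have [N1 h1] := cvg0_le (b0 x (mem_head _ _)) e20.
have [|N2 h2] := IH _ _ e20; first by move=> y ys; apply: b0; rewrite in_cons ys orbT.
exists (maxn N1 N2) => n; rewrite geq_max => /andP[/h1 {}h1 /h2 {}h2].
by rewrite big_cons; lra.
Qed.

(** Dominated convergence for sums: the head given by [esum_tail] converges termwise, and the tail
    is at most [e / 2] for all [n] at once. *)
Lemma esum_dominated A a (b : nat -> I -> R) : (forall x, 0 <= a x) ->
  (\esum_(x in A) (a x)%:E < +oo)%E ->
  (forall n x, 0 <= b n x <= a x) ->
  (forall x, A x -> b n x @[n --> \oo] --> (0 : R)) ->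
  forall e, 0 < e -> exists N, forall n, (N <= n)%N ->
    (\esum_(x in A) (b n x)%:E <= e%:E)%E.
Proof.
move=> a0 afin ba b0 e e0; have e20 : 0 < e / 2 by rewrite divr_gt0.
have [s [us sA sP]] := esum_tail a0 afin e20.
have [N hN] := sum_cvg0_le (fun x xs => b0 x (sA x xs)) e20.
exists N => n /hN {}hN; apply: esum_ub => t ut tA; rewrite lee_fin.
rewrite (bigID (mem s))/= -[X in X + _]big_filter -[X in _ + X]big_filter [e]splitr lerD//.
- apply: le_trans hN; apply: sum_uniq_sub => //.
  + by move=> x; case/andP: (ba n x).
  + by rewrite filter_uniq.
  + by move=> x; rewrite mem_filter => /andP[].
- apply: (@le_trans _ _ (\sum_(x <- [seq x <- t | x \notin s]) a x)).
    by apply: ler_sum => x _; case/andP: (ba n x).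
  apply: sP; first by rewrite filter_uniq.
  by move=> x; rewrite mem_filter => /andP[-> /tA].
Qed.

Lemma esum_swap_le (A B : set I) (a : I -> I -> R) : (forall x y, 0 <= a x y) ->
  (\esum_(x in A) \esum_(y in B) (a x y)%:E <=
   \esum_(y in B) \esum_(x in A) (a x y)%:E)%E.
Proof.
move=> a0; apply: ge_ereal_sup => /= _ [X [finX XA] <-].
rewrite fsbig_finite// big_seq -esum_sum; last first.
  by move=> x y _ _; rewrite lee_fin.
apply: le_esum => y By; rewrite -big_seq sumEFin; apply: esum_lb => //.
by move=> x; rewrite in_fset_set// => /set_mem/XA.
Qed.

Lemma esum_swap (A B : set I) (a : I -> I -> R) : (forall x y, 0 <= a x y) ->
  (\esum_(x in A) \esum_(y in B) (a x y)%:E =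
   \esum_(y in B) \esum_(x in A) (a x y)%:E)%E.
Proof.
move=> a0; apply/eqP; rewrite eq_le esum_swap_le//.
by rewrite (@esum_swap_le B A (fun y x => a x y)).
Qed.

End EsumExtra.

(** * Orthonormal bases and the Hilbert-Schmidt norm *)

Section Basis.
Context {d} {T : measurableType d} {R : realType}.
Variable mu : {measure set T -> \bar R}.
Implicit Types (f g h e : L2 mu) (M : set (L2 mu)) (s : seq (L2 mu)).

(** Ensures that [onb] is not the default [set0] of [xget]. A maximal orthonormal set, given by
    Zorn's lemma, is a basis, since a unit vector orthogonal to it could be adjoined. *)
Lemma onb_exists : exists B : set (L2 mu), orthonormal_basis B.
Proof.
have [F FP Ftot|B [oB Bmax]] := @Zorn_bigcup _ (@Defs.orthonormal _ _ _ mu).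
  move=> e f [X FX Xe] [Y FY Yf].
  by have [XY|YX] := Ftot _ _ FX FY; [apply: (FP _ FY)|apply: (FP _ FX)] => //; auto.
exists B; split=> // f fB; apply: contrapT => f0.
have fp : 0 < nsq f.
  by rewrite lt_neqAle nsq_ge0 andbT eq_sym; apply/eqP => /nsq_eq0.
pose u := (L2norm f)^-1%:C *: f.
have uB e : B e -> dot u e = 0 by move=> Be; rewrite dotZl fB// mulr0.
have u1 : dot u u = 1.
  rewrite dotff nsqZ /= expr0n addr0 sqr_sqrtr ?sqr_ge0//.
  by rewrite exprVn L2norm2 mulVf// gt_eqF.
have uNB : ~ B u.
  by move=> /uB; rewrite u1 => /eqP; rewrite oner_eq0.
apply: (Bmax (B `|` [set u])).
  split; first by move=> e Be; left.
  by move=> h; apply: uNB; apply: h; right.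
move=> e g [Be|->] [Bg|->].
- exact: oB.
- rewrite dotC uB// conjc0; case: eqP => // eu.
  by case: uNB; rewrite -eu.
- rewrite uB//; case: eqP => // eu.
  by case: uNB; rewrite eu.
- by rewrite u1 eqxx.
Qed.

Lemma onbP : orthonormal_basis (@onb _ _ _ mu).
Proof. by have [B BP] := onb_exists; exact: (xgetPex set0 (ex_intro _ B BP)). Qed.

Let oB : forall e f, onb e -> onb f -> dot e f = (e == f)%:R := onbP.1.

Lemma dot_suml (J : Type) (r : seq J) (F : J -> L2 mu) h :
  dot (\sum_(j <- r) F j) h = \sum_(j <- r) dot (F j) h.
Proof. by elim/big_ind2: _ => [|x a y b <- <-|//]; rewrite ?dot0l// dotDl. Qed.

Definition proj_seq s f : L2 mu := \sum_(e <- s) dot f e *: e.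

Lemma proj_seq_dot s f e : uniq s -> (forall x, x \in s -> onb x) -> e \in s ->
  dot (proj_seq s f) e = dot f e.
Proof.
move=> us sB es; have Be := sB _ es.
rewrite dot_suml (bigD1_seq e)//= dotZl (oB Be Be) eqxx mulr1.
rewrite big_seq_cond big1 ?addr0// => x /andP[xs xe].
by rewrite dotZl (oB (sB _ xs) Be) (negbTE xe) mulr0.
Qed.

Lemma Re_sum (J : Type) (r : seq J) (F : J -> R[i]) :
  Re (\sum_(j <- r) F j) = \sum_(j <- r) Re (F j).
Proof.
elim: r => [|j r IH]; first by rewrite !big_nil.
by rewrite !big_cons -IH; case: (F j) (\sum_(_ <- _) _) => ? ? [].
Qed.

Lemma nsq_proj_seq s f : uniq s -> (forall x, x \in s -> onb x) ->
  nsq f = \sum_(e <- s) normc (dot f e) ^+ 2 + nsq (f - proj_seq s f).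
Proof.
move=> us sB; set p := proj_seq s f.
have dp x : dot p x = \sum_(e <- s) dot f e * dot e x.
  by rewrite /p dot_suml; apply: eq_bigr => e _; rewrite dotZl.
have ep e : e \in s -> dot e p = dot e f.
  by move=> es; rewrite dotC (proj_seq_dot f us sB es) -dotC.
have pE : nsq p = \sum_(e <- s) normc (dot f e) ^+ 2.
  rewrite /nsq /rdot dp Re_sum; apply: eq_big_seq => e es.
  rewrite ep// (dotC e) normc2E.
  by case: (dot f e) => a b /=; ring.
have fp : rdot f p = nsq p.
  rewrite rdotC /nsq /rdot !dp; congr Re.
  by apply: eq_big_seq => e es; rewrite ep.
by rewrite nsqB fp -pE; ring.
Qed.

Lemma bessel s f : uniq s -> (forall x, x \in s -> onb x) ->
  \sum_(e <- s) normc (dot f e) ^+ 2 <= nsq f.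
Proof. by move=> us sB; rewrite [leRHS](nsq_proj_seq f us sB) lerDl nsq_ge0. Qed.

Let lin (l : seq (R[i] * L2 mu)) : L2 mu := \sum_(p <- l) p.1 *: p.2.

(** The closed linear span of the basis; a finite combination is a list of coefficient-vector
    pairs. *)
Let hull : set (L2 mu) := [set f | forall e : R, 0 < e -> exists l,
   (forall p, p \in l -> onb p.2) /\ nsq (f - lin l) <= e].

Let hull_closed : closed_subspace hull.
Proof.
split; first split.
- by move=> e e0; exists [::]; split => //; rewrite /lin big_nil subr0 nsq0 ltW.
- move=> a f g hf hg e e0.
  (* By [nsqD_le] and [nsqZ] the two errors enter with weights [2 * normc a ^+ 2] and [2]. *)
  have a0 : 0 < 2 * normc a ^+ 2 + 2 by rewrite ltr_wpDl// mulr_ge0// sqr_ge0.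
  have [l1 [l1B h1]] := hf _ (divr_gt0 e0 a0).
  have [l2 [l2B h2]] := hg _ (divr_gt0 e0 a0).
  exists ([seq (a * p.1, p.2) | p <- l1] ++ l2); split.
    by move=> p; rewrite mem_cat => /orP[/mapP[q /l1B q1 ->]|/l2B].
  rewrite /lin big_cat big_map/=.
  have -> : \sum_(p <- l1) (a * p.1) *: p.2 = a *: lin l1.
    by rewrite scaler_sumr; apply: eq_bigr => p _; rewrite scalerA.
  rewrite -/(lin l2) opprD addrACA -scalerBr.
  apply: le_trans (nsqD_le _ _) _; rewrite nsqZ.
  rewrite ler_pdivlMr// in h1; rewrite ler_pdivlMr// in h2.
  move: a0 h1 h2; set A := normc a ^+ 2; set x := nsq _; set y := nsq _ => a0 h1 h2.
  have x0 : 0 <= x by exact: nsq_ge0.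
  have y0 : 0 <= y by exact: nsq_ge0.
  have A0 : 0 <= A by exact: sqr_ge0.
  have Ah : 0 <= A * (e - x * (2 * A + 2)) by rewrite mulr_ge0// subr_ge0.
  rewrite -(ler_pM2r a0); move: A x y h1 h2 Ah {a0 x0 y0 A0} => A x y h1 h2 Ah.
  by nra.
- apply/norm_closed_nsq => f hf e e0.
  have e40 : 0 < e / 4 by rewrite divr_gt0.
  have [g hg fg] := hf _ e40; have [l [lB gl]] := hg _ e40.
  exists l; split => //; rewrite -[f](subrK g) -addrA.
  apply: le_trans (nsqD_le _ _) _.
  by move: fg gl; set x := nsq _; set y := nsq _; lra.
Qed.

(** One direction is Bessel. For the other, [f] minus its projection onto [hull] is orthogonal to
    the basis, so [f] lies in [hull]; the Fourier sum over the vectors of an approximating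
    combination is at least as close to [f] as that combination. *)
Lemma parseval f : (nsq f)%:E = (\esum_(e in @onb _ _ _ mu) (normc (dot f e) ^+ 2)%:E)%E.
Proof.
apply/eqP; rewrite eq_le; apply/andP; split; last first.
  by apply: esum_ub => s us sB; rewrite lee_fin bessel.
have hB e : onb e -> hull e.
  move=> Be r r0; exists [:: (1, e)]; split; first by move=> p; rewrite inE => /eqP ->.
  by rewrite /lin big_seq1 /= scale1r subrr nsq0 ltW.
have hf : hull f.
  suff -> : f = orth_proj hull f by exact: orth_proj_in.
  apply/eqP; rewrite -subr_eq0; apply/eqP/onbP.2 => e Be.
  by apply: orth_proj_dot => //; exact: hB.
apply/lee_addgt0Pr => r r0.
have [l [lB fl]] := hf _ r0; pose s := undup (map snd l).
have us : uniq s by exact: undup_uniq.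
have sB x : x \in s -> onb x by rewrite mem_undup => /mapP[p /lB pB ->].
have h1 : nsq (f - proj_seq s f) <= nsq (f - lin l).
  pose w := f - proj_seq s f; pose z := proj_seq s f - lin l.
  have wz : rdot w z = 0.
    have we e : e \in s -> dot w e = 0.
      by move=> es; rewrite /w dotBl proj_seq_dot// subrr.
    rewrite rdotC /rdot /z dotBl /proj_seq /lin !dot_suml big_seq big1.
      rewrite big_seq big1 ?subrr// => p pl; rewrite dotZl (dotC p.2) we ?conjc0 ?mulr0//.
      by rewrite mem_undup; apply/mapP; exists p.
    by move=> e es; rewrite dotZl (dotC e) we ?conjc0 ?mulr0.
  have -> : f - lin l = w + z by rewrite /w /z addrA subrK.
  by rewrite (nsqD w z) wz mulr0 addr0 lerDl nsq_ge0.
apply: (@le_trans _ _ ((\sum_(e <- s) normc (dot f e) ^+ 2)%:E + r%:E)%E).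
  by rewrite -EFinD lee_fin (nsq_proj_seq f us sB) lerD2l (le_trans h1).
by rewrite leeD2r// esum_lb.
Qed.

(** The square of the Hilbert-Schmidt norm. *)
Definition hs (X : L2 mu -> L2 mu) : \bar R := \esum_(e in @onb _ _ _ mu) (nsq (X e))%:E.

Lemma hs_ge0 X : (0 <= hs X)%E.
Proof. by apply: esum_ge0 => e _; rewrite lee_fin nsq_ge0. Qed.

Lemma hs_le X Y : (forall f, nsq (X f) <= nsq (Y f)) -> (hs X <= hs Y)%E.
Proof. by move=> XY; apply: le_esum => e _; rewrite lee_fin. Qed.

Lemma is_adjoint_sym (X Y : L2 mu -> L2 mu) : is_adjoint X Y -> is_adjoint Y X.
Proof. by move=> XY f g; rewrite dotC -XY -dotC. Qed.

(** By Parseval both sides are the double sum of [|<X e, f>|^2] over the basis. *)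
Lemma hs_adjoint X Y : is_adjoint X Y -> hs X = hs Y.
Proof.
move=> XY; rewrite /hs; under eq_esum do rewrite parseval.
rewrite (@esum_swap _ _ _ _ (fun e f => normc (dot (X e) f) ^+ 2)); last first.
  by move=> *; exact: sqr_ge0.
apply: eq_esum => f _; rewrite parseval; apply: eq_esum => e _.
rewrite XY dotC; congr (_%:E); rewrite !normc2E.
by case: (dot _ _) => a b /=; rewrite sqrrN.
Qed.

(** The coefficient of [X f] along [e] is [<f, Y e>], to which Cauchy-Schwarz applies; the terms
    [nsq (Y e)] sum to [hs Y], which equals [hs X]. *)
Lemma nsq_le_hs X Y (c : R) f : is_adjoint X Y -> (hs X <= c%:E)%E ->
  nsq (X f) <= c * nsq f.
Proof.
move=> XY; rewrite (hs_adjoint XY) => hc; rewrite -lee_fin parseval.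
apply: esum_ub => s us sB; rewrite lee_fin.
apply: (@le_trans _ _ (\sum_(e <- s) (nsq (Y e) * nsq f))).
  by apply: ler_sum => e _; rewrite XY mulrC dot_CS.
rewrite -mulr_suml ler_wpM2r ?nsq_ge0// -lee_fin.
by apply: le_trans hc; exact: esum_lb.
Qed.

End Basis.

(** * Absolute values of self-adjoint operators *)

Section AbsoluteValue.
Context {d} {T : measurableType d} {R : realType}.
Variable mu : {measure set T -> \bar R}.
Implicit Types (f g h e : L2 mu) (K S X Y : L2 mu -> L2 mu).

Lemma opD K f g : linear K -> K (f + g) = K f + K g.
Proof. by move=> lK; rewrite -[f in LHS]scale1r lK scale1r. Qed.

Lemma op0 K : linear K -> K 0 = 0.
Proof.
by move=> lK; have /eqP := opD 0 0 lK; rewrite addr0 -subr_eq subrr => /eqP <-.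
Qed.

Lemma opZ K a f : linear K -> K (a *: f) = a *: K f.
Proof. by move=> lK; rewrite -[a *: f]addr0 lK op0// addr0. Qed.

Lemma opN K f : linear K -> K (- f) = - K f.
Proof. by move=> lK; rewrite -scaleN1r (opZ _ _ lK) scaleN1r. Qed.

Lemma opB K f g : linear K -> K (f - g) = K f - K g.
Proof. by move=> lK; rewrite (opD _ _ lK) (opN _ lK). Qed.

Lemma bounded_op_nsq K : bounded_op K ->
  exists2 c : R, 0 < c & forall f, nsq (K f) <= c * nsq f.
Proof.
move=> [_ [c Kc]]; exists (c ^+ 2 + 1); first by rewrite ltr_wpDl// sqr_ge0.
move=> f; rewrite -!L2norm2 mulrDl mul1r -exprMn.
apply: le_trans (_ : (c * L2norm f) ^+ 2 <= _); last by rewrite lerDl sqr_ge0.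
rewrite ler_pXn2r ?nnegrE ?L2norm_ge0//.
exact: le_trans (L2norm_ge0 _) (Kc f).
Qed.

Lemma bounded_opI K (c : R) : linear K -> 0 <= c ->
  (forall f, nsq (K f) <= c * nsq f) -> bounded_op K.
Proof.
move=> lK c0 Kc; split => //; exists (Num.sqrt c) => f.
rewrite -(@ler_pXn2r _ 2)// ?nnegrE ?mulr_ge0 ?sqrtr_ge0 ?L2norm_ge0//.
by rewrite exprMn !L2norm2 sqr_sqrtr.
Qed.

Lemma pos_re S f : positive_op S -> 0 <= rdot (S f) f.
Proof. by move=> /(_ f); rewrite lecE => /andP[]. Qed.

(** In the complex order, positivity of [dot (S h) h] includes that it is real. Taking [h = f + g]
    and [h = f + i g] gives symmetry by polarisation. *)
Lemma positive_op_sym S : linear S -> positive_op S -> is_adjoint S S.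
Proof.
move=> lS pS f g.
have im0 h : Im (dot (S h) h) = 0 by have := pS h; rewrite lecE => /andP[/eqP].
have := im0 (f + g); have := im0 (f + 'i%C *: g).
rewrite !(opD _ _ lS) !(opZ _ _ lS) !dotDl !dotDr !dotZl !dotZr (dotC f (S g)).
have := im0 g; have := im0 f.
case: (dot (S f) f) => a a' /= ->; case: (dot (S g) g) => b b' /= ->.
case: (dot (S f) g) (dot (S g) f) => x y [z w] /=.
rewrite !(mul0r, mul1r, mulr0, add0r, addr0, mulN1r, opprK, subr0, sub0r, oppr0, mulr1, mulrN1) => h1 h2.
by congr (_ +i* _); lra.
Qed.

Lemma rdot_adjoint X Y f g : is_adjoint X Y -> rdot (X f) g = rdot f (Y g).
Proof. by move=> XY; rewrite /rdot XY. Qed.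

Lemma discriminant_le (a b c : R) : 0 <= c ->
  (forall t : R, 0 <= a + 2 * t * b + t ^+ 2 * c) -> b ^+ 2 <= a * c.
Proof.
move=> c0 h; have [cz|cn] := eqVneq c 0.
  rewrite cz mulr0; have [->|bn] := eqVneq b 0; first by rewrite expr0n.
  (* For [c = 0] the expression is affine in [t], and this [t] gives it the value -1. *)
  have := h (- (a + 1) / (2 * b)); rewrite cz mulr0 addr0.
  have -> : a + 2 * (- (a + 1) / (2 * b)) * b = -1 by field.
  by rewrite ler0N1.
have cp : 0 < c by rewrite lt_neqAle eq_sym cn.
have := h (- b / c).
have -> : a + 2 * (- b / c) * b + (- b / c) ^+ 2 * c = (a * c - b ^+ 2) / c by field.
by rewrite pmulr_lge0 ?invr_gt0// subr_ge0.
Qed.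

Lemma pos_form_CS S f g : linear S -> positive_op S ->
  rdot (S f) g ^+ 2 <= rdot (S f) f * rdot (S g) g.
Proof.
move=> lS pS; have sS := positive_op_sym lS pS.
apply: discriminant_le; first exact: pos_re.
move=> t; have := pos_re (f + t%:C *: g) pS; congr (_ <= _).
rewrite (opD _ _ lS) (opZ _ _ lS) !(rdotDl, rdotDr, rdotZl, rdotZr) (rdotC (S g)) -(rdot_adjoint _ _ sS).
ring.
Qed.

(** Cauchy-Schwarz for the form of [S] at [f] and [S f]; the factor [<S (S f), S f>] is at most a
    constant times [|S f|^2]. In particular [S f = 0] as soon as the form vanishes at [f]. *)
Lemma pos_nsq_le S : bounded_op S -> positive_op S ->
  exists2 c : R, 0 < c & forall f, nsq (S f) <= c * rdot (S f) f.
Proof.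
move=> bS pS; have [c c0 Sc] := bounded_op_nsq bS.
(* [c] bounds the square of the norm of [S]; [c + 1] exceeds the square root of [c] whether [c] is
   large or small. *)
exists (c + 1); first exact: addr_gt0.
move=> f; have := pos_form_CS f (S f) bS.1 pS; rewrite -/(nsq (S f)).
have := rdot_CS (S (S f)) (S f); have := Sc (S f).
have := nsq_ge0 (S f); have := pos_re f pS; have := pos_re (S f) pS.
set x := nsq (S f); set y := nsq _; set r := rdot (S f) f; set z := rdot _ _.
move: x y r z => x y r z z0 r0 x0 yx zy xz.
have cx0 : 0 <= (c + 1) * x by rewrite mulr_ge0 // addr_ge0 // ltW.
have zx : z <= (c + 1) * x.
  rewrite -(@ler_pXn2r _ 2)//; apply: le_trans zy _.
  apply: le_trans (ler_wpM2r x0 yx) _.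
  rewrite -subr_ge0 (_ : _ - _ = (c ^+ 2 + c + 1) * x ^+ 2); last by ring.
  by rewrite mulr_ge0 ?sqr_ge0// addr_ge0// addr_ge0 ?sqr_ge0// ltW.
have [->|xn] := eqVneq x 0; first by rewrite mulr_ge0// addr_ge0// ltW.
have xp : 0 < x by rewrite lt_neqAle eq_sym xn.
rewrite -(ler_pM2r xp) -expr2; apply: le_trans xz _.
by apply: le_trans (ler_wpM2l r0 zx) _; rewrite mulrCA mulrA.
Qed.

Lemma le0_of_inv_nat (r c : R) : (forall n : nat, n%:R * r <= c) -> r <= 0.
Proof.
move=> h; rewrite leNgt; apply/negP => r0.
have := h (Num.truncn (c / r)).+1; apply/negP; rewrite -ltNge -ltr_pdivrMr//.
exact: truncnS_gt.
Qed.

(* If [S >= 0] and [S D = - D S], then [(1 + s S) ^ k D = D (1 - s S) ^ k]: for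
   small [s] the right-hand side stays bounded in [k], while the left-hand side
   grows at least like [2 k s <S D f, D f>]. *)
Lemma anticommute_eq0 S D : bounded_op S -> positive_op S -> bounded_op D ->
  (forall f, S (D f) = - D (S f)) -> forall f, S (D f) = 0.
Proof.
move=> bS pS bD SD f; have [lS _] := bS; have [lD _] := bD.
have sS := positive_op_sym lS pS.
have [c c0 Sc] := pos_nsq_le bS pS; have [cD cD0 Dc] := bounded_op_nsq bD.
(* With this [s] the bound [Sc] makes [1 - s S] a contraction. *)
pose s := c^-1; have s0 : 0 < s by rewrite invr_gt0.
pose A h := h + s%:C *: S h; pose B h := h - s%:C *: S h.
have AD h : A (D h) = D (B h).
  by rewrite /A /B SD (opB _ _ lD) (opZ _ _ lD) scalerN.
have iterAD k h : iter k A (D h) = D (iter k B h).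
  by elim: k => [//|k IH]; rewrite !iterS IH AD.
have nB h : nsq (B h) <= nsq h.
  rewrite /B nsqB rdotZr nsqZ /= expr0n addr0 sqr_sqrtr ?sqr_ge0// rdotC.
  have := Sc h; have := pos_re h pS; set x := nsq (S h); set r := rdot _ _ => r0 xr.
  have : s ^+ 2 * x <= s * r.
    by rewrite expr2 -mulrA ler_pM2l// mulrC ler_pdivrMr// mulrC.
  have : 0 <= s * r by rewrite mulr_ge0// ltW.
  by set y := s * r; set z := s ^+ 2 * x; lra.
have niB k h : nsq (iter k B h) <= nsq h.
  by elim: k => [//|k IH]; rewrite iterS (le_trans (nB _)).
have rA h : rdot (S h) h <= rdot (S (A h)) (A h).
  have -> : rdot (S (A h)) (A h) =
      rdot (S h) h + 2 * (s * nsq (S h)) + s * (s * rdot (S (S h)) (S h)).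
    rewrite /A (opD _ _ lS) (opZ _ _ lS) !(rdotDl, rdotDr, rdotZl, rdotZr).
    by rewrite (rdot_adjoint (S h) h sS) /nsq; ring.
  by rewrite -addrA lerDl addr_ge0// !mulr_ge0 ?nsq_ge0 ?(ltW s0)//; exact: pos_re.
have nA h : nsq h + 2 * s * rdot (S h) h <= nsq (A h).
  by rewrite /A nsqD rdotZr (rdotC h) mulrA lerDl nsq_ge0.
have riA k h : rdot (S h) h <= rdot (S (iter k A h)) (iter k A h).
  by elim: k => [//|k IH]; rewrite iterS (le_trans IH).
have niA k h : nsq h + k%:R * (2 * s * rdot (S h) h) <= nsq (iter k A h).
  elim: k => [|k IH]; first by rewrite mul0r addr0.
  rewrite iterS -natr1 mulrDl mul1r addrA; apply: le_trans (nA _).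
  by rewrite lerD// ler_wpM2l// mulr_ge0// ltW.
have r0 : rdot (S (D f)) (D f) <= 0.
  have : 2 * s * rdot (S (D f)) (D f) <= 0.
    apply: (@le0_of_inv_nat _ (cD * nsq f)) => k.
    apply: (@le_trans _ _ (nsq (iter k A (D f)))).
      by apply: le_trans (niA _ _); rewrite lerDr nsq_ge0.
    by rewrite iterAD (le_trans (Dc _))// ler_pM2l.
  by rewrite pmulr_rle0// mulr_gt0.
apply: nsq_eq0; apply/eqP; rewrite eq_le nsq_ge0 andbT.
by rewrite (le_trans (Sc _))// pmulr_rle0.
Qed.

Lemma bounded_opB K S : bounded_op K -> bounded_op S ->
  bounded_op (fun f => K f - S f).
Proof.
move=> bK bS; have [c c0 Kc] := bounded_op_nsq bK.
have [c' c'0 Sc] := bounded_op_nsq bS.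
apply: (@bounded_opI _ (2 * c + 2 * c')).
- by move=> a f g; rewrite bK.1 bS.1 scalerBr opprD addrACA.
- by rewrite addr_ge0// mulr_ge0// ltW.
- move=> f; apply: le_trans (nsqB_le _ _) _.
  by rewrite [leRHS]mulrDl -!mulrA lerD// ler_pM2l.
Qed.

Lemma bounded_opD K S : bounded_op K -> bounded_op S ->
  bounded_op (fun f => K f + S f).
Proof.
move=> bK bS; have [c c0 Kc] := bounded_op_nsq bK.
have [c' c'0 Sc] := bounded_op_nsq bS.
apply: (@bounded_opI _ (2 * c + 2 * c')).
- by move=> a f g; rewrite bK.1 bS.1 scalerDr addrACA.
- by rewrite addr_ge0// mulr_ge0// ltW.
- move=> f; apply: le_trans (nsqD_le _ _) _.
  by rewrite [leRHS]mulrDl -!mulrA lerD// ler_pM2l.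
Qed.

Lemma bounded_op_comp K S : bounded_op K -> bounded_op S -> bounded_op (K \o S).
Proof.
move=> bK bS; have [c c0 Kc] := bounded_op_nsq bK.
have [c' c'0 Sc] := bounded_op_nsq bS.
apply: (@bounded_opI _ (c * c')).
- by move=> a f g /=; rewrite bS.1 bK.1.
- by rewrite mulr_ge0// ltW.
- by move=> f; apply: le_trans (Kc _) _; rewrite -mulrA ler_pM2l.
Qed.

(** Since [S^2 = K^2], the commutator [C] anticommutes with [S], whence [S C = 0]; then
    [|K C h|^2 = <S^2 C h, C h> = 0]. Moving [S] and [K] across the inner product, [|C f|^2]
    vanishes. *)
Lemma sqrt_commute S K : bounded_op S -> positive_op S -> bounded_op K ->
  is_adjoint K K -> (forall f, S (S f) = K (K f)) -> forall f, S (K f) = K (S f).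
Proof.
move=> bS pS bK sK SK f; have [lS _] := bS; have [lK _] := bK.
have sS := positive_op_sym lS pS.
pose C h := S (K h) - K (S h).
have bC : bounded_op C by apply: bounded_opB; exact: bounded_op_comp.
have SC h : S (C h) = 0.
  apply: anticommute_eq0 => // g.
  by rewrite /C (opB _ _ lS) opprB !SK.
have KC h : K (C h) = 0.
  apply: nsq_eq0; rewrite /nsq (rdot_adjoint _ _ sK) -SK SC.
  by rewrite (op0 lS) rdot0r.
apply/eqP; rewrite -subr_eq0; apply/eqP/nsq_eq0; rewrite -/(C f) /nsq {1}/C rdotBl.
by rewrite (rdot_adjoint _ _ sS) SC rdot0r (rdot_adjoint _ _ sK) KC rdot0r subrr.
Qed.

(* The junk value of [abs_op] is [0], whose trace vanishes: upper bounds on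
   [trace_norm] do not require the existence of square roots. *)
Lemma abs_op_cases K : bounded_op K -> is_adjoint K K ->
  abs_op K = (fun=> 0) \/
  [/\ bounded_op (abs_op K), positive_op (abs_op K) &
      forall f, abs_op K (abs_op K f) = K (K f)].
Proof.
move=> bK sK; rewrite /abs_op; case: xgetP => [S _ [bS pS [K' [bK' KK'] SE]]|_]; last by left.
right; split=> // f; rewrite -[S (S f)]/((S \o S) f) SE /=.
apply/eqP; rewrite -subr_eq0; apply/eqP/nsq_eq0.
by rewrite /nsq rdotBr -(rdot_adjoint _ _ KK') -(rdot_adjoint _ (K f) sK) subrr.
Qed.

(** Uniqueness of the positive square root; [K] itself shows that one exists. As [S = abs_op K]
    commutes with [K], [S + K] kills [D = S f - K f]; positivity then gives [S D = K D = 0], and so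
    [D = 0]. *)
Lemma abs_op_pos K : bounded_op K -> positive_op K -> abs_op K = K.
Proof.
move=> bK pK; have [lK _] := bK; have sK := positive_op_sym lK pK.
have [bS pS [K' [bK' KK'] SE]] :
    [set S | [/\ bounded_op S, positive_op S &
      exists2 K', bounded_op K' /\ is_adjoint K K' & S \o S = K' \o K]] (abs_op K).
  by apply: (@xgetPex _ (fun=> 0)); exists K; split=> //; exists K.
have [lS _] := bS.
have SK f : abs_op K (abs_op K f) = K (K f).
  rewrite -[LHS]/((abs_op K \o abs_op K) f) SE /=.
  apply/eqP; rewrite -subr_eq0; apply/eqP/nsq_eq0.
  by rewrite /nsq rdotBr -(rdot_adjoint _ _ KK') -(rdot_adjoint _ (K f) sK) subrr.
move: (abs_op K) bS pS lS SK {SE} => S bS pS lS SK.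
have sS := positive_op_sym lS pS.
have cSK := sqrt_commute bS pS bK sK SK.
apply/funext => f; pose D := S f - K f.
have SKD : S D + K D = 0.
  by rewrite /D (opB _ _ lS) (opB _ _ lK) cSK addrA subrK SK subrr.
have [c c0 Sc] := pos_nsq_le bS pS; have [c' c'0 Kc] := pos_nsq_le bK pK.
have rSK : rdot (S D) D + rdot (K D) D = 0 by rewrite -rdotDl SKD rdot0l.
have rS := pos_re D pS; have rK := pos_re D pK.
have SD : S D = 0.
  apply: nsq_eq0; apply/eqP; rewrite eq_le nsq_ge0 andbT.
  by rewrite (le_trans (Sc _))// pmulr_rle0//; lra.
have KD : K D = 0.
  apply: nsq_eq0; apply/eqP; rewrite eq_le nsq_ge0 andbT.
  by rewrite (le_trans (Kc _))// pmulr_rle0//; lra.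
apply/eqP; rewrite -subr_eq0; apply/eqP/nsq_eq0; rewrite -/D /nsq {1}/D rdotBl.
by rewrite (rdot_adjoint _ _ sS) (rdot_adjoint _ _ sK) SD KD !rdot0r subrr.
Qed.

Lemma trace_norm_pos K : bounded_op K -> positive_op K ->
  trace_norm K = \esum_(e in @onb _ _ _ mu) (rdot (K e) e)%:E.
Proof. by move=> bK pK; rewrite /trace_norm abs_op_pos. Qed.

End AbsoluteValue.

(** * Bounding trace norms by quadratic forms *)

Section TraceBound.
Context {d} {T : measurableType d} {R : realType}.
Variable mu : {measure set T -> \bar R}.
Implicit Types (f g h e : L2 mu) (K S X Y p : L2 mu -> L2 mu).
Implicit Types (a b : L2 mu -> R) (c : R).

(* The quadratic form [a] has trace at most [c], even after composition with a
   self-adjoint contraction [p]: this spares us basis independence of the trace. *)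
Definition form_trace_le a c := forall p, is_adjoint p p ->
  (forall f, nsq (p f) <= nsq f) ->
  (\esum_(e in @onb _ _ _ mu) (a (p e))%:E <= c%:E)%E.

Lemma form_trace_sub a b c : (forall f, a f <= b f) -> form_trace_le b c ->
  form_trace_le a c.
Proof.
move=> ab hb p sp cp; apply: le_trans (hb p sp cp).
by apply: le_esum => e _; rewrite lee_fin.
Qed.

Lemma form_trace_lec a c c' : c <= c' -> form_trace_le a c -> form_trace_le a c'.
Proof. by move=> cc h p sp cp; rewrite (le_trans (h p sp cp))// lee_fin. Qed.

Lemma form_trace_ge0 a c : (forall f, 0 <= a f) -> form_trace_le a c -> 0 <= c.
Proof.
move=> a0 /(_ id (fun _ _ => erefl) (fun _ => lexx _)); rewrite -lee_fin.
by apply: le_trans; apply: esum_ge0 => e _; rewrite lee_fin.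
Qed.

Lemma form_trace_nsq X Y c : is_adjoint X Y -> (hs X <= c%:E)%E ->
  form_trace_le (fun f => nsq (X f)) c.
Proof.
move=> XY hX p sp cp; apply: le_trans hX.
have pY : is_adjoint (X \o p) (p \o Y) by move=> f g /=; rewrite XY sp.
rewrite -[leLHS]/(hs (X \o p)) (hs_adjoint pY) (hs_adjoint XY).
by apply: hs_le => f /=.
Qed.

Lemma form_traceD a b c c' : form_trace_le a c -> form_trace_le b c' ->
  form_trace_le (fun f => a f + b f) (c + c').
Proof.
move=> ha hb p sp cp; apply: esum_ub => s us sB; rewrite big_split/= lee_fin.
apply: lerD; rewrite -lee_fin.
- by apply: le_trans (ha p sp cp); exact: (@esum_lb _ _ _ (fun e => a (p e))).
- by apply: le_trans (hb p sp cp); exact: (@esum_lb _ _ _ (fun e => b (p e))).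
Qed.

Lemma form_traceZ a c (k : R) : 0 <= k -> form_trace_le a c ->
  form_trace_le (fun f => k * a f) (k * c).
Proof.
move=> k0 ha p sp cp; apply: esum_ub => s us sB; rewrite -mulr_sumr lee_fin.
rewrite ler_wpM2l// -lee_fin.
by apply: le_trans (ha p sp cp); exact: (@esum_lb _ _ _ (fun e => a (p e))).
Qed.

Lemma kernel_closed K : bounded_op K -> closed_subspace [set f | K f = 0].
Proof.
move=> bK; have [lK _] := bK; split; first split.
- by rewrite /= (op0 lK).
- by move=> a f g /= Kf Kg; rewrite lK Kf Kg scaler0 addr0.
- have [c c0 Kc] := bounded_op_nsq bK.
  apply/norm_closed_nsq => f hf /=; apply: nsq_eq0; apply/eqP.
  rewrite eq_le nsq_ge0 andbT; apply/ler_addgt0Pr => r r0; rewrite add0r.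
  have [g /= Kg fg] := hf _ (divr_gt0 r0 c0).
  have -> : K f = K (f - g) by rewrite (opB _ _ lK) Kg subr0.
  by apply: le_trans (Kc _) _; rewrite mulrC -ler_pdivlMr.
Qed.

Lemma trace_norm_le K a b c c' : bounded_op K -> is_adjoint K K ->
  (forall f, 0 <= a f) -> (forall f, 0 <= b f) ->
  (forall f, rdot (K f) f <= a f) -> (forall f, - rdot (K f) f <= b f) ->
  form_trace_le a c -> form_trace_le b c' -> (trace_norm K <= (c + c')%:E)%E.
Proof.
move=> bK sK a0 b0 Ka Kb ha hb; rewrite /trace_norm /trace.
have [->|[bS pS SK]] := abs_op_cases bK sK.
  rewrite esum1; last by move=> e _; rewrite dot0l.
  by rewrite lee_fin addr_ge0// (form_trace_ge0 _ ha, form_trace_ge0 _ hb).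
move: (abs_op K) bS pS SK => S bS pS SK.
have [lS _] := bS; have [lK _] := bK; have sS := positive_op_sym lS pS.
have cSK := sqrt_commute bS pS bK sK SK.
pose N := [set f : L2 mu | S f + K f = 0].
have cN : closed_subspace N := kernel_closed (bounded_opD bS bK).
pose q := orth_proj N; pose p f := f - q f.
have sq : is_adjoint q q by move=> f g; exact: orth_proj_sym.
have sp : is_adjoint p p by move=> f g; rewrite /p dotBl dotBr sq.
have cq f : nsq (q f) <= nsq f by exact: nsq_orth_proj_le.
have cp f : nsq (p f) <= nsq f by rewrite [leRHS](nsq_orth_proj cN f) lerDr nsq_ge0.
have Sq f : S (q f) = - K (q f).
  by apply/eqP; rewrite -addr_eq0; apply/eqP; exact: (orth_proj_in cN f).
have Sp f : S (p f) = K (p f).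
  apply/eqP; rewrite -subr_eq0; apply/eqP/nsq_eq0.
  set x := S (p f) - K (p f).
  (* [(S + K) (S - K) = 0] because [S] and [K] commute and have equal squares. Since [nsq x] equals
     [rdot (p f) (S x - K x)] and [p f] is orthogonal to [N], [x] vanishes. *)
  have Nx : N (S x - K x).
    rewrite /N /= (opB _ _ lS) (opB _ _ lK) cSK !SK.
    by rewrite addrA subrK subrr.
  rewrite /nsq {1}/x rdotBl (rdot_adjoint _ _ sS) (rdot_adjoint _ x sK) -rdotBr.
  by rewrite /rdot /p orth_proj_dot.
have main f : rdot (S f) f <= a (p f) + b (q f).
  have -> : rdot (S f) f = rdot (K (p f)) (p f) - rdot (K (q f)) (q f).
    have fE : f = p f + q f by rewrite /p subrK.
    move: (p f) (q f) (Sp f) (Sq f) fE => u w Su Sw ->.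
    rewrite (opD _ _ lS) Su Sw !(rdotDl, rdotDr, rdotNl) (rdot_adjoint u w sK).
    by rewrite (rdotC u (K w)); ring.
  by rewrite lerD.
apply: esum_ub => s us sB; rewrite lee_fin.
apply: (@le_trans _ _ (\sum_(e <- s) (a (p e) + b (q e)))).
  by apply: ler_sum => e _; exact: main.
rewrite big_split/=; apply: lerD; rewrite -lee_fin.
- by apply: le_trans (ha p sp cp); exact: (@esum_lb _ _ _ (fun e => a (p e))).
- by apply: le_trans (hb q sq cq); exact: (@esum_lb _ _ _ (fun e => b (q e))).
Qed.

Lemma chi2_bounded (A : set T) : measurable A -> bounded_op (chi2 (mu := mu) A).
Proof.
move=> mA; apply: (@bounded_opI _ _ _ _ _ 1) => //; first exact: chi2_linear.
by move=> f; rewrite mul1r nsq_chi2_le.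
Qed.

Lemma compress_bounded (A : set T) K : measurable A -> bounded_op K ->
  bounded_op (compress A K).
Proof.
by move=> mA bK; do !apply: bounded_op_comp => //; exact: chi2_bounded.
Qed.

Lemma compress_adjoint (A : set T) K K' : measurable A -> is_adjoint K K' ->
  is_adjoint (compress A K) (compress A K').
Proof.
by move=> mA KK' f g; rewrite /compress /= (dot_chi2 _ _ mA) KK' (dot_chi2 _ _ mA).
Qed.

Lemma rdot_compress (A : set T) K f g : measurable A ->
  rdot (compress A K f) g = rdot (K (chi2 A f)) (chi2 A g).
Proof. by move=> mA; rewrite /compress /= rdot_chi2. Qed.

(** The compression has the form [|Q chi_A f|^2], with [Q] the projection onto [M]. Being positive,
    it is its own absolute value, so its trace norm is a squared Hilbert-Schmidt norm. *)
Lemma hs_proj_chi (A : set T) M : measurable A -> closed_subspace M ->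
  trace_class (compress A (@orth_proj _ _ _ mu M)) ->
  exists2 c : R, 0 <= c & (hs (fun f => orth_proj M (chi2 A f)) <= c%:E)%E.
Proof.
move=> mA cM [bK]; set K := compress A _ in bK *.
have KE f : rdot (K f) f = nsq (orth_proj M (chi2 A f)).
  by rewrite rdot_compress// rdot_orth_proj.
have sK : is_adjoint K K by apply: compress_adjoint => // f g; exact: orth_proj_sym.
have pK : positive_op K.
  move=> f; have := KE f; rewrite /rdot lecE /=.
  have : Im (dot (K f) f) = 0.
    have := sK f f; rewrite {1}(dotC (K f) f); case: (dot f (K f)) (dotC (K f) f) => x y -> /= [yy].
    by lra.
  by move=> -> ->; rewrite eqxx nsq_ge0.
rewrite trace_norm_pos//.
have -> : (\esum_(e in @onb _ _ _ mu) (rdot (K e) e)%:E =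
   hs (fun f => orth_proj M (chi2 A f)))%E.
  by apply: eq_esum => e _; rewrite KE.
move=> hfin; exists (fine (hs (fun f => orth_proj M (chi2 A f)))).
  exact/fine_ge0/hs_ge0.
by rewrite fineK// ge0_fin_numE// hs_ge0.
Qed.

Lemma proj_chi_adjoint (A : set T) M : measurable A -> closed_subspace M ->
  is_adjoint (fun f => @orth_proj _ _ _ mu M (chi2 A f)) (fun f => chi2 A (orth_proj M f)).
Proof. by move=> mA cM f g; rewrite orth_proj_sym// dot_chi2. Qed.

Lemma hs_chi_cvg0 (A : nat -> set T) X (c : R) : (forall n, measurable (A n)) ->
  (forall n, A n.+1 `<=` A n) -> \bigcap_n A n = set0 -> (hs X <= c%:E)%E ->
  forall r, 0 < r -> exists N, forall n, (N <= n)%N ->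
    (hs (fun f => chi2 (A n) (X f)) <= r%:E)%E.
Proof.
move=> mA dA A0 hX; apply: (@esum_dominated _ _ _ (fun e => nsq (X e))).
- by move=> e; exact: nsq_ge0.
- exact: le_lt_trans hX (ltry _).
- by move=> n e; rewrite nsq_ge0 nsq_chi2_le.
- by move=> e _; exact: chi2_cvg0.
Qed.

(** The trace of a rank one form: after composition with [p], Parseval gives [nsq (p u)]. *)
Lemma form_trace_dot (u : L2 mu) :
  form_trace_le (fun f => normc (dot f u) ^+ 2) (nsq u).
Proof.
move=> p sp cp; apply: (@le_trans _ _ (nsq (p u))%:E); last by rewrite lee_fin.
rewrite parseval; apply: le_esum => e _; rewrite sp (dotC (p u)) lee_fin !normc2E.
by case: (dot e _) => x y /=; rewrite sqrrN.
Qed.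

End TraceBound.

(** * Finite-dimensional extensions of closed subspaces *)

Section Lines.
Context {d} {T : measurableType d} {R : realType}.
Variable mu : {measure set T -> \bar R}.
Implicit Types (f g h u v w m : L2 mu) (M N : set (L2 mu)) (X : L2 mu -> L2 mu).

Definition add_line M v : set (L2 mu) :=
  [set h | exists m t, M m /\ h = m + t *: v].

Lemma add_line_sub M v : M `<=` add_line M v.
Proof. by move=> m Mm; exists m, 0; rewrite scale0r addr0. Qed.

Lemma add_line_in M v : linear_subspace M -> M v -> add_line M v = M.
Proof.
move=> lM Mv; apply/seteqP; split; last exact: add_line_sub.
by move=> _ [m [t [Mm ->]]]; apply: subspaceD => //; exact: subspaceZ.
Qed.

Lemma add_line_vec M v : linear_subspace M -> add_line M v v.
Proof. by move=> [M0 _]; exists 0, 1; rewrite scale1r add0r. Qed.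

Lemma add_line_subspace M v : linear_subspace M -> linear_subspace (add_line M v).
Proof.
move=> lM; split; first by apply: add_line_sub; case: lM.
move=> a _ _ [m [t [Mm ->]]] [m' [t' [Mm' ->]]].
exists (a *: m + m'), (a * t + t'); split; first exact: subspaceZD.
by rewrite scalerDr scalerA scalerDl addrACA.
Qed.

Lemma closed_of_proj N : linear_subspace N ->
  (forall f, exists2 g, N g & forall h, N h -> dot (f - g) h = 0) ->
  closed_subspace N.
Proof.
move=> lN hN; split=> //; apply/norm_closed_nsq => f hf.
have [g Ng gP] := hN f.
suff -> : f = g by [].
apply/eqP; rewrite -subr_eq0; apply/eqP/nsq_eq0/eqP; rewrite eq_le nsq_ge0 andbT.
apply/ler_addgt0Pr => e e0; rewrite add0r; have [h Nh fh] := hf _ e0.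
apply: le_trans fh; have -> : f - h = (f - g) + (g - h) by rewrite addrA subrK.
rewrite (nsqD (f - g)) /rdot gP ?mulr0 ?addr0 ?lerDl ?nsq_ge0//.
exact: subspaceB.
Qed.

(** One Gram-Schmidt step. If [v] lies in [M] then [u = 0], hence the bound [nsq u <= 1] in place of
    an equality. *)
Lemma proj_add_line M v : closed_subspace M ->
  closed_subspace (add_line M v) /\
  exists u, [/\ nsq u <= 1, add_line M v u, forall m, M m -> dot u m = 0 &
    forall f, orth_proj (add_line M v) f = orth_proj M f + dot f u *: u].
Proof.
move=> cM; have [lM _] := cM; have lN := add_line_subspace v lM.
pose w := v - orth_proj M v.
have [w0|wn] := eqVneq (nsq w) 0.
  have Mv : M v.
    have /eqP := nsq_eq0 w0; rewrite subr_eq0 => /eqP ->; exact: orth_proj_in.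
  rewrite (add_line_in lM Mv); split=> //; exists 0; split.
  - by rewrite nsq0.
  - by case: lM.
  - by move=> m _; rewrite dot0l.
  - by move=> f; rewrite dot0r scale0r addr0.
have n0 : L2norm w != 0 by rewrite -sqrf_eq0 L2norm2.
pose u := (L2norm w)^-1%:C *: w.
have uu : dot u u = 1.
  rewrite dotff nsqZ /= expr0n addr0 sqr_sqrtr ?sqr_ge0// -L2norm2.
  by rewrite -exprMn mulVf// expr1n.
have um m : M m -> dot u m = 0.
  by move=> Mm; rewrite dotZl /w orth_proj_dot// mulr0.
have vE : v = orth_proj M v + (L2norm w)%:C *: u.
  by rewrite /u scalerA -rmorphM /= divff// scale1r /w addrC subrK.
have Nu : add_line M v u.
  apply: (subspaceZ _ lN); apply: (subspaceB lN); first exact: add_line_vec.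
  by apply: add_line_sub; exact: orth_proj_in.
have key f : add_line M v (orth_proj M f + dot f u *: u) /\
    forall h, add_line M v h -> dot (f - (orth_proj M f + dot f u *: u)) h = 0.
  split.
    apply: (subspaceD lN); last exact: (subspaceZ _ lN).
    by apply: add_line_sub; exact: orth_proj_in.
  have dm m : M m -> dot (f - (orth_proj M f + dot f u *: u)) m = 0.
    move=> Mm; rewrite dotBl dotDl dotZl um// mulr0 addr0.
    by rewrite (orth_proj_dotE cM f Mm) subrr.
  move=> _ [m [t [Mm ->]]]; rewrite dotDr dm// add0r dotZr vE dotDr dm; last exact: orth_proj_in.
  rewrite add0r dotZr dotBl dotDl dotZl uu mulr1 (dotC (orth_proj M f)) um; last exact: orth_proj_in.
  by rewrite conjc0 add0r subrr !mulr0.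
have cN : closed_subspace (add_line M v).
  by apply: closed_of_proj => // f; have [? ?] := key f; eexists; eauto.
split=> //; exists u; split => //; first by rewrite /nsq /rdot uu.
by move=> f; have [k1 k2] := key f; exact: orth_proj_eq.
Qed.

Definition bounded_below X M := exists2 c : R, 0 < c &
  forall m, M m -> c * nsq m <= nsq (X m).

Lemma image_subspace X M : linear X -> linear_subspace M -> linear_subspace (X @` M).
Proof.
move=> lX lM; split; first by exists 0; [case: lM|exact: op0].
by move=> a _ _ [f Mf <-] [g Mg <-]; exists (a *: f + g); [exact: subspaceZD|exact: lX].
Qed.

Lemma image_closed X M : bounded_op X -> closed_subspace M -> bounded_below X M ->
  closed_subspace (X @` M).
Proof.
move=> bX [lM cM] [c c0 Xc]; have [lX _] := bX; have [C C0 XC] := bounded_op_nsq bX.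
split; first exact: image_subspace.
apply/norm_closed_nsq => f hf.
have inv0 n : 0 < n.+1%:R^-1 :> R by rewrite invr_gt0.
have ex n : exists m, M m /\ nsq (f - X m) <= n.+1%:R^-1.
  by have [_ [m Mm <-] h] := hf _ (inv0 n); exists m.
pose u n := projT1 (cid (ex n)).
have Mu n : M (u n) := (projT2 (cid (ex n))).1.
have uP n : nsq (f - X (u n)) <= n.+1%:R^-1 := (projT2 (cid (ex n))).2.
have [g ug] : exists g, forall e, 0 < e -> exists k, forall n, (k <= n)%N -> nsq (u n - g) <= e.
  apply: L2_complete => e e0.
  have ce0 : 0 < c * e / 4 by rewrite divr_gt0// mulr_gt0.
  have [N hN] := inv_nat_small ce0; exists N => m n /hN hm /hN hn.
  rewrite -(ler_pM2l c0); apply: le_trans (Xc _ (subspaceB lM (Mu m) (Mu n))) _.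
  rewrite (opB _ _ lX).
  have -> : X (u m) - X (u n) = (f - X (u n)) - (f - X (u m)).
    by rewrite opprB [RHS]addrC addrA subrK.
  apply: le_trans (nsqB_le _ _) _.
  have := le_trans (uP m) hm; have := le_trans (uP n) hn.
  by set x := nsq _; set y := nsq _; set z := c * e; move: x y z => x y z; lra.
have Mg := norm_closed_seq cM Mu ug.
exists g => //; apply/eqP; rewrite -subr_eq0; apply/eqP/nsq_eq0/eqP.
rewrite eq_le nsq_ge0 andbT; apply/ler_addgt0Pr => e e0; rewrite add0r.
have e40 : 0 < e / 4 by rewrite divr_gt0.
have eC0 : 0 < e / (4 * C) by rewrite divr_gt0// mulr_gt0.
have [N1 hN1] := inv_nat_small e40; have [N2 hN2] := ug _ eC0.
pose n := maxn N1 N2.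
have h1 : nsq (f - X (u n)) <= e / 4 by rewrite (le_trans (uP n))// hN1// leq_maxl.
have h2 : nsq (X (g - u n)) <= e / 4.
  apply: le_trans (XC _) _; rewrite -nsqN opprB mulrC -ler_pdivlMr//.
  by rewrite (le_trans (hN2 _ _)) ?leq_maxr// invfM mulrA.
have -> : X g - f = X (g - u n) - (f - X (u n)).
  by rewrite (opB _ _ lX) opprB addrA subrK.
apply: le_trans (nsqB_le _ _) _.
by move: h1 h2; set x := nsq _; set y := nsq _; move: x y => x y; lra.
Qed.

(** [z] is the part of [X v] orthogonal to the closed space [X M]. If [z = 0], injectivity puts [v]
    in [M]. Otherwise [|X h|] controls the coefficient [t] through [z], and then [m] through
    [X m = X h - t X v]. *)
Lemma bounded_below_add_line X M v : bounded_op X -> closed_subspace M ->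
  bounded_below X M -> (forall h, add_line M v h -> X h = 0 -> h = 0) ->
  bounded_below X (add_line M v).
Proof.
move=> bX cM bM injX; have [lX _] := bX; have [lM _] := cM.
have lN := add_line_subspace v lM.
have cXM := image_closed bX cM bM.
pose z := X v - orth_proj (X @` M) (X v).
have [z0|zn] := eqVneq (nsq z) 0.
  have [m Mm mE] := orth_proj_in cXM (X v).
  have vm : v = m.
    apply/eqP; rewrite -subr_eq0; apply/eqP/injX.
      by apply: (subspaceB lN); [exact: add_line_vec|exact: add_line_sub].
    by rewrite (opB _ _ lX) mE; exact: nsq_eq0.
  by rewrite (add_line_in lM)// vm.
have zp : 0 < nsq z by rewrite lt_neqAle eq_sym zn nsq_ge0.
have [c c0 Xc] := bM.
(* Collects [|h|^2 <= 2 |m|^2 + 2 |t|^2 |v|^2], [c |m|^2 <= 2 |X h|^2 + 2 |t|^2 |X v|^2] and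
   [|t|^2 <= |X h|^2 / |z|^2]. *)
pose k := 2 / c * (2 + 2 * nsq (X v) / nsq z) + 2 * nsq v / nsq z.
have k0 : 0 <= k.
  by rewrite /k; do !(apply: addr_ge0 || apply: mulr_ge0); rewrite ?invr_ge0 ?nsq_ge0 ?ltW//.
exists (k + 1)^-1; first by rewrite invr_gt0 ltr_wpDl.
move=> _ [m [t [Mm ->]]].
set h := m + t *: v.
rewrite mulrC ler_pdivrMr ?ltr_wpDl//.
apply: (@le_trans _ _ (nsq (X h) * k)); last by rewrite ler_wpM2l ?nsq_ge0// lerDl.
have tz : normc t ^+ 2 * nsq z <= nsq (X h).
  have -> : X h = t *: z + (X m + t *: orth_proj (X @` M) (X v)).
    by rewrite /h (opD _ _ lX) (opZ _ _ lX) /z scalerBr addrCA subrK.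
  rewrite (nsqD (t *: z)) nsqZ /rdot dotZl orth_proj_dot//; last first.
    apply: subspaceD; [by case: cXM|by exists m|].
    by apply: subspaceZ; [case: cXM|exact: orth_proj_in].
  by rewrite mulr0 mulr0 addr0 lerDl nsq_ge0.
set A := normc t ^+ 2 in tz; set y := nsq (X h) in tz *.
have Ay : A <= y / nsq z by rewrite ler_pdivlMr.
have y0 : 0 <= y by exact: nsq_ge0.
have Xm : nsq (X m) <= 2 * y + 2 * (A * nsq (X v)).
  have -> : X m = X h - t *: X v by rewrite /h (opD _ _ lX) (opZ _ _ lX) addrK.
  by rewrite (le_trans (nsqB_le _ _))// nsqZ.
have hm : nsq h <= 2 * nsq m + 2 * (A * nsq v).
  by rewrite (le_trans (nsqD_le _ _))// nsqZ.
have m1 : nsq m <= (2 * y + 2 * (y / nsq z * nsq (X v))) / c.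
  rewrite ler_pdivlMr// mulrC; apply: le_trans (Xc _ Mm) _; apply: le_trans Xm _.
  by rewrite lerD2l ler_pM2l// ler_wpM2r ?nsq_ge0.
have m2 : A * nsq v <= y / nsq z * nsq v by rewrite ler_wpM2r ?nsq_ge0.
apply: le_trans hm _.
apply: (@le_trans _ _ (2 * ((2 * y + 2 * (y / nsq z * nsq (X v))) / c) + 2 * (y / nsq z * nsq v))).
  by apply: lerD; rewrite ler_pM2l.
rewrite le_eqVlt; apply/orP; left; apply/eqP; rewrite /k; field.
by rewrite zn gt_eqF.
Qed.

End Lines.

(** * Lower bounds on subspaces of finite codimension, and iterated one-dimensional extensions *)

Section FiniteCodimension.
Context {d} {T : measurableType d} {R : realType}.
Variable mu : {measure set T -> \bar R}.
Implicit Types (f g h u v w m : L2 mu) (M N : set (L2 mu)) (X : L2 mu -> L2 mu).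

Lemma orth_compl_closed w : closed_subspace [set f : L2 mu | dot f w = 0].
Proof.
split; first split.
- by rewrite /= dot0l.
- by move=> a f g /= fw gw; rewrite dotDZl fw gw mulr0 addr0.
- apply/norm_closed_nsq => f hf /=; apply: ComplexField.Normc.eq0_normc; apply/eqP.
  have n0 : 0 <= nsq w by exact: nsq_ge0.
  rewrite -sqrf_eq0 eq_le sqr_ge0 andbT.
  apply/ler_addgt0Pr => e e0; rewrite add0r.
  have w1 : 0 < nsq w + 1 by rewrite ltr_wpDl.
  have [g /= gw fg] := hf _ (divr_gt0 e0 w1).
  have -> : dot f w = dot (f - g) w by rewrite dotBl gw subr0.
  apply: le_trans (dot_CS _ _) _; rewrite ler_pdivlMr// in fg.
  by apply: le_trans fg; rewrite ler_wpM2l ?nsq_ge0// lerDl.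
Qed.

Lemma closed_subspaceI M N : closed_subspace M -> closed_subspace N ->
  closed_subspace (M `&` N).
Proof.
move=> [[M0 MZ] cM] [[N0 NZ] cN]; split; first split=> //.
  by move=> a f g [Mf Nf] [Mg Ng]; split; [exact: MZ|exact: NZ].
by move=> f hf; split; [apply: cM|apply: cN] => e /hf[g [Mg Ng] fg]; exists g.
Qed.

(** Each [w] either is orthogonal to [M] or cuts out a hyperplane [Mw] with [M = Mw + C v] for any
    [v] in [M] not orthogonal to [w]; the latter case is [bounded_below_add_line]. *)
Lemma bounded_below_finite_codim X M (ws : seq (L2 mu)) : bounded_op X ->
  closed_subspace M -> (forall h, M h -> X h = 0 -> h = 0) ->
  bounded_below X (M `&` [set f | forall w, w \in ws -> dot f w = 0]) ->
  bounded_below X M.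
Proof.
move=> bX; elim: ws M => [|w ws IH] M cM injX bM.
  by case: bM => c c0 h; exists c => // m Mm; apply: h.
have [lM _] := cM.
pose Mw := M `&` [set f : L2 mu | dot f w = 0].
have cMw : closed_subspace Mw by apply: closed_subspaceI => //; exact: orth_compl_closed.
have bMw : bounded_below X Mw.
  apply: IH => //; first by move=> h [Mh _]; exact: injX.
  case: bM => c c0 h; exists c => // m [[Mm mw] mws]; apply: h; split=> //.
  by move=> x; rewrite in_cons => /orP[/eqP ->|/mws].
have [Mperp|] := pselect (forall m, M m -> dot m w = 0).
  by case: bMw => c c0 h; exists c => // m Mm; apply: h; split=> //; exact: Mperp.
move=> /existsNP[v /not_implyP[Mv /eqP vw]].
have sub h : add_line Mw v h -> M h.
  by move=> [m [t [[Mm _] ->]]]; apply: (subspaceD lM) => //; exact: subspaceZ.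
have [|c c0 h] := bounded_below_add_line (v := v) bX cMw bMw.
  by move=> h /sub; exact: injX.
exists c => // m Mm; apply: h; exists (m - (dot m w / dot v w) *: v), (dot m w / dot v w).
split; last by rewrite subrK.
split; first by apply: (subspaceB lM) => //; exact: subspaceZ.
by rewrite /= dotBl dotZl divfK// subrr.
Qed.

(* Outside finitely many directions the Hilbert-Schmidt operator [chi (~` E0) Q]
   has norm at most [1/2]; the remaining directions are handled by injectivity. *)
Lemma chi2_bounded_below (E0 : set T) (L : set (L2 mu)) (c : R) :
  measurable E0 -> closed_subspace L ->
  (hs (fun f => orth_proj L (chi2 (~` E0) f)) <= c%:E)%E ->
  (forall l, L l -> chi2 E0 l = 0 -> l = 0) ->
  bounded_below (chi2 E0) L.
Proof.
move=> mE0 cL hc injE0; have mC := measurableC mE0.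
pose X f := chi2 (~` E0) (orth_proj L f); pose Y f := orth_proj L (chi2 (~` E0) f).
have YX : is_adjoint Y X by exact: proj_chi_adjoint.
have XY := is_adjoint_sym YX.
have half0 : 0 < 2^-1 :> R by rewrite invr_gt0.
have [s [us sB sP]] := esum_tail (fun e => nsq_ge0 (Y e)) (le_lt_trans hc (ltry _)) half0.
(* [<X f, e> = <f, Y e>], so orthogonality to these vectors removes the coefficients of [X f] along
   [s]; the others contribute at most [nsq f / 2]. *)
apply: (@bounded_below_finite_codim _ _ (map Y s)) => //; first exact: chi2_bounded.
exists 2^-1 => // f [Lf fs].
have fX : chi2 (~` E0) f = X f by rewrite /X orth_proj_id.
have : nsq (X f) <= 2^-1 * nsq f.
  rewrite -lee_fin parseval; apply: esum_ub => t ut tB; rewrite lee_fin.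
  rewrite (bigID (mem s))/= big1; last first.
    move=> e es; rewrite XY fs; last exact: map_f.
    by rewrite normc2E /= expr0n addr0.
  rewrite add0r -big_filter.
  apply: (@le_trans _ _ (\sum_(e <- [seq e <- t | e \notin s]) (nsq (Y e) * nsq f))).
    by apply: ler_sum => e _; rewrite XY mulrC dot_CS.
  rewrite -mulr_suml ler_wpM2r ?nsq_ge0//; apply: sP; first by rewrite filter_uniq.
  by move=> e; rewrite mem_filter => /andP[-> /tB].
have := nsq_chi2_setC f mE0; rewrite fX.
by move=> ->; set x := nsq _; set y := nsq _; move: x y => x y; lra.
Qed.

Fixpoint add_lines M (ws : seq (L2 mu)) : set (L2 mu) :=
  if ws is w :: ws' then add_line (add_lines M ws') w else M.

Lemma add_lines_sub M ws : M `<=` add_lines M ws.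
Proof.
by elim: ws => [//|w ws IH] m /IH; exact: add_line_sub.
Qed.

Lemma proj_add_lines M ws : closed_subspace M ->
  closed_subspace (add_lines M ws) /\
  exists us : seq (L2 mu), [/\ size us = size ws,
    forall u, u \in us -> [/\ nsq u <= 1, add_lines M ws u & forall m, M m -> dot u m = 0] &
    forall f, orth_proj (add_lines M ws) f = orth_proj M f + \sum_(u <- us) dot f u *: u].
Proof.
move=> cM; elim: ws => [|w ws [cN [us [sus usP PE]]]] /=.
  by split=> //; exists [::]; split=> // f; rewrite big_nil addr0.
have [cNw [u [u1 Nu um uE]]] := proj_add_line w cN.
split=> //; exists (u :: us); split; first by rewrite /= sus.
- move=> x; rewrite in_cons => /orP[/eqP ->|/usP[x1 Nx xm]]; split => //.
  + by move=> m Mm; apply: um; exact: add_lines_sub.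
  + exact: add_line_sub.
- by move=> f; rewrite uE PE big_cons -addrA [X in _ + X]addrC.
Qed.

Lemma add_linesP (I : eqType) M (w : I -> L2 mu) (r : seq I) h : uniq r ->
  add_lines M (map w r) h <->
  exists m (c : I -> R[i]), M m /\ h = m + \sum_(i <- r) c i *: w i.
Proof.
elim: r h => [|i r IH] h /=.
  move=> _; split=> [Mh|[m [c [Mm ->]]]]; last by rewrite big_nil addr0.
  by exists h, (fun=> 0); rewrite big_nil addr0.
move=> /andP[ir ur]; split.
- move=> [x [t [/(IH _ ur)[m [c [Mm ->]]] ->]]].
  exists m, (fun j => if j == i then t else c j); split=> //.
  rewrite big_cons eqxx -addrA; congr (_ + _); rewrite addrC; congr (_ + _).
  apply: eq_big_seq => j jr; case: eqP => // ji.
  by move: ir; rewrite -ji jr.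
- move=> [m [c [Mm ->]]]; exists (m + \sum_(j <- r) c j *: w j), (c i).
  split; last by rewrite big_cons -addrA [X in _ + X]addrC.
  by apply/(IH _ ur); exists m, c.
Qed.

End FiniteCodimension.

Opaque chi chi2 orth_proj.

(** * The projection onto [chi A L] *)

Section CompressedProjection.
Context {d} {T : measurableType d} {R : realType}.
Variable mu : {measure set T -> \bar R}.
Implicit Types (f g h : L2 mu) (K S : L2 mu -> L2 mu).

Lemma positive_op_re K : is_adjoint K K -> (forall f, 0 <= rdot (K f) f) ->
  positive_op K.
Proof.
move=> sK K0 f; have := K0 f; rewrite /rdot lecE /=.
have : Im (dot (K f) f) = 0.
  by have := dotC (K f) f; rewrite -sK; case: (dot (K f) f) => x y /= [yy]; lra.
by move=> -> ->; rewrite eqxx.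
Qed.

Lemma ler_complement (a x y : R) : a * (x + y) <= x -> y <= (1 - a) * (x + y).
Proof. by move=> h; rewrite mulrBl mul1r lerBrDr addrC lerD2r. Qed.

(** For a positive operator a form bound [r] is an operator norm bound [r], by Cauchy-Schwarz for
    the form at [f] and [S f]. *)
Lemma positive_op_nsq_le S (r : R) : linear S -> positive_op S -> 0 <= r ->
  (forall f, rdot (S f) f <= r * nsq f) -> forall f, nsq (S f) <= r ^+ 2 * nsq f.
Proof.
move=> lS pS r0 Sr f; have := pos_form_CS f (S f) lS pS; rewrite -/(nsq (S f)).
have h1 := Sr f; have h2 := Sr (S f).
have p1 := pos_re f pS; have p2 := pos_re (S f) pS.
have [->|xn] := eqVneq (nsq (S f)) 0; first by rewrite mulr_ge0 ?sqr_ge0 ?nsq_ge0.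
have xp : 0 < nsq (S f) by rewrite lt_neqAle eq_sym xn nsq_ge0.
move=> h3; rewrite -(ler_pM2r xp) -expr2; apply: le_trans h3 _.
apply: le_trans (ler_pM p1 p2 h1 h2) _.
by rewrite expr2 mulrACA mulrA.
Qed.

Variables (A : set T) (L : set (L2 mu)) (c : R).
Hypotheses (mA : measurable A) (cL : closed_subspace L) (c0 : 0 < c).
Hypothesis c1 : c <= 1.
Hypothesis Lc : forall l, L l -> c * nsq l <= nsq (chi2 A l).

Local Notation Q := (orth_proj L).
Local Notation P := (orth_proj (chi2 A @` L)).
Let mC : measurable (~` A) := measurableC mA.

Lemma chi2_image_closed : closed_subspace (chi2 A @` L).
Proof. by apply: image_closed => //; [exact: chi2_bounded|exists c]. Qed.

Definition proj_defect f := P f - chi2 A (Q (chi2 A f)).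

Lemma proj_defect_bounded : bounded_op proj_defect.
Proof.
apply: bounded_opB; first exact/orth_proj_bounded/chi2_image_closed.
by apply: (compress_bounded mA); exact: orth_proj_bounded.
Qed.

Lemma proj_defect_adjoint : is_adjoint proj_defect proj_defect.
Proof.
move=> f g; rewrite /proj_defect dotBl dotBr; congr (_ - _).
  exact: (orth_proj_sym chi2_image_closed).
by rewrite (dot_chi2 _ _ mA) (orth_proj_sym cL) (dot_chi2 _ _ mA).
Qed.

(* Write [P f = chi A l] with [l] in [L]. Then [l = a + b] with
   [a = Q (chi A f)] and [b = Q (chi (~` A) l)], and the quadratic form of the
   defect at [f] is [<b, a>]. *)
Lemma proj_defect_bounds f : 0 <= rdot (proj_defect f) f <=
  c^-1 * nsq (chi2 (~` A) (Q (chi2 A f))).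
Proof.
have [lL _] := cL.
have [l Ll lE] := orth_proj_in chi2_image_closed f.
have [a aD] := ex_intro (fun x => x = Q (chi2 A f)) _ erefl.
have [b bD] := ex_intro (fun x => x = Q (chi2 (~` A) l)) _ erefl.
have La : L a by rewrite aD; exact: orth_proj_in.
have Lb : L b by rewrite bD; exact: orth_proj_in.
have aE : Q (chi2 A l) = a.
  apply: orth_proj_eq => // h Lh.
  have /(orth_proj_dot chi2_image_closed f) : (chi2 A @` L) (chi2 A h) by exists h.
  rewrite -lE dotBl -!dot_chi2// chi2_chi2// setIid => /eqP.
  rewrite subr_eq0 => /eqP fl; rewrite dotBl -fl aD.
  by rewrite (orth_proj_dotE cL (chi2 A f) Lh) subrr.
have lab : l = a + b.
  rewrite -[LHS](orth_proj_id cL Ll) -{1}(chi2_setC l mA).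
  by rewrite (opD _ _ (orth_proj_linear cL)) aE bD.
have aQ h : L h -> rdot a h = rdot (chi2 A f) h.
  by move=> Lh; rewrite aD /rdot -(orth_proj_dotE cL _ Lh).
have bQ h : L h -> rdot b h = rdot (chi2 (~` A) l) h.
  by move=> Lh; rewrite bD /rdot -(orth_proj_dotE cL _ Lh).
have CE g h : rdot (chi2 (~` A) g) h = rdot (chi2 (~` A) g) (chi2 (~` A) h).
  by rewrite -[RHS](rdot_chi2 _ _ mC) (chi2_chi2 _ mC mC) setIid.
have e1 : rdot (P f) f = rdot a l.
  by rewrite -lE (rdot_chi2 l f mA) (rdotC l) aQ.
have e2 : rdot (chi2 A a) f = rdot a a.
  by rewrite (rdot_chi2 a f mA) (rdotC a) [RHS]aQ.
have DE : rdot (proj_defect f) f = rdot b a.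
  rewrite /proj_defect -aD rdotBl e1 e2 lab rdotDr (rdotC a b).
  by rewrite addrAC subrr add0r.
have [X XD] := ex_intro (fun x => x = nsq (chi2 (~` A) l)) _ erefl.
have [Y YD] := ex_intro (fun x => x = nsq (chi2 (~` A) a)) _ erefl.
have bl : rdot b l = X by rewrite XD (bQ l Ll) (CE l l).
have bl' : rdot b l = rdot b a + nsq b by rewrite -rdotDr -lab.
have Db : rdot b a ^+ 2 <= X * Y by rewrite XD YD (bQ _ La) CE rdot_CS.
(* [nsq b] is the pairing of [l] and [b] over the complement of [A], where the lower bound [Lc]
   leaves [b] at most the fraction [1 - c] of its mass. *)
have b2 : nsq b ^+ 2 <= X * ((1 - c) * nsq b).
  apply: (@le_trans _ _ (X * nsq (chi2 (~` A) b))).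
    by rewrite {1}/nsq (bQ _ Lb) CE XD rdot_CS.
  rewrite ler_wpM2l ?XD ?nsq_ge0//; have := Lc Lb; rewrite (nsq_chi2_setC b mA).
  exact: ler_complement.
have B0 := nsq_ge0 b; have X0 : 0 <= X by rewrite XD nsq_ge0.
have Y0 : 0 <= Y by rewrite YD nsq_ge0.
have D0 : 0 <= rdot b a.
  have := nsq_orth_proj_le cL (chi2 (~` A) l); rewrite -bD -XD.
  by rewrite -bl bl' lerDr.
rewrite DE D0 /= -aD -YD.
move: (nsq b) (rdot b a) (rdot b l) bl bl' Db b2 B0 D0.
move=> B D Z -> XE Db b2 B0 D0.
have BX : B <= (1 - c) * X.
  have [->|Bn] := eqVneq B 0; first by rewrite mulr_ge0// subr_ge0.
  have Bp : 0 < B by rewrite lt_neqAle eq_sym Bn.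
  by rewrite -(ler_pM2r Bp) -expr2 (le_trans b2)// mulrCA mulrA.
(* [X = D + B] and [B <= (1 - c) * X]. Together with [D ^+ 2 <= X * Y] this yields [c * D <= Y]. *)
have cX : c * X <= D.
  by move: BX; rewrite mulrBl mul1r lerBrDr addrC [leRHS]XE lerD2r.
rewrite -(ler_pM2l c0) mulrA mulfV ?gt_eqF// mul1r.
have [->|Dn] := eqVneq D 0; first by rewrite mulr0.
have Dp : 0 < D by rewrite lt_neqAle eq_sym Dn.
rewrite -(ler_pM2r Dp) -mulrA -expr2; apply: le_trans (ler_wpM2l (ltW c0) Db) _.
by rewrite mulrA mulrC ler_wpM2l.
Qed.

End CompressedProjection.

(** * Finite-dimensional spaces of locally square integrable functions *)

Section UltrafilterCompactness.
Context {R : realType}.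
Variables (F : set_system nat) (FU : UltraFilter F).

(** The limit is the supremum of the [t] that lie below [x n] for [F]-almost every [n]. *)
Lemma ultra_real (x : nat -> R) (C : R) : F [set n | `|x n| <= C] ->
  exists l, forall e, 0 < e -> F [set n | `|x n - l| <= e].
Proof.
move=> FC; pose S := [set t : R | F [set n | t <= x n]].
have SC t : S t -> t <= C.
  move=> St; have [n [/= tx xC]] := filter_ex (filterI St FC).
  by rewrite (le_trans tx)// (le_trans (ler_norm _)).
have hS : has_sup S.
  split; last by exists C => t /SC.
  by exists (- C); apply: filterS FC => n /=; rewrite ler_norml => /andP[].
exists (sup S) => e e0.
have [t St lt_t] := sup_adherent e0 hS.
have F2 : F [set n | x n < sup S + e].
  have [//|Fn] := in_ultra_setVsetC [set n | x n < sup S + e] FU.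
  have Se : S (sup S + e) by apply: filterS Fn => n /= /negP; rewrite -leNgt.
  have := ub_le_sup hS.2 Se; rewrite gerDl leNgt e0//.
apply: filterS2 St F2 => n /= tx xs.
by rewrite ler_distl (ltW xs) andbT (le_trans (ltW lt_t)).
Qed.

Context {d} {T : measurableType d}.
Variable mu : {measure set T -> \bar R}.
Implicit Types (M : set (L2 mu)) (f g u v w : L2 mu).

(** Compactness of bounded sets along a fixed ultrafilter: in the induction on the dimension no
    subsequence has to be extracted. *)
Definition ultra_compact M := forall (x : nat -> L2 mu) (C : R),
  (forall n, M (x n)) -> F [set n | nsq (x n) <= C] ->
  exists g, M g /\ forall e : R, 0 < e -> F [set n | nsq (x n - g) <= e].

Lemma norm_le_of_sqr (a C : R) : a ^+ 2 <= C -> `|a| <= C + 1.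
Proof. by rewrite -real_normK ?num_real// => h; have := normr_ge0 a; nra. Qed.

Lemma ultra_compact0 : ultra_compact [set 0].
Proof.
move=> x C x0 _; exists 0; split=> // e e0; apply: filterE => n /=.
by rewrite x0 subrr nsq0 ltW.
Qed.

(** The projection onto [M] and the scalar coordinate along [u] are both bounded, so each converges
    along [F]. *)
Lemma ultra_compact_line M v : closed_subspace M -> ultra_compact M ->
  ultra_compact (add_line M v).
Proof.
move=> cM UM x C Nx xC; have [cN [u [u1 Nu um PE]]] := proj_add_line v cM.
have [lN _] := cN.
have xE n : x n = orth_proj M (x n) + dot (x n) u *: u.
  by rewrite -PE orth_proj_id.
have [g [Mg gP]] : exists g, M g /\ forall e : R, 0 < e ->
    F [set n | nsq (orth_proj M (x n) - g) <= e].
  apply: (UM _ C) => [n|]; first exact: orth_proj_in.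
  by apply: filterS xC => n /=; exact/le_trans/nsq_orth_proj_le.
have tC : F [set n | normc (dot (x n) u) ^+ 2 <= C].
  apply: filterS xC => n /=; apply: le_trans; apply: le_trans (dot_CS _ _) _.
  by rewrite ler_piMr ?nsq_ge0.
have [a aP] : exists l, forall e, 0 < e -> F [set n | `|Re (dot (x n) u) - l| <= e].
  apply: (@ultra_real _ (C + 1)); apply: filterS tC => n /=; rewrite normc2E => h.
  by apply: norm_le_of_sqr; apply: le_trans h; rewrite lerDl sqr_ge0.
have [b bP] : exists l, forall e, 0 < e -> F [set n | `|Im (dot (x n) u) - l| <= e].
  apply: (@ultra_real _ (C + 1)); apply: filterS tC => n /=; rewrite normc2E => h.
  by apply: norm_le_of_sqr; apply: le_trans h; rewrite lerDr sqr_ge0.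
exists (g + (a +i* b) *: u); split.
  by apply: (subspaceD lN); [exact: add_line_sub|exact: subspaceZ].
have sq (y e : R) : 0 < e -> `|y| <= Num.sqrt e -> y ^+ 2 <= e.
  move=> e0 ye; rewrite -(sqr_sqrtr (ltW e0)) -real_normK ?num_real//.
  by rewrite ler_pXn2r ?nnegrE ?sqrtr_ge0.
move=> e e0; have e80 : 0 < e / 8 by rewrite divr_gt0.
have s80 : 0 < Num.sqrt (e / 8) by rewrite sqrtr_gt0.
apply: filterS3 (gP _ e80) (aP _ s80) (bP _ s80) => n /= h1 /(sq _ _ e80) h2 /(sq _ _ e80) h3.
rewrite {1}(xE n) opprD addrACA -scalerBl; apply: le_trans (nsqD_le _ _) _.
rewrite nsqZ normc2E.
have h4 : ((Re (dot (x n) u - (a +i* b))) ^+ 2 +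
  (Im (dot (x n) u - (a +i* b))) ^+ 2) * nsq u <= e / 4.
  apply: (@le_trans _ _ (e / 8 + e / 8)).
    rewrite -[leRHS]mulr1; apply: ler_pM; rewrite ?nsq_ge0 ?addr_ge0 ?sqr_ge0//.
    by move: h2 h3; case: (dot (x n) u) => p q /= h2 h3; exact: lerD.
  by move: {e80 s80 sq h1 h2 h3} e e0 => e e0; lra.
by move: e0 h1 h4; set p := nsq _; set q := _ * nsq u; move: p q => p q; lra.
Qed.

Lemma ultra_compact_lines M ws : closed_subspace M -> ultra_compact M ->
  ultra_compact (add_lines M ws).
Proof.
move=> cM UM; elim: ws => [//|w ws IH].
by apply: ultra_compact_line => //; case: (proj_add_lines ws cM).
Qed.

End UltrafilterCompactness.

(** * Restrictions to a set of the span of finitely many classes *)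

Section FiniteDimensional.
Context {d} {T : measurableType d} {R : realType}.
Variable mu : {measure set T -> \bar R}.
Implicit Types (M : set (L2 mu)) (f g h w : L2 mu) (u v : L0 mu).

Lemma closed_subspace0 : closed_subspace [set (0 : L2 mu)].
Proof.
split; first by split=> // a f g /= -> ->; rewrite scaler0 addr0.
apply/norm_closed_nsq => f hf; apply: nsq_eq0; apply/eqP.
rewrite eq_le nsq_ge0 andbT; apply/ler_addgt0Pr => e e0; rewrite add0r.
by have [_ /= ->] := hf _ e0; rewrite subr0.
Qed.

Lemma bounded_below_lines X ws : bounded_op X ->
  (forall h, add_lines [set (0 : L2 mu)] ws h -> X h = 0 -> h = 0) ->
  bounded_below X (add_lines [set 0] ws).
Proof.
move=> bX; elim: ws => [|w ws IH] inj /=.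
  by exists 1 => // m ->; rewrite nsq0 mulr0 nsq_ge0.
apply: bounded_below_add_line => //; first by case: (proj_add_lines ws closed_subspace0).
by apply: IH => h Nh; apply: inj; exact: add_line_sub.
Qed.

Section Span.
Variables (k : nat) (b : 'I_k -> L0 mu).
Let V : set (L0 mu) := [set v | exists c : 'I_k -> R[i], v = \sum_i c i *: b i].

(** The default 0 is returned only if [chi A (b i)] is not square integrable; compare
    [restrict2E]. *)
Definition restrict2 (A : set T) (i : 'I_k) : L2 mu := insubd 0 (chi A (b i)).

Lemma restrict2E A i : chi A (b i) \in finL2 -> L2_val (restrict2 A i) = chi A (b i).
Proof. by move=> h; rewrite /restrict2 /insubd insubT. Qed.

Lemma span_gen i : V (b i).
Proof.
exists (fun j => (j == i)%:R); rewrite (bigD1 i)//= eqxx scale1r big1 ?addr0//.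
by move=> j /negbTE ->; rewrite scale0r.
Qed.

Lemma chi0 (A : set T) : measurable A -> chi A (0 : L0 mu) = 0.
Proof.
move=> mA; apply: L0_eqP; apply: filterS2 (chiE 0 mA) (L0_fun0 mu) => x -> ->.
by rewrite mulr0.
Qed.

Lemma chi_sum (J : Type) (r : seq J) (A : set T) (F : J -> L0 mu) : measurable A ->
  chi A (\sum_(j <- r) F j) = \sum_(j <- r) chi A (F j).
Proof.
move=> mA; elim: r => [|j r IH]; first by rewrite !big_nil chi0.
by rewrite !big_cons -[F j in LHS]scale1r chi_lin// scale1r IH.
Qed.

Lemma chiZ (A : set T) (a : R[i]) (u : L0 mu) : measurable A -> chi A (a *: u) = a *: chi A u.
Proof. by move=> mA; rewrite -[a *: u]addr0 chi_lin// chi0// addr0. Qed.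

Lemma L2_val_sum (J : Type) (r : seq J) (F : J -> L2 mu) :
  L2_val (\sum_(j <- r) F j) = \sum_(j <- r) L2_val (F j).
Proof. by elim/big_ind2: _ => // x a y c <- <-. Qed.

(** Elements of [V] need not lie in [L2], but their restrictions do. This identifies [chi A V] (for
    [M = 0]) and [chi A (L + V)] (for [M = chi A L]) with iterated line extensions inside [L2]. *)
Lemma restrict_span (A : set T) M (h : L2 mu) : measurable A ->
  (forall v, V v -> chi A v \in finL2) ->
  add_lines M (map (restrict2 A) (enum 'I_k)) h <->
  exists m v, [/\ M m, V v & L2_val h = L2_val m + chi A v].
Proof.
move=> mA VA; rewrite (add_linesP _ _ _ (enum_uniq _)).
have E c : L2_val (\sum_(i <- enum 'I_k) c i *: restrict2 A i) =
    chi A (\sum_i c i *: b i).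
  rewrite L2_val_sum chi_sum// big_enum; apply: eq_bigr => i _.
  by rewrite L2_valZ (restrict2E (VA _ (span_gen i))) (chiZ _ _ mA).
split.
- move=> [m [c [Mm ->]]]; exists m, (\sum_i c i *: b i); split=> //.
    by exists c.
  by rewrite L2_valD E.
- move=> [m [_ [Mm [c ->] hE]]]; exists m, c; split=> //.
  by apply: val_inj; rewrite /= hE -E.
Qed.

End Span.

End FiniteDimensional.

(** * Decay on fixed sets of elements of [V] bounded on large sets *)

Section Decay.
Context {d} {T : measurableType d} {R : realType}.
Variable mu : {measure set T -> \bar R}.
Variables (k : nat) (b : 'I_k -> L0 mu).
Let V : set (L0 mu) := [set v | exists c : 'I_k -> R[i], v = \sum_i c i *: b i].
Variable E0 : set T.
Hypothesis mE0 : measurable E0.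
Hypothesis VE0 : forall v, V v -> chi E0 v \in finL2.
Hypothesis injE0 : forall v, V v -> chi E0 v = 0 -> v = 0.

Lemma span_sub u v : V u -> V v -> V (u - v).
Proof.
move=> [c ->] [c' ->]; exists (fun i => c i - c' i).
by rewrite -sumrB; apply: eq_bigr => i _; rewrite scalerBl.
Qed.

Lemma chi_sub (D : set T) (u v : L0 mu) : measurable D ->
  chi D (u - v) = chi D u - chi D v.
Proof. by move=> mD; rewrite addrC -scaleN1r chi_lin// scaleN1r addrC. Qed.

(** [chi E0] is injective on the finite-dimensional space [chi D V], hence bounded below there; [K]
    depends on [D]. *)
Lemma norm_equiv (D : set T) : measurable D -> E0 `<=` D ->
  (forall v, V v -> chi D v \in finL2) ->
  exists2 K : R, 0 < K & forall v (g g0 : L2 mu), V v -> L2_val g = chi D v ->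
    L2_val g0 = chi E0 v -> nsq g <= K * nsq g0.
Proof.
move=> mD ED VD.
have restr v (g : L2 mu) : L2_val g = chi D v -> L2_val (chi2 E0 g) = chi E0 v.
  by move=> gE; rewrite L2_val_chi2 gE chi_chi// (setIidl ED).
have [h Wh h0|c c0 hc] := @bounded_below_lines _ _ _ mu (chi2 E0)
    (map (restrict2 b D) (enum 'I_k)) (chi2_bounded mu mE0).
  have [m [v [m0 Vv hE]]] := (restrict_span [set 0] h mD VD).1 Wh.
  have hD : L2_val h = chi D v by rewrite hE m0 add0r.
  apply: val_inj; rewrite /= hD (injE0 Vv) ?chi0//.
  by rewrite -(restr _ _ hD) h0.
exists c^-1; first by rewrite invr_gt0.
move=> v g g0 Vv gE g0E; rewrite mulrC ler_pdivlMr// mulrC.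
have -> : g0 = chi2 E0 g by apply: val_inj; rewrite [RHS](restr _ _ gE).
apply: hc; apply/(restrict_span [set 0] g mD VD).
by exists 0, v; split=> //; rewrite gE add0r.
Qed.

Variable A : nat -> set T.
Hypothesis mA : forall n, measurable (A n).
Hypothesis iA : forall n, A n `<=` A n.+1.
Hypothesis AT : \bigcup_n A n = setT.
Hypothesis EA : forall n, E0 `<=` A n.
Hypothesis VA : forall n v, V v -> chi (A n) v \in finL2.
Hypothesis VL2 : forall v, V v -> v \in finL2 -> v = 0.

(* A failure of the decay produces, by compactness of bounded sets in the finite
   dimensional space [chi E0 V], a nonzero element of [V] in [L2]. *)
Lemma decay_E0 (C e : R) : 0 < e -> exists N, forall n, (N <= n)%N ->
  forall v (g g0 : L2 mu), V v -> L2_val g = chi (A n) v -> nsq g <= C ->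
  L2_val g0 = chi E0 v -> nsq g0 <= e.
Proof.
move=> e0; apply: contrapT => /forallNP nd.
have bad N : exists p : nat * L0 mu * L2 mu * L2 mu,
    [/\ (N <= p.1.1.1)%N, V p.1.1.2, L2_val p.1.2 = chi (A p.1.1.1) p.1.1.2 /\
        nsq p.1.2 <= C, L2_val p.2 = chi E0 p.1.1.2 & e < nsq p.2].
  apply: contrapT => /forallNP h; apply: (nd N) => n Nn v g g0 Vv gE gC g0E.
  by rewrite leNgt; apply/negP => eg; apply: (h (n, v, g, g0)).
pose p N := projT1 (cid (bad N)).
have pP N : [/\ (N <= (p N).1.1.1)%N, V (p N).1.1.2,
    L2_val (p N).1.2 = chi (A (p N).1.1.1) (p N).1.1.2 /\ nsq (p N).1.2 <= C,
    L2_val (p N).2 = chi E0 (p N).1.1.2 & e < nsq (p N).2] := projT2 (cid (bad N)).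
(* [F] refines the filter of cofinite sets, so what holds [F]-almost everywhere holds for some
   arbitrarily large index. *)
have [F [FU Foo]] := @ultraFilterLemma _ (\oo : set_system nat) _.
have UC := @ultra_compact_lines _ F FU _ _ mu [set 0] (map (restrict2 b E0) (enum 'I_k))
  (closed_subspace0 mu) (@ultra_compact0 _ F FU _ _ mu).
have x0E N : (p N).2 = chi2 E0 (p N).1.2.
  have [_ _ [gE _] g0E _] := pP N.
  by apply: val_inj; rewrite [RHS]L2_val_chi2 [LHS]g0E gE chi_chi// (setIidl (EA _)).
have [N||g [Wg gP]] := UC (fun N => (p N).2) C.
- have [_ Vv _ g0E _] := pP N.
  by apply/(restrict_span [set 0] _ mE0 VE0); exists 0, (p N).1.1.2; rewrite add0r.
- apply: filterE => N /=; have [_ _ [_ gC] _ _] := pP N.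
  by rewrite x0E (le_trans (nsq_chi2_le _ mE0)).
have [m0 [v [m00 Vv gE]]] := (restrict_span [set 0] g mE0 VE0).1 Wg.
have {m0 m00} gE : L2_val g = chi E0 v by rewrite gE m00 add0r.
have vL2 : v \in finL2.
  (* The restriction of [v] to [A m] is within distance 1 of that of some bad vector, whose [nsq] is
     at most [C]; [nsqD_le] doubles both. *)
  apply: (nondecreasing_finL2 (c := 2 * C + 2) mA iA AT) => m.
  have [gm gmE] : exists gm : L2 mu, L2_val gm = chi (A m) v.
    by exists (MkL2 (VA m Vv)).
  exists gm => //.
  have [K K0 KP] := norm_equiv (mA m) (EA m) (VA m).
  have Ki : 0 < K^-1 by rewrite invr_gt0.
  have Fm : F [set N | (m <= N)%N] by apply: Foo; exists m.
  have [N [/= gN mN]] := filter_ex (filterI (gP _ Ki) Fm).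
  have [Nn VvN [gNE gNC] g0NE _] := pP N.
  have mn : (m <= (p N).1.1.1)%N := leq_trans mN Nn.
  have h1 : nsq (gm - chi2 (A m) (p N).1.2) <= 1.
    apply: le_trans (KP (v - (p N).1.1.2) _ (g - (p N).2) _ _ _) _.
    + exact: span_sub.
    + rewrite L2_valB gmE chi_sub//; congr (_ - _); rewrite L2_val_chi2 gNE chi_chi//.
      by rewrite (setIidl (subset_nondecreasing iA mn)).
    + by rewrite L2_valB gE g0NE chi_sub.
    + by rewrite -nsqN opprB mulrC -ler_pdivlMr// mul1r.
  rewrite -(subrK (chi2 (A m) (p N).1.2) gm) (le_trans (nsqD_le _ _))//.
  rewrite addrC lerD//; last by rewrite -[leRHS]mulr1 ler_pM2l.
  by rewrite ler_pM2l// (le_trans (nsq_chi2_le _ (mA m))).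
have v0 := VL2 Vv vL2.
(* Contradiction: [g] is a limit of vectors whose [nsq] exceeds [e]. *)
have g0 : g = 0 by apply: val_inj; rewrite /= gE v0 chi0.
have [N /=] := filter_ex (gP _ e0); rewrite g0 subr0.
by have [_ _ _ _ eN] := pP N; rewrite leNgt eN.
Qed.

Lemma decay (C e : R) (D : set T) : 0 < e -> measurable D -> E0 `<=` D ->
  (forall v, V v -> chi D v \in finL2) ->
  exists N, forall n, (N <= n)%N ->
  forall v (g h : L2 mu), V v -> L2_val g = chi (A n) v -> nsq g <= C ->
  L2_val h = chi D v -> nsq h <= e.
Proof.
move=> e0 mD ED VD; have [K K0 KP] := norm_equiv mD ED VD.
have [N hN] := decay_E0 C (divr_gt0 e0 K0); exists N => n Nn v g h Vv gE gC hE.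
have g0E : L2_val (MkL2 (VE0 Vv)) = chi E0 v by [].
apply: le_trans (KP _ _ _ Vv hE g0E) _; rewrite mulrC -ler_pdivlMr//.
exact: hN Vv gE gC g0E.
Qed.

End Decay.

(** * The angle condition as a bound on projections *)

Section AngleCondition.
Context {d} {T : measurableType d} {R : realType}.
Variable mu : {measure set T -> \bar R}.
Implicit Types (f g h u : L2 mu).

Lemma trace_norm_ge0 (K : L2 mu -> L2 mu) : bounded_op K -> is_adjoint K K ->
  (0 <= trace_norm K)%E.
Proof.
move=> bK sK; apply: esum_ge0 => e _; rewrite lee_fin.
have [->|[_ pS _]] := abs_op_cases bK sK; first by rewrite dot0l.
exact: (pos_re e pS).
Qed.

(** The angle is tested on [g] and its projection [p], where the cosine is [|p| / |g|]. Truncating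
    [alpha] at [pi / 2] stays where the cosine is decreasing and nonnegative. *)
Lemma angle_proj_le (M : set (L2 mu)) (N : set (L2 mu)) (alpha : R) :
  closed_subspace M -> 0 < alpha -> (alpha%:E <= angle M N)%E ->
  forall g, N g -> nsq (orth_proj M g) <= cos (Num.min alpha (pi / 2)) ^+ 2 * nsq g.
Proof.
move=> cM a0 ang g Ng; set p := orth_proj M g.
have rhs0 : 0 <= cos (Num.min alpha (pi / 2)) ^+ 2 * nsq g.
  by rewrite mulr_ge0 ?sqr_ge0 ?nsq_ge0.
have [p0|pn] := eqVneq p 0; first by rewrite p0 nsq0.
have [g0|gn] := eqVneq g 0; first by move: pn; rewrite /p g0 (op0 (orth_proj_linear cM)) eqxx.
have np : 0 < L2norm p.
  by rewrite lt_neqAle L2norm_ge0 andbT eq_sym; apply: contra_neq pn => /L2norm_eq0.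
have ng : 0 < L2norm g.
  by rewrite lt_neqAle L2norm_ge0 andbT eq_sym; apply: contra_neq gn => /L2norm_eq0.
have : (alpha%:E <= (vect_angle p g)%:E)%E.
  apply: le_trans ang _; apply: ereal_inf_lbound; exists p, g; split=> //.
  exact: orth_proj_in.
rewrite lee_fin /vect_angle -/(rdot p g) rdot_orth_proj// -/p -L2norm2.
set t := _ / _ => at_.
have tE : t = L2norm p / L2norm g.
  by rewrite /t expr2 -mulf_div divff ?mul1r// gt_eqF.
have t0 : 0 <= t by rewrite tE divr_ge0// ltW.
have t1 : t <= 1.
  by rewrite tE ler_pdivrMr// mul1r L2norm_le nsq_orth_proj_le.
have tI : -1 <= t <= 1 by rewrite t1 andbT (le_trans _ t0)// lerN10.
have pi0 : 0 < pi :> R := pi_gt0 R.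
have tc : t <= cos (Num.min alpha (pi / 2)).
  have b1 : Num.min alpha (pi / 2) \in `[0, pi].
    rewrite in_itv/= le_min (ltW a0) divr_ge0 ?(ltW pi0)//= ge_min.
    by rewrite ler_pdivrMr// ler_peMr ?(ltW pi0) ?ler1n ?orbT.
  have b2 : acos t \in `[0, pi] by rewrite in_itv/= acos_ge0// acos_lepi.
  by rewrite -[leLHS](acosK tI) leNgt (ltr_cos b2 b1) -leNgt ge_min at_.
rewrite -(L2norm2 g) -exprMn ler_pXn2r ?nnegrE ?mulr_ge0 ?(ltW np) ?(ltW ng)//.
  by rewrite -ler_pdivrMr// -tE.
exact: le_trans t0 tc.
Qed.

Lemma cos_min_lt1 (alpha : R) : 0 < alpha -> 0 <= cos (Num.min alpha (pi / 2)) ^+ 2 < 1.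
Proof.
move=> a0; rewrite sqr_ge0/=; have pi0 : 0 < pi :> R := pi_gt0 R.
set beta := Num.min _ _.
have b0 : 0 < beta by rewrite lt_min a0 divr_gt0.
have b2 : beta <= pi / 2 by rewrite ge_min lexx orbT.
have c0 : 0 <= cos beta.
  by apply: cos_ge0_pihalf; rewrite b2 andbT (le_trans _ (ltW b0))// oppr_le0 divr_ge0// ltW.
rewrite -[ltRHS](expr1n _ 2) ltr_pXn2r ?nnegrE// -cos0 ltr_cos ?in_itv//= ?lexx ?(ltW pi0)//.
by rewrite (ltW b0) (le_trans b2)// ler_pdivrMr// ler_peMr ?(ltW pi0)// ler1n.
Qed.

End AngleCondition.

Opaque nsq.

(** * Convergence of the projections *)

Section Perturbation.
Context {d} {T : measurableType d} {R : realType}.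
Variable mu : {measure set T -> \bar R}.
Implicit Types (f g h u : L2 mu).

Lemma form_trace_sum_dot (us : seq (L2 mu)) :
  form_trace_le (fun f => \sum_(u <- us) normc (dot f u) ^+ 2) (\sum_(u <- us) nsq u).
Proof.
elim: us => [|u us IH].
  move=> p _ _; rewrite big_nil; under eq_esum do rewrite big_nil.
  by rewrite esum1.
rewrite big_cons; have := form_traceD (form_trace_dot u) IH.
apply: form_trace_sub => f; by rewrite big_cons.
Qed.

Lemma chi2C (A D : set T) f : measurable A -> measurable D ->
  chi2 A (chi2 D f) = chi2 D (chi2 A f).
Proof. by move=> mA mD; rewrite !chi2_chi2// setIC. Qed.

Lemma dot_sumZ f (us : seq (L2 mu)) :
  rdot (\sum_(u <- us) dot f u *: u) f = \sum_(u <- us) normc (dot f u) ^+ 2.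
Proof.
rewrite /rdot dot_suml Re_sum; apply: eq_bigr => u _.
rewrite dotZl (dotC u) normc2E; case: (dot f u) => x y /=; ring.
Qed.

Variables (A D : set T) (L : set (L2 mu)) (c : R) (us : seq (L2 mu)).
Hypotheses (mA : measurable A) (mD : measurable D) (cL : closed_subspace L).
Hypotheses (c0 : 0 < c) (c1 : c <= 1).
Hypothesis Lc : forall l, L l -> c * nsq l <= nsq (chi2 A l).
Local Notation Q := (orth_proj L).
Let mC : measurable (~` A) := measurableC mA.

Variable Pi : L2 mu -> L2 mu.
Hypotheses (bPi : bounded_op Pi) (sPi : is_adjoint Pi Pi).
Hypothesis PiE : forall f,
  Pi f = orth_proj (chi2 A @` L) f + \sum_(u <- us) dot f u *: u.

Lemma rdot_Pi f : rdot (Pi f) f = nsq (Q (chi2 A f)) +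
  rdot (proj_defect A L f) f + \sum_(u <- us) normc (dot f u) ^+ 2.
Proof.
rewrite PiE rdotDl dot_sumZ; congr (_ + _).
have -> : nsq (Q (chi2 A f)) = rdot (chi2 A (Q (chi2 A f))) f.
  by rewrite (rdot_chi2 _ _ mA) rdot_orth_proj.
by rewrite -rdotDl /proj_defect addrC subrK.
Qed.

(** Young's inequality for the cross term, from [|eta f + g|^2 >= 0] and [|eta f - g|^2 >= 0]
    divided by [eta]. *)
Lemma nsq_perturb (eta : R) f g : 0 < eta ->
  `|nsq (f - g) - nsq f| <= eta * nsq f + (eta^-1 + 1) * nsq g.
Proof.
move=> eta0; have ei0 : 0 < eta^-1 by rewrite invr_gt0.
have h1 := nsq_ge0 (eta%:C *: f + g); have h2 := nsq_ge0 (eta%:C *: f - g).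
rewrite nsqD nsqZ rdotZl /= expr0n addr0 sqr_sqrtr ?sqr_ge0// in h1.
rewrite nsqB nsqZ rdotZl /= expr0n addr0 sqr_sqrtr ?sqr_ge0// in h2.
have y0 := nsq_ge0 f; have x0 := nsq_ge0 g; rewrite nsqB.
move: (nsq f) (nsq g) (rdot f g) h1 h2 x0 y0 => x y r h1 h2 y0 x0.
have en : eta != 0 by rewrite gt_eqF.
have h1' : 0 <= eta * x + 2 * r + eta^-1 * y.
  have E : eta * (eta * x + 2 * r + eta^-1 * y) = eta ^+ 2 * x + 2 * (eta * r) + y by field.
  by rewrite -(pmulr_rge0 _ eta0) E.
have h2' : 0 <= eta * x - 2 * r + eta^-1 * y.
  have E : eta * (eta * x - 2 * r + eta^-1 * y) = eta ^+ 2 * x - 2 * (eta * r) + y by field.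
  by rewrite -(pmulr_rge0 _ eta0) E.
have e1 : (eta^-1 + 1) * y = eta^-1 * y + y by rewrite mulrDl mul1r.
rewrite ler_norml e1; move: (eta * x) (eta^-1 * y) h1' h2' => p q h1' h2'.
by apply/andP; split; lra.
Qed.

(** The first two terms come from [nsq_perturb], the third from [proj_defect_bounds] and the last
    from the rank one terms. *)
Definition majorant (eta : R) f : R :=
  eta * nsq (Q (chi2 D f)) + (eta^-1 + 1) * nsq (Q (chi2 (~` A) (chi2 D f))) +
  c^-1 * nsq (chi2 (~` A) (Q (chi2 A (chi2 D f)))) +
  \sum_(u <- map (chi2 D) us) normc (dot f u) ^+ 2.

Lemma majorant_ge0 eta f : 0 < eta -> 0 <= majorant eta f.
Proof.
move=> eta0; rewrite /majorant !addr_ge0// ?mulr_ge0 ?addr_ge0 ?invr_ge0 ?nsq_ge0 ?(ltW eta0) ?(ltW c0)//.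
by apply: sumr_ge0 => u _; exact: sqr_ge0.
Qed.

Lemma ler_dist_add (x y r s p q : R) : 0 <= s -> 0 <= r -> r <= q ->
  `|x - y| <= p -> `|x + r + s - y| <= p + q + s.
Proof. by move=> s0 r0 rq; rewrite !ler_norml => /andP[h1 h2]; apply/andP; split; lra. Qed.

Lemma rdot_diff_le (eta : R) f : 0 < eta ->
  `|rdot (compress D (fun g => Pi g - Q g) f) f| <= majorant eta f.
Proof.
move=> eta0; rewrite rdot_compress// rdotBl (rdot_orth_proj cL) rdot_Pi.
rewrite /majorant big_map.
have -> : \sum_(u <- us) normc (dot f (chi2 D u)) ^+ 2 =
    \sum_(u <- us) normc (dot (chi2 D f) u) ^+ 2.
  by apply: eq_bigr => u _; rewrite (dot_chi2 _ _ mD).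
move: (chi2 D f) => g.
have := nsq_perturb (Q g) (Q (chi2 (~` A) g)) eta0.
have -> : Q g - Q (chi2 (~` A) g) = Q (chi2 A g).
  by rewrite -{1}(chi2_setC g mA) (opD _ _ (orth_proj_linear cL)) addrK.
move=> H; have /andP[r0 rq] := proj_defect_bounds mA cL c0 c1 Lc g.
apply: (ler_dist_add _ r0 rq H).
by apply: sumr_ge0 => u _; exact: sqr_ge0.
Qed.

(** Passing to adjoints brings the indicator of the complement of [A] to the outside in [h2] and
    [h3], where [hs_chi_cvg0] makes it small. *)
Lemma form_trace_majorant (eta h1 h2 h3 h4 : R) : 0 < eta ->
  (hs (fun f => Q (chi2 D f)) <= h1%:E)%E ->
  (hs (fun f => chi2 (~` A) (chi2 D (Q f))) <= h2%:E)%E ->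
  (hs (fun f => chi2 (~` A) (Q f)) <= h3%:E)%E ->
  \sum_(u <- us) nsq (chi2 D u) <= h4 ->
  form_trace_le (majorant eta) (eta * h1 + (eta^-1 + 1) * h2 + c^-1 * h3 + h4).
Proof.
move=> eta0 H1 H2 H3 H4; apply: form_traceD; first apply: form_traceD; first apply: form_traceD.
- apply: form_traceZ; first exact: ltW.
  exact: form_trace_nsq (proj_chi_adjoint mD cL) H1.
- apply: form_traceZ; first by rewrite addr_ge0// invr_ge0 ltW.
  have adj : is_adjoint (fun f => Q (chi2 (~` A) (chi2 D f)))
      (fun f => chi2 (~` A) (chi2 D (Q f))).
    move=> f g; rewrite (orth_proj_sym cL) (dot_chi2 _ _ mC) (dot_chi2 _ _ mD).
    by rewrite (chi2C _ mD mC).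
  by apply: (form_trace_nsq adj); rewrite (hs_adjoint adj).
- apply: form_traceZ; first by rewrite invr_ge0 ltW.
  have adj : is_adjoint (fun f => chi2 (~` A) (Q (chi2 A (chi2 D f))))
      (fun f => chi2 D (chi2 A (Q (chi2 (~` A) f)))).
    by move=> f g; rewrite (dot_chi2 _ _ mC) (orth_proj_sym cL) (dot_chi2 _ _ mA) (dot_chi2 _ _ mD).
  apply: (form_trace_nsq adj); rewrite (hs_adjoint adj); apply: le_trans H3.
  rewrite -(hs_adjoint (proj_chi_adjoint mC cL)); apply: hs_le => f.
  by rewrite (le_trans (nsq_chi2_le _ mD))// nsq_chi2_le.
- apply: form_trace_lec H4 _; have := form_trace_sum_dot (map (chi2 D) us).
  by rewrite big_map.
Qed.

Lemma trace_norm_diff_le (eta h1 h2 h3 h4 : R) : 0 < eta ->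
  (hs (fun f => Q (chi2 D f)) <= h1%:E)%E ->
  (hs (fun f => chi2 (~` A) (chi2 D (Q f))) <= h2%:E)%E ->
  (hs (fun f => chi2 (~` A) (Q f)) <= h3%:E)%E ->
  \sum_(u <- us) nsq (chi2 D u) <= h4 ->
  (trace_norm (compress D (fun f => Pi f - Q f)%R) <=
   (2 * (eta * h1 + (eta^-1 + 1) * h2 + c^-1 * h3 + h4))%:E)%E.
Proof.
move=> eta0 H1 H2 H3 H4; have F := form_trace_majorant eta0 H1 H2 H3 H4.
(* One majorant bounds the form from above and from below, hence the factor 2. *)
rewrite mulr2n mulrDl mul1r.
apply: (trace_norm_le _ _ _ _ _ _ F F).
- apply: (compress_bounded mD); apply: bounded_opB => //.
  exact: (orth_proj_bounded cL).
- apply: (compress_adjoint mD) => f g.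
  by rewrite dotBl dotBr sPi (orth_proj_sym cL).
- by move=> f; exact: majorant_ge0.
- by move=> f; exact: majorant_ge0.
- by move=> f; apply: le_trans (ler_norm _) (rdot_diff_le _ _).
- move=> f; apply: le_trans (ler_norm _) _; rewrite normrN.
  exact: rdot_diff_le.
Qed.

Lemma trace_norm_Pi_fin (h1 h2 h3 : R) :
  (hs (fun f => Q (chi2 D f)) <= h1%:E)%E ->
  (hs (fun f => chi2 (~` A) (chi2 D (Q f))) <= h2%:E)%E ->
  (hs (fun f => chi2 (~` A) (Q f)) <= h3%:E)%E ->
  (trace_norm (compress D Pi) < +oo)%E.
Proof.
move=> H1 H2 H3; have F := form_trace_majorant ltr01 H1 H2 H3 (lexx _).
(* The form of [compress D Q] is added to the majorant with [eta = 1], since here [Pi] is bounded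
   and not [Pi - Q]. *)
have G := form_traceD (form_trace_nsq (proj_chi_adjoint mD cL) H1) F.
apply: le_lt_trans (ltry (_ + _)); apply: (trace_norm_le _ _ _ _ _ _ G G).
- exact: (compress_bounded mD).
- exact: (compress_adjoint mD).
- by move=> f; rewrite addr_ge0 ?nsq_ge0// majorant_ge0.
- by move=> f; rewrite addr_ge0 ?nsq_ge0// majorant_ge0.
- move=> f; have := rdot_diff_le f ltr01.
  rewrite !rdot_compress// rdotBl (rdot_orth_proj cL) => h.
  by have := le_trans (ler_norm _) h; rewrite lerBlDl.
- move=> f; have := rdot_diff_le f ltr01.
  rewrite !rdot_compress// rdotBl (rdot_orth_proj cL) => h.
  have := majorant_ge0 f ltr01; have := nsq_ge0 (Q (chi2 D f)) => n0 m0.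
  apply: (@le_trans _ _ 0); last by rewrite addr_ge0.
  have /andP[p0 _] := proj_defect_bounds mA cL c0 c1 Lc (chi2 D f).
  rewrite oppr_le0 rdot_Pi !addr_ge0 ?nsq_ge0//.
  by apply: sumr_ge0 => u _; exact: sqr_ge0.
Qed.

End Perturbation.

(** * Epsilon bookkeeping for the final estimates *)

Section RealBounds.
Context {R : realType}.
Implicit Types x y e : R.

Lemma add2_le32 x y e : x <= e / 32 -> y <= e / 32 -> 2 * x + 2 * y <= e / 8.
Proof. by lra. Qed.

Lemma add2_le8_16 x y e : x <= e / 8 -> y <= e / 16 -> 2 * x + 2 * y <= 3 * (e / 8).
Proof. by lra. Qed.

Lemma add2_le8 x y e : x <= e / 8 -> y <= 3 * (e / 8) -> 2 * x + 2 * y <= e.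
Proof. by lra. Qed.

Lemma quarter_sum x e : x <= e / 8 -> 2 * (x + e / 8 + e / 8 + e / 8) <= e.
Proof. by lra. Qed.

End RealBounds.

(** * The limit in [n] on a fixed set [D] *)

Section Convergence.
Context {d} {T : measurableType d} {R : realType}.
Variable mu : {measure set T -> \bar R}.
Implicit Types (f g h : L2 mu) (u v : L0 mu).

Lemma L2_val_inj : injective (@L2_val d T R mu).
Proof. exact: val_inj. Qed.

Lemma chiD (B : set T) u v : measurable B -> chi B (u + v) = chi B u + chi B v.
Proof. by move=> mB; rewrite -[u in LHS]scale1r chi_lin// scale1r. Qed.

Variable L : set (L2 mu).
Hypothesis cL : closed_subspace L.
Variables (k : nat) (b : 'I_k -> L0 mu).
Let V : set (L0 mu) := [set v | exists c : 'I_k -> R[i], v = \sum_i c i *: b i].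
Variable E0 : set T.
Hypothesis mE0 : measurable E0.
Hypothesis VE0 : forall v, V v -> chi E0 v \in finL2.
Hypothesis injE0 : forall v, V v -> chi E0 v = 0 -> v = 0.
Variable A : nat -> set T.
Hypothesis mA : forall n, measurable (A n).
Hypothesis iA : forall n, A n `<=` A n.+1.
Hypothesis AT : \bigcup_n A n = setT.
Hypothesis EA : forall n, E0 `<=` A n.
Hypothesis VA : forall n v, V v -> chi (A n) v \in finL2.
Hypothesis VL2 : forall v, V v -> v \in finL2 -> v = 0.
Local Notation Q := (orth_proj L).
Variables c00 c : R.
Hypothesis hsE0 : (hs (fun f => Q (chi2 (~` E0) f)) <= c00%:E)%E.
Hypotheses (c0 : 0 < c) (c1 : c <= 1).
Hypothesis E0c : forall l, L l -> c * nsq l <= nsq (chi2 E0 l).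
Variable alpha : R.
Hypothesis alpha0 : 0 < alpha.
Hypothesis ang : forall n, (alpha%:E <=
  angle (chi2 (A n) @` L) (in_L2 (chi (A n) @` V)))%E.

Let mC n : measurable (~` A n) := measurableC (mA n).

(** As [A n] contains [E0], the constant of [E0] serves for all [n]; all later estimates are uniform
    for this reason. *)
Lemma lower_bound n l : L l -> c * nsq l <= nsq (chi2 (A n) l).
Proof. by move=> Ll; apply: le_trans (E0c Ll) _; exact: nsq_chi2_sub. Qed.

Lemma compl_noninc n : ~` A n.+1 `<=` ~` A n.
Proof. by apply: subsetC; exact: iA. Qed.

Lemma compl_cap : \bigcap_n (~` A n) = set0.
Proof. by rewrite -setC_bigcup AT setCT. Qed.

Lemma hs_proj_chiE (B : set T) : measurable B ->
  hs (fun f => Q (chi2 B f)) = hs (fun f => chi2 B (Q f)).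
Proof. by move=> mB; exact: hs_adjoint (proj_chi_adjoint mB cL). Qed.

Lemma hs_E0 : (hs (fun f => chi2 (~` E0) (Q f)) <= c00%:E)%E.
Proof. by rewrite -(hs_proj_chiE (measurableC mE0)). Qed.

Lemma hs_compl_proj n : (hs (fun f => chi2 (~` A n) (Q f)) <= c00%:E)%E.
Proof.
apply: le_trans hs_E0; apply: hs_le => f.
by apply: nsq_chi2_sub => //; [exact: measurableC|apply: subsetC].
Qed.

(** [Q] itself need not be Hilbert-Schmidt. Since [E0] lies in [A n], the indicator of [E0]'s
    complement can be inserted before [Q], and that product is Hilbert-Schmidt. *)
Lemma hs_compl_cvg0 (r : R) : 0 < r -> exists N, forall n, (N <= n)%N ->
  (hs (fun f => chi2 (~` A n) (Q f)) <= r%:E)%E.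
Proof.
move=> r0; have [N hN] := hs_chi_cvg0 mC compl_noninc compl_cap hs_E0 r0.
exists N => n Nn; apply: le_trans (hN n Nn); apply: hs_le => f.
rewrite (chi2_chi2 (Q f) (mC n) (measurableC mE0)) setIidl//.
by apply: subsetC.
Qed.

Local Notation H n := (in_L2 (chi (A n) @` add_subspaces L V)).
Local Notation M n := (chi2 (A n) @` L).
Local Notation Pi n := (orth_proj (H n)).

Lemma in_L2_lines n : H n = add_lines (M n) (map (restrict2 b (A n)) (enum 'I_k)).
Proof.
apply/seteqP; split=> h.
  move=> [_ [l [v [Ll Vv ->]]] hE]; apply/(restrict_span _ _ (mA n) (VA n)).
  exists (chi2 (A n) l), v; split; [by exists l|exact: Vv|].
  by rewrite L2_val_chi2 -hE (chiD _ _ (mA n)).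
move=> /(restrict_span _ _ (mA n) (VA n))[_ [v [[l Ll <-] Vv hE]]].
exists (L2_val l + v); first by exists l, v.
by rewrite hE L2_val_chi2 (chiD _ _ (mA n)).
Qed.

Lemma M_closed n : closed_subspace (M n).
Proof. exact: (chi2_image_closed (mA n) cL c0 (@lower_bound n)). Qed.

Lemma proj_H n : closed_subspace (H n) /\ exists us : seq (L2 mu), [/\ size us = k,
    forall w, w \in us -> [/\ nsq w <= 1, H n w & forall m, M n m -> dot w m = 0] &
    forall f, Pi n f = orth_proj (M n) f + \sum_(w <- us) dot f w *: w].
Proof.
rewrite in_L2_lines.
have [cN [us [sus h1 h2]]] := proj_add_lines (map (restrict2 b (A n)) (enum 'I_k)) (M_closed n).
by split=> //; exists us; split=> //; rewrite sus size_map size_enum_ord.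
Qed.

Variable D : set T.
Hypothesis mD : measurable D.
Hypothesis VD : forall v, V v -> chi (E0 `|` D) v \in finL2.
Variable h1 : R.
Hypothesis hsD : (hs (fun f => Q (chi2 D f)) <= h1%:E)%E.

Lemma hs_D : (hs (fun f => chi2 D (Q f)) <= h1%:E)%E.
Proof. by rewrite -(hs_proj_chiE mD). Qed.

Lemma hs_compl_D n : (hs (fun f => chi2 (~` A n) (chi2 D (Q f))) <= h1%:E)%E.
Proof. by apply: le_trans hs_D; apply: hs_le => f; exact: nsq_chi2_le. Qed.

Lemma hs_compl_D_cvg0 (r : R) : 0 < r -> exists N, forall n, (N <= n)%N ->
  (hs (fun f => chi2 (~` A n) (chi2 D (Q f))) <= r%:E)%E.
Proof. exact: (hs_chi_cvg0 mC compl_noninc compl_cap hs_D). Qed.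

Lemma hs_compl_Q_cvg0 (r : R) : 0 < r -> exists N, forall n, (N <= n)%N ->
  (hs (fun f => chi2 (~` A n) (Q (chi2 D f))) <= r%:E)%E.
Proof. exact: (hs_chi_cvg0 mC compl_noninc compl_cap hsD). Qed.

(** The factor [c] in the hypothesis cancels the [c^-1] of [proj_defect_bounds], leaving a form
    bound [r] for a positive operator. *)
Lemma proj_defect_small n (r : R) f : 0 <= r ->
  (hs (fun g => chi2 (~` A n) (Q g)) <= (c * r)%:E)%E ->
  nsq (proj_defect (A n) L f) <= r ^+ 2 * nsq f.
Proof.
move=> r0 hr.
have bD := proj_defect_bounded (mA n) cL c0 (@lower_bound n).
have sD := proj_defect_adjoint (mA n) cL c0 (@lower_bound n).
have DB := proj_defect_bounds (mA n) cL c0 c1 (@lower_bound n).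
apply: positive_op_nsq_le => //; first by case: bD.
  by apply: positive_op_re => // g; case/andP: (DB g).
move=> g; have /andP[_ h] := DB g; apply: le_trans h _.
rewrite mulrC ler_pdivrMr// mulrAC [r * c]mulrC.
apply: le_trans (nsq_le_hs (X := fun x => chi2 (~` A n) (Q x)) _ _ hr) _.
  exact: is_adjoint_sym (proj_chi_adjoint (mC n) cL).
by rewrite ler_wpM2l ?nsq_chi2_le// mulr_ge0// ltW.
Qed.

(** [g] is split along [A m], with [m] free of [n]: the near part only meets contractions, the far
    part an operator whose adjoint has small Hilbert-Schmidt norm. *)
Lemma chi_proj_le m (r : R) g : (hs (fun f => chi2 (~` A m) (Q (chi2 D f))) <= r%:E)%E ->
  nsq (chi2 D (Q g)) <= 2 * nsq (chi2 (A m) g) + 2 * (r * nsq g).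
Proof.
move=> hr; have [lQ _] := orth_proj_bounded cL.
have -> : chi2 D (Q g) = chi2 D (Q (chi2 (A m) g)) + chi2 D (Q (chi2 (~` A m) g)).
  by rewrite -{1}(chi2_setC g (mA m)) (opD _ _ lQ) (opD _ _ (chi2_linear mD)).
apply: le_trans (nsqD_le _ _) _.
have q1 : nsq (chi2 D (Q (chi2 (A m) g))) <= nsq (chi2 (A m) g).
  by apply: le_trans (nsq_chi2_le _ mD) _; exact: nsq_orth_proj_le.
apply: (lerD (ler_wpM2l (ler0n _ 2) q1)); apply: (ler_wpM2l (ler0n _ 2)).
have adj : is_adjoint (fun f => chi2 D (Q (chi2 (~` A m) f)))
    (fun f => chi2 (~` A m) (Q (chi2 D f))).
  by move=> f f'; rewrite (dot_chi2 _ _ mD) (orth_proj_sym cL) (dot_chi2 _ _ (mC m)).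
by apply: (nsq_le_hs (X := fun f => chi2 D (Q (chi2 (~` A m) f))) g adj); rewrite (hs_adjoint adj).
Qed.

Let kappa := cos (Num.min alpha (pi / 2)) ^+ 2.
Let C := (1 - kappa)^-1.

Lemma kappa_lt1 : 0 < 1 - kappa.
Proof. by rewrite subr_gt0; case/andP: (cos_min_lt1 alpha0). Qed.

(** Projecting [w = chi_n l + g] onto [M n] gives [chi_n l = - P_n g]. Then [|g|^2 = |P_n g|^2 +
    |w|^2 <= kappa |g|^2 + 1], which is the origin of [C]. *)
Lemma H_decomp n w : H n w -> (forall m, M n m -> dot w m = 0) -> nsq w <= 1 ->
  exists v g, [/\ V v, L2_val g = chi (A n) v, nsq g <= C & w = g - orth_proj (M n) g].
Proof.
move=> [_ [l [v [Ll Vv ->]]] hE] wM w1.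
have cM := M_closed n; have [lM _] := cM.
pose g : L2 mu := MkL2 (VA n Vv).
have gE : L2_val g = chi (A n) v by [].
have wE : w = chi2 (A n) l + g.
  by apply: L2_val_inj; rewrite L2_valD gE L2_val_chi2 -hE (chiD _ _ (mA n)).
have Ml : M n (chi2 (A n) l) by exists l.
have w0 : w = g - orth_proj (M n) g.
  have p0 : orth_proj (M n) w = 0.
    by apply: (orth_proj_eq cM) => [|h Mh]; [case: lM|rewrite subr0 wM].
  have := p0; rewrite wE (opD _ _ (orth_proj_linear cM)) (orth_proj_id cM Ml).
  by move=> /eqP; rewrite addr_eq0 => /eqP ->; rewrite addrC.
exists v, g; split=> //.
have Hg : in_L2 (chi (A n) @` V) g by exists v.
have := angle_proj_le cM alpha0 (ang n) Hg; have := nsq_orth_proj cM g.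
rewrite -w0 -/kappa => e1 e2.
rewrite /C -[leRHS]mul1r ler_pdivlMr ?kappa_lt1//.
apply: le_trans w1; rewrite mulrBr mulr1 (mulrC _ kappa) lerBlDr.
by rewrite [leLHS]e1 addrC lerD2l.
Qed.

Lemma C_gt0 : 0 < C. Proof. by rewrite invr_gt0 kappa_lt1. Qed.

Lemma residual_decay (e : R) : 0 < e -> exists N, forall n, (N <= n)%N ->
  forall w, H n w -> (forall m, M n m -> dot w m = 0) -> nsq w <= 1 ->
  nsq (chi2 D w) <= e.
Proof.
move=> e0; have C0 := C_gt0.
have mED : measurable (E0 `|` D) by exact: measurableU.
have e80 : 0 < e / 8 by rewrite divr_gt0.
have e320 : 0 < e / 32 by rewrite divr_gt0.
have eta0 : 0 < e / 32 / C by rewrite divr_gt0.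
(* The cap at 1 lets [r] replace the [r ^+ 2] of [proj_defect_small]; the other bound absorbs
   [nsq g <= C]. *)
have [r rD] := ex_intro (fun x => x = Num.min 1 (e / 16 / C)) _ erefl.
have r0 : 0 < r by rewrite rD lt_min ltr01 !divr_gt0.
have r1 : r <= 1 by rewrite rD ge_min lexx.
have rC : r * C <= e / 16 by rewrite -ler_pdivlMr// rD ge_min lexx orbT.
have [N1 hN1] := decay mE0 VE0 injE0 mA iA AT EA VA VL2 C e80 mED (@subsetUl _ E0 D) VD.
(* [m] is fixed before [N2], which depends on the set [A m]. *)
have [m hm] := hs_compl_Q_cvg0 eta0.
have [N2 hN2] := decay mE0 VE0 injE0 mA iA AT EA VA VL2 C e320 (mA m) (EA m) (VA m).
have [N3 hN3] := hs_compl_cvg0 (mulr_gt0 c0 r0).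
exists (maxn (maxn N1 N2) (maxn N3 m)) => n.
rewrite !geq_max => /andP[/andP[n1 n2] /andP[n3 nm]] w Hw wM w1.
have [v [g [Vv gE gC ->]]] := H_decomp Hw wM w1.
have t1 : nsq (chi2 D g) <= e / 8.
  have [h hE] : exists h : L2 mu, L2_val h = chi (E0 `|` D) v by exists (MkL2 (VD Vv)).
  apply: le_trans (hN1 _ n1 v g h Vv gE gC hE).
  (* [decay] asks for a set containing [E0], so it is applied to the union of [E0] and [D]. *)
  have -> : chi2 D g = chi2 (A n `&` D) h.
    apply: L2_val_inj; rewrite !L2_val_chi2 gE hE.
    rewrite (chi_chi _ mD (mA n)) (chi_chi _ (measurableI _ _ (mA n) mD) mED).
    by rewrite -setIA (setIidl (@subsetUr _ E0 D)) setIC.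
  exact: nsq_chi2_le (measurableI _ _ (mA n) mD).
have t2 : nsq (chi2 (A m) g) <= e / 32.
  apply: (hN2 _ n2 v g (chi2 (A m) g) Vv gE gC).
  rewrite L2_val_chi2 gE (chi_chi _ (mA m) (mA n)) setIidl//.
  exact: subset_nondecreasing iA _ _ nm.
have t3 : nsq (chi2 D (Q g)) <= e / 8.
  have h := chi_proj_le g (hm m (leqnn m)).
  have eg : e / 32 / C * nsq g <= e / 32.
    by rewrite mulrAC ler_pdivrMr// ler_pM2l.
  exact: le_trans h (add2_le32 t2 eg).
have t4 : nsq (proj_defect (A n) L g) <= e / 16.
  apply: le_trans (proj_defect_small g (ltW r0) (hN3 n n3)) _.
  apply: le_trans rC; rewrite expr2 -mulrA (ler_pM2l r0).
  apply: le_trans gC; rewrite -[leRHS]mul1r ler_wpM2r//; exact: nsq_ge0.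
have gA : chi2 (A n) g = g.
  by apply: L2_val_inj; rewrite L2_val_chi2 gE (chi_chi _ (mA n) (mA n)) setIid.
have t5 : nsq (chi2 D (orth_proj (M n) g)) <= 3 * (e / 8).
  have -> : orth_proj (M n) g = chi2 (A n) (Q g) + proj_defect (A n) L g.
    by rewrite /proj_defect gA addrC subrK.
  rewrite (opD _ _ (chi2_linear mD)); apply: le_trans (nsqD_le _ _) _.
  apply: add2_le8_16; last exact: le_trans (nsq_chi2_le _ mD) t4.
  rewrite -(chi2C _ (mA n) mD); exact: le_trans (nsq_chi2_le _ (mA n)) t3.
rewrite (opB _ _ (chi2_linear mD)); apply: le_trans (nsqB_le _ _) _.
exact: add2_le8.
Qed.

Lemma sum_le_size (I : eqType) (s : seq I) (a : I -> R) (e : R) :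
  (forall x, x \in s -> a x <= e) -> \sum_(x <- s) a x <= (size s)%:R * e.
Proof.
elim: s => [|x s IH] h; first by rewrite big_nil mul0r.
rewrite big_cons /= -natr1 mulrDl mul1r addrC lerD ?h ?mem_head//.
by apply: IH => y ys; apply: h; rewrite in_cons ys orbT.
Qed.

Lemma h1_ge0 : 0 <= h1.
Proof. by rewrite -lee_fin; apply: le_trans hsD; exact: hs_ge0. Qed.

Lemma Pi_diff_cvg (e : R) : 0 < e -> exists N, forall n, (N <= n)%N ->
  (trace_norm (compress D (fun f => Pi n f - Q f)%R) <= e%:E)%E.
Proof.
move=> e0; have e80 : 0 < e / 8 by rewrite divr_gt0.
have h11 : 0 < h1 + 1 by rewrite ltr_wpDl// h1_ge0.
(* [eta] is chosen before [N1], because the coefficient [eta^-1 + 1] must be beaten by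
   [hs_compl_D_cvg0]. Each of the four terms of the bound gets [e / 8]. *)
have [eta etaD] := ex_intro (fun x => x = e / 8 / (h1 + 1)) _ erefl.
have eta0 : 0 < eta by rewrite etaD divr_gt0.
have eh : eta * h1 <= e / 8.
  by rewrite etaD mulrAC ler_pdivrMr// ler_pM2l// lerDl.
have ei0 : 0 < eta^-1 + 1 by rewrite addr_gt0// invr_gt0.
(* There are [k] residual vectors whatever [n] is, so a bound on each one suffices. *)
have k0 : 0 < k%:R + 1 :> R by rewrite ltr_wpDl.
have [N1 hN1] := hs_compl_D_cvg0 (divr_gt0 e80 ei0).
have [N2 hN2] := hs_compl_cvg0 (mulr_gt0 c0 e80).
have [N3 hN3] := residual_decay (divr_gt0 e80 k0).
exists (maxn N1 (maxn N2 N3)) => n; rewrite !geq_max => /andP[n1 /andP[n2 n3]].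
have [cH [us [sus usP PE]]] := proj_H n.
have s4 : \sum_(w <- us) nsq (chi2 D w) <= e / 8.
  apply: le_trans (sum_le_size (e := e / 8 / (k%:R + 1)) _) _.
    by move=> w /usP[w1 Hw wM]; exact: (hN3 n n3 w Hw wM w1).
  by rewrite sus mulrCA ler_piMr ?(ltW e80)// ler_pdivrMr// mul1r lerDl.
have sH : is_adjoint (Pi n) (Pi n) by move=> f g; exact: orth_proj_sym.
have := trace_norm_diff_le (mA n) mD cL c0 c1 (@lower_bound n) (orth_proj_bounded cH)
  sH PE eta0 hsD (hN1 n n1) (hN2 n n2) s4.
move=> /le_trans; apply; rewrite lee_fin.
rewrite (mulrC (eta^-1 + 1)) divfK ?gt_eqF// mulKf ?gt_eqF//.
exact: quarter_sum.
Qed.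

Lemma Pi_bounded n : bounded_op (Pi n).
Proof. by have [cH _] := proj_H n; exact: orth_proj_bounded. Qed.

Lemma Pi_trace_class n : trace_class (compress D (Pi n)).
Proof.
have [cH [us [sus usP PE]]] := proj_H n.
have sH : is_adjoint (Pi n) (Pi n) by move=> f g; exact: orth_proj_sym.
split; first exact: (compress_bounded mD (Pi_bounded n)).
exact: (trace_norm_Pi_fin (mA n) mD cL c0 c1 (@lower_bound n) (Pi_bounded n) sH PE
  hsD (hs_compl_D n) (hs_compl_proj n)).
Qed.

Lemma Pi_diff_ge0 n : (0 <= trace_norm (compress D (fun f => Pi n f - Q f)%R))%E.
Proof.
have [cH _] := proj_H n; apply: trace_norm_ge0.
  apply: (compress_bounded mD); apply: bounded_opB; first exact: Pi_bounded.
  exact: orth_proj_bounded.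
apply: (compress_adjoint mD) => f g.
by rewrite dotBl dotBr (orth_proj_sym cH) (orth_proj_sym cL).
Qed.

Lemma Pi_cvg :
  trace_norm (compress D (fun f => Pi n f - Q f)%R) @[n --> \oo] --> 0%E.
Proof.
have fin : \forall n \near \oo,
    trace_norm (compress D (fun f => Pi n f - Q f)%R) \is a fin_num.
  have [N hN] := Pi_diff_cvg ltr01; exists N => // n /= Nn.
  by rewrite ge0_fin_numE ?Pi_diff_ge0// (le_lt_trans (hN n Nn))// ltry.
apply/fine_cvgP; split=> //; apply/cvgrPdist_le => e e0.
have [N hN] := Pi_diff_cvg e0.
near=> n; rewrite /= sub0r normrN ger0_norm; last exact/fine_ge0/Pi_diff_ge0.
rewrite -lee_fin fineK; last by near: n.
by apply: hN; near: n; exists N.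
Unshelve. all: by end_near. Qed.

End Convergence.

(** * Deducing the theorem from the abstract convergence result *)

Lemma chi_setU_finL2 d (T : measurableType d) (R : realType)
    (mu : {measure set T -> \bar R}) (A B : set T) (v : L0 mu) :
  measurable A -> measurable B -> chi A v \in finL2 -> chi B v \in finL2 ->
  chi (A `|` B) v \in finL2.
Proof.
move=> mA mB vA vB; have mC := measurableC mA.
have -> : chi (A `|` B) v = chi A v + chi (~` A) (chi B v).
  apply: L0_eqP; near=> x.
  have -> : L0_fun (chi (A `|` B) v) x = (\1_(A `|` B) x)%:C * L0_fun v x.
    by near: x; apply: chiE; exact: measurableU.
  have -> : L0_fun (chi A v + chi (~` A) (chi B v)) x =
      L0_fun (chi A v) x + L0_fun (chi (~` A) (chi B v)) x by near: x; exact: L0_funD.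
  have -> : L0_fun (chi A v) x = (\1_A x)%:C * L0_fun v x by near: x; exact: chiE.
  have -> : L0_fun (chi (~` A) (chi B v)) x = (\1_(~` A) x)%:C * L0_fun (chi B v) x.
    by near: x; exact: chiE.
  have -> : L0_fun (chi B v) x = (\1_B x)%:C * L0_fun v x by near: x; exact: chiE.
  rewrite mulrA -mulrDl; congr (_ * _); rewrite !indicE in_setU in_setC.
  by case: (x \in A); case: (x \in B); rewrite /= ?mulr1 ?mulr0 ?mul0r ?addr0 ?add0r.
apply: (rpredD vA).
exact: (chi_finL2 (~` A) (MkL2 vB)).
Unshelve. all: by end_near. Qed.

Theorem corollary2p9 (R : realType) (E : completeMetricType R)
  (E_locally_compact : locally_compact [set: E])
  (E_separable : separable E)
  (E_bounded_compact :
    forall A : set E, metric_bounded A -> compact (closure A))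
  (mu : {measure set (borel E) -> \bar R})
  (mu_sigma_finite : sigma_finite [set: borel E] mu)
  (L : set (L2 mu)) (L_subspace : linear_subspace L) (L_closed : norm_closed L)
  (Q_I1loc : I1loc (orth_proj L))
  (V : set (L0 mu)) (V_finite_dim : finite_dim_subspace V)
  (V_L2loc : V `<=` L2loc (mu := mu))
  (E0 : set (borel E)) (E0_borel : measurable E0)
  (LVE0 : assumptionA L V E0)
  (V_L2 : forall v, V v -> v \in finL2 -> v = 0)
  (B : nat -> set (borel E))
  (B_bounded_borel : forall n, bounded_borel (B n))
  (B_increasing : forall n, B n `<=` B n.+1)
  (B_exhausts : \bigcup_n B n = ~` E0)
  (alpha0 : R) (alpha0_gt0 : 0 < alpha0)
  (angle_ge : forall n, (alpha0%:E <=
    angle (chi2 (E0 `|` B n) @` L) (in_L2 (chi (E0 `|` B n) @` V)))%E) :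
  I1loc_cvg
    (fun n => orth_proj (in_L2 (chi (E0 `|` B n) @` add_subspaces L V)))
    (orth_proj L).
Proof.
have cL : closed_subspace L by [].
have [A1 A2 A3 A4] := LVE0; have [k [b VE]] := V_finite_dim; subst V.
have mB n : measurable (B n) by case: (B_bounded_borel n).
have VU D : bounded_borel D -> forall v,
    (exists c : 'I_k -> R[i], v = \sum_i c i *: b i) -> chi (E0 `|` D) v \in finL2.
  move=> bD v Vv; apply: chi_setU_finL2 => //; [by case: bD|exact: A2|].
  by apply/square_integrable_onP; [case: bD|exact: V_L2loc].
have injE0 v : (exists c : 'I_k -> R[i], v = \sum_i c i *: b i) ->
    chi E0 v = 0 -> v = 0.
  (* A3 with [l = 0]. *)
  move=> Vv v0; apply: A3 => //; exists 0; first by case: L_subspace.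
  by rewrite L2_val_chi2 v0 chi0.
have [c00 _ hsE0] := hs_proj_chi (measurableC E0_borel) cL A1.
have [c' c'0 E0c'] := chi2_bounded_below E0_borel cL hsE0 A4.
have [c [c0 c1 E0c]] : exists c : R, [/\ 0 < c, c <= 1 &
    forall l, L l -> c * nsq l <= nsq (chi2 E0 l)].
  (* Capped at 1 because [proj_defect_bounds] works with [1 - c >= 0]. *)
  exists (Num.min c' 1); split; first by rewrite lt_min c'0 ltr01.
    by rewrite ge_min lexx orbT.
  move=> l Ll; apply: le_trans (E0c' l Ll).
  by rewrite ler_wpM2r ?nsq_ge0// ge_min lexx.
have mA n : measurable (E0 `|` B n) by exact: measurableU.
have iA n : E0 `|` B n `<=` E0 `|` B n.+1 by exact: setUS.
have AT : \bigcup_n (E0 `|` B n) = setT.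
  by rewrite bigcupUr ?B_exhausts ?setUv//; exists 0%N.
have EA n : E0 `<=` E0 `|` B n by exact: subsetUl.
have VA n := VU _ (B_bounded_borel n).
have hsD D : bounded_borel D -> exists h : R,
    (hs (fun f => orth_proj L (chi2 D f)) <= h%:E)%E.
  move=> bD; have [mD _] := bD.
  by have [h _ hh] := hs_proj_chi mD cL (Q_I1loc.2 D bD); exists h.
split; [|exact: Q_I1loc|].
- move=> n; split.
    exact: (Pi_bounded cL E0_borel mA EA VA c0 E0c n).
  move=> D bD; have [h hh] := hsD D bD; have [mD _] := bD.
  exact: (Pi_trace_class cL E0_borel mA EA VA hsE0 c0 c1 E0c mD hh n).
- move=> D bD; have [h hh] := hsD D bD; have [mD _] := bD.
  exact: (Pi_cvg cL E0_borel A2 injE0 mA iA AT EA VA V_L2 hsE0 c0 c1 E0c alpha0_gt0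
    angle_ge mD (VU D bD) hh).
Qed.
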